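(* Let $G$ be an étale, locally compact (not necessarily Hausdorff) groupoid with open range map and Hausdorff unit space $G^0$. Then: 1. There exists an isomorphism $\Phi\colon L^2(G)\to L^2(\mathfrak{H}G)$ of Hilbert $C^*$-modules (over $C_0(Y)\cong C_0((\mathfrak{H}G)^0)$) such that $\Phi(f\odot a)=f\,s^*(a)$ for all $f\in C_c(G)\subseteq C_c(\mathfrak{H}G)$ and $a\in C_0(Y)$. 2. The $C^*$-algebra generated by $\mathrm{Ad}_\Phi(C^*_r(G))$ and $\mathfrak{r}^*(C_0((\mathfrak{H}G)^0))$ is $C^*_r(\mathfrak{H}G)$.
   Context: Topological spaces are not assumed Hausdorff. Quasi-compact means every open cover has a finite subcover; compact means quasi-compact and Hausdorff; a space is locally compact if every point has a compact neighbourhood. A net is primitive if every cluster point is a limit point; $\lim_\nu x_\nu$ is the set of all limit points. For a locally compact space $X$, $\mathfrak{K}X$ is the set of all limit sets of primitive nets in $X$, with the topology generated by the sets $\{A\in\mathfrak{K}X\mid A\cap V\neq\emptyset\}$ ($V\subseteq X$ open) and $\{A\in\mathfrak{K}X\mid A\cap Q=\emptyset\}$ ($Q\subseteq X$ quasi-compact); $\mathfrak{H}X=\mathfrak{K}X\setminus\{\emptyset\}$ with the subspace topology, and $X\subseteq\mathfrak{H}X$ via $x\mapsto\{x\}$. A locally compact groupoid is a topological groupoid whose space is locally compact in this sense. It is étale if it is covered by open sets $V$ such that $r(V)$ is open in the unit space and $r|_V\colon V\to r(V)$ is a homeomorphism. For $A,B\subseteq G$, $A^{-1}=\{x^{-1}\mid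 x\in A\}$ and $AB=\{xy\mid x\in A,y\in B,s(x)=r(y)\}$. The space $\mathfrak{H}G$ is a locally compact Hausdorff groupoid, étale since $G$ is, with unit space $(\mathfrak{H}G)^0$ the closure of $G^0$ in $\mathfrak{H}G$, range $\mathfrak{r}(A)=AA^{-1}$, source $\mathfrak{s}(A)=A^{-1}A$, multiplication $AB$ and inversion $A^{-1}$. For an open Hausdorff $U\subseteq G$, functions in $C_c(U)$ are extended by $0$ to $G$; $C_c(G)$ is the linear span of all $C_c(U)$, $U\subseteq G$ open Hausdorff. It is a $*$-algebra with $(f*g)(x)=\sum_{z\in G^{r(x)}}f(z)g(z^{-1}x)$ and $f^*(x)=\overline{f(x^{-1})}$, where $G^{u}=r^{-1}(u)$. Each $f\in C_c(G)$ extends (uniquely) to a continuous compactly supported function on $\mathfrak{H}G$; in this way $C_c(G)\subseteq C_c(\mathfrak{H}G)$. Let $D$ be the $C^*$-subalgebra of the bounded Borel functions on $G^0$ generated by all $f|_{G^0}$, $f\in C_c(G)$; let $Y$ be the spectrum of $D$ and identify $D=C_0(Y)$. The map $f\mapsto f|_{G^0}$ is a $*$-isomorphism $C_0((\mathfrak{H}G)^0)\to C_0(Y)$, by which these two algebras are identified. For $a\in C_0(Y)$, $s^*(a)$ is the function $x\mapsto a(s(x))$ on $G$ (equivalently $A\mapsto a(\mathfrak{s}(A))$ on $\mathfrak{H}G$). $L^2(G)$ is the separated completion of the algebraic tensor product $C_c(G)\odot C_0(Y)$ as a pre-Hilbert $C^*$-module over $C_0(Y)$ with $\langle f\odot a\mid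 g\odot b\rangle=a^*\cdot(f^**g)|_{G^0}\cdot b$ and $(f\odot a)b=f\odot ab$. The representation $L_G\colon C_c(G)\to\mathcal{L}(L^2(G))$ (adjointable operators) is $L_G(f)(g\odot a)=(f*g)\odot a$, and $C^*_r(G)$ is the norm closure of $L_G(C_c(G))$. $C_c(\mathfrak{H}G)$ is a $*$-algebra with $(f*g)(A)=\sum_{\mathfrak{r}(C)=\mathfrak{r}(A)}f(C)g(C^{-1}A)$, $f^*(A)=\overline{f(A^{-1})}$, and a pre-Hilbert $C^*$-module over $C_0((\mathfrak{H}G)^0)$ with $\langle f|g\rangle=(f^**g)|_{(\mathfrak{H}G)^0}$ and $(fh)(A)=f(A)h(\mathfrak{s}(A))$; $L^2(\mathfrak{H}G)$ is its completion. $L_{\mathfrak{H}G}(f)g=f*g$ defines $L_{\mathfrak{H}G}\colon C_c(\mathfrak{H}G)\to\mathcal{L}(L^2(\mathfrak{H}G))$, and $C^*_r(\mathfrak{H}G)$, the reduced $C^*$-algebra of $\mathfrak{H}G$, is the norm closure of $L_{\mathfrak{H}G}(C_c(\mathfrak{H}G))$. The representation $\mathfrak{r}^*\colon C_0((\mathfrak{H}G)^0)\to\mathcal{L}(L^2(\mathfrak{H}G))$ is $((\mathfrak{r}^*h)f)(A)=h(\mathfrak{r}(A))f(A)$ for $f\in C_c(\mathfrak{H}G)$. Finally $\mathrm{Ad}_\Phi(T)=\Phi T\Phi^{-1}$. *)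

(* Defs.v *)
From HB Require Import structures.
From mathcomp Require Import all_boot all_order all_algebra.
From mathcomp Require Import complex.
From mathcomp Require Import all_classical all_reals all_analysis.
Set Implicit Arguments.
Unset Strict Implicit.
Unset Printing Implicit Defensive.
Import Order.TTheory GRing.Theory Num.Theory.
Import numFieldNormedType.Exports.
Local Open Scope classical_set_scope.
Local Open Scope ring_scope.
Local Open Scope complex_scope.

(* R[i], named at numClosedFieldType so that the norm topology is inferred. *)
Definition Cplx (R : realType) : numClosedFieldType := R[i].

(* The library's [compact] does not include Hausdorff: it is quasi-compactness.
   A set [A] used as a type carries the subspace topology. *)

Definition locally_compact_space (X : topologicalType) : Prop :=
  forall x : X, exists K : set X,
    [/\ nbhs x K, compact K & hausdorff_space (set_type K)].

Definition open_in (X : topologicalType) (Z S : set X) : Prop :=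
  exists2 W, open W & S = Z `&` W.

Definition homeomorphism_on (X Y : topologicalType) (A : set X) (B : set Y)
    (f : X -> Y) : Prop :=
  [/\ f @` A = B, {within A, continuous f} &
    exists2 g : Y -> X, {within B, continuous g} & forall x, A x -> g (f x) = x].

Definition directed (I : Type) (le : I -> I -> Prop) : Prop :=
  [/\ inhabited I, forall i, le i i,
      forall i j k, le i j -> le j k -> le i k &
      forall i j, exists k, le i k /\ le j k].

Section Nets.
Variables (X : topologicalType) (I : Type) (le : I -> I -> Prop) (x : I -> X).

Definition net_lim : set X :=
  [set p | forall U, nbhs p U -> exists i, forall j, le i j -> U (x j)].

Definition net_cluster : set X :=
  [set p | forall U, nbhs p U -> forall i, exists2 j, le i j & U (x j)].

Definition primitive_net : Prop := net_cluster `<=` net_lim.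

End Nets.

Definition primitive_limit_set (X : topologicalType) (A : set X) : Prop :=
  exists (I : Type) (le : I -> I -> Prop) (x : I -> X),
    [/\ directed le, primitive_net le x & A = net_lim le x].

Record fellK (X : topologicalType) := FellK {
  fellK_set : set X;
  fellK_primitive : primitive_limit_set fellK_set }.

HB.instance Definition _ (X : topologicalType) := gen_eqMixin (fellK X).
HB.instance Definition _ (X : topologicalType) := gen_choiceMixin (fellK X).

Definition fellK_subbase (X : topologicalType) : set (set (fellK X)) :=
  [set W | (exists2 V, open V & W = [set A | fellK_set A `&` V !=set0]) \/
           (exists2 Q, compact Q & W = [set A | fellK_set A `&` Q = set0])].

HB.instance Definition _ (X : topologicalType) :=
  isSubBaseTopological.Build (fellK X) (@fellK_subbase X) id.

Definition fellH (X : topologicalType) : topologicalType :=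
  set_type [set A : fellK X | fellK_set A !=set0].

Definition fset_of (X : topologicalType) (A : fellH X) : set X :=
  fellK_set (set_val A).

(* The point of [fellH X] with underlying set [S]; [d] is returned if there is
   no such point. *)
Definition to_fellH (X : topologicalType) (d : fellH X) (S : set X) : fellH X :=
  xget d [set A | fset_of A = S].

(* [gmul x y] is meaningful only when [gsrc x = grng y]. *)
Record groupoid_data (T : Type) := GroupoidData {
  grng : T -> T;
  gsrc : T -> T;
  gmul : T -> T -> T;
  ginv : T -> T }.

Section Groupoids.
Variables (G : topologicalType) (o : groupoid_data G).
Local Notation r := (grng o).
Local Notation s := (gsrc o).
Local Notation "x ** y" := (gmul o x y) (at level 40, left associativity).

Definition is_groupoid : Prop :=
  [/\ forall x, [/\ r (r x) = r x, s (r x) = r x, r (s x) = s x & s (s x) = s x],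
      forall x y, s x = r y -> r (x ** y) = r x /\ s (x ** y) = s y,
      forall x y z, s x = r y -> s y = r z -> (x ** y) ** z = x ** (y ** z),
      forall x, r x ** x = x /\ x ** s x = x &
      forall x, [/\ r (ginv o x) = s x, s (ginv o x) = r x,
                    x ** ginv o x = r x & ginv o x ** x = s x]].

Definition topological_groupoid : Prop :=
  [/\ is_groupoid, continuous (ginv o) &
      {within [set p : G * G | s p.1 = r p.2],
        continuous (fun p : G * G => p.1 ** p.2)}].

Definition units : set G := range r.

Definition etale : Prop :=
  forall x : G, exists V : set G,
    [/\ open V, V x, open_in units (r @` V) & homeomorphism_on V (r @` V) r].

Definition open_range_map : Prop :=
  forall V : set G, open V -> open_in units (r @` V).

Definition set_inv (A : set G) : set G := ginv o @` A.

Definition set_mul (A B : set G) : set G :=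
  [set z | exists x y, [/\ A x, B y, s x = r y & z = x ** y]].

(* When [G] is an etale locally compact groupoid, the sets below are points of
   [fellH G] (for products, of composable points), so that the default value of
   [to_fellH] is not used. *)
Definition fell_groupoid : groupoid_data (fellH G) :=
  {| grng := fun A => to_fellH A (set_mul (fset_of A) (set_inv (fset_of A)));
     gsrc := fun A => to_fellH A (set_mul (set_inv (fset_of A)) (fset_of A));
     gmul := fun A B => to_fellH A (set_mul (fset_of A) (fset_of B));
     ginv := fun A => to_fellH A (set_inv (fset_of A)) |}.

Definition fell_units : set (fellH G) :=
  closure [set A | exists2 x, units x & fset_of A = [set x]].

End Groupoids.

(* A function on a subset [Z] of [T] is represented by its extension by zero to
   [T]; [restr Z f] represents the restriction of [f] to [Z]. *)
Definition restr (R : realType) (T : Type) (Z : set T) (f : T -> Cplx R) :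
  T -> Cplx R := patch (fun=> 0) Z f.

Section FunctionSpaces.
Variables (R : realType) (T : topologicalType).
Implicit Types (f g : T -> Cplx R) (U Z : set T).

Definition Cc_on U : set (T -> Cplx R) :=
  [set f | [/\ forall x, ~ U x -> f x = 0, {within U, continuous f} &
               compact (U `&` closure [set x | f x != 0])]].

Definition Cc_span : set (T -> Cplx R) :=
  [set f | exists (n : nat) (U : 'I_n -> set T) (c : 'I_n -> Cplx R)
                  (g : 'I_n -> T -> Cplx R),
     (forall i, [/\ open (U i), hausdorff_space (set_type (U i)) &
                    Cc_on (U i) (g i)]) /\
     f = (fun x => \sum_(i < n) c i * g i x)].

Definition C0 Z : set (T -> Cplx R) :=
  [set f | [/\ forall x, ~ Z x -> f x = 0, {within Z, continuous f} &
               forall e : R, 0 < e ->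
                 compact (Z `&` [set x | e%:C <= `|f x|])]].

Definition bounded_borel Z : set (T -> Cplx R) :=
  [set f | [/\ forall x, ~ Z x -> f x = 0,
               exists M : R, forall x, `|f x| <= M%:C &
               forall V : set (Cplx R), open V ->
                 <<s Z, open_in Z >> (Z `&` f @^-1` V)]].

Definition Cstar_subalgebra_fun (A B : set (T -> Cplx R)) : Prop :=
  [/\ B `<=` A, B (fun=> 0),
      forall (c : Cplx R) f g, B f -> B g -> B (fun x => c * f x + g x),
      forall f g, B f -> B g -> B (fun x => f x * g x) /\ B (fun x => (f x)^*) &
      forall f, (forall e : R, 0 < e ->
                   exists2 g, B g & forall x, `|f x - g x| <= e%:C) -> B f].

Variable o : groupoid_data T.

Definition conv f g : T -> Cplx R := fun x =>
  \sum_(z \in [set z | grng o z = grng o x]) f z * g (gmul o (ginv o z) x).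

Definition star f : T -> Cplx R := fun x => (f (ginv o x))^*.

(* D, identified with C_0(Y) for Y its spectrum: elements of C_0(Y) are used
   only as functions on the unit space. *)
Definition algD : set (T -> Cplx R) :=
  smallest (Cstar_subalgebra_fun (bounded_borel (units o)))
           (restr (units o) @` Cc_span).

End FunctionSpaces.

Section Extensions.
Variables (R : realType) (G : topologicalType) (o : groupoid_data G).

(* The inclusion of C_c(G) into C_c(HG): for an etale locally compact groupoid
   the continuous extension exists and is unique. *)
Definition ext_Cc (f : G -> Cplx R) : fellH G -> Cplx R :=
  xget (fun=> 0) [set F | Cc_on setT F /\
    forall x A, fset_of A = [set x] -> F A = f x].

(* The inverse of the *-isomorphism h |-> h|_(G^0) from C_0((HG)^0) onto D. *)
Definition ext_D (a : G -> Cplx R) : fellH G -> Cplx R :=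
  xget (fun=> 0) [set h | C0 (fell_units o) h /\
    forall x A, units o x -> fset_of A = [set x] -> h A = a x].

End Extensions.

Section IpNorm.
Variables (R : realType) (P V : Type) (ip : V -> V -> P -> Cplx R).
Definition ip_norm (x : V) : R :=
  Num.sqrt (sup (range (fun p => complex.Re `|ip x x p|))).
End IpNorm.

Section HilbertModuleAxioms.
Variables (R : realType) (P : Type) (A : set (P -> Cplx R)).
Variables (V : lmodType (Cplx R)) (ip : V -> V -> P -> Cplx R)
  (act : V -> (P -> Cplx R) -> V).

Definition inner_product_axioms : Prop :=
  [/\ forall x y, A (ip x y),
      forall (c : Cplx R) x y z p, ip x (c *: y + z) p = c * ip x y p + ip x z p,
      forall x y p, ip y x p = (ip x y p)^*,
      forall x p, 0 <= ip x x p &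
      forall x, (forall p, ip x x p = 0) -> x = 0].

Definition action_axioms : Prop :=
  [/\ forall (c : Cplx R) x y a, A a ->
        act (c *: x + y) a = c *: act x a + act y a,
      forall (c : Cplx R) x a b, A a -> A b ->
        act x (fun p => c * a p + b p) = c *: act x a + act x b,
      forall x a b, A a -> A b ->
        act x (fun p => a p * b p) = act (act x a) b &
      forall x y a p, A a -> ip x (act y a) p = ip x y p * a p].

Definition ip_complete : Prop :=
  forall u : nat -> V,
    (forall e : R, 0 < e -> exists N : nat, forall m n : nat,
       (N <= m)%N -> (N <= n)%N -> ip_norm ip (u m - u n) < e) ->
    exists l : V, forall e : R, 0 < e -> exists N : nat, forall n : nat,
       (N <= n)%N -> ip_norm ip (u n - l) < e.

End HilbertModuleAxioms.

Record hilbert_module (R : realType) (P : Type) (A : set (P -> Cplx R)) :=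
  HilbertModule {
    hm_car :> lmodType (Cplx R);
    hm_ip : hm_car -> hm_car -> P -> Cplx R;
    hm_act : hm_car -> (P -> Cplx R) -> hm_car;
    hm_ip_axioms : inner_product_axioms A hm_ip;
    hm_act_axioms : action_axioms A hm_ip hm_act;
    hm_complete : ip_complete hm_ip }.

Section Operators.
Variables (R : realType) (P : Type) (A : set (P -> Cplx R)).
Variable E : hilbert_module A.
Implicit Types S T : E -> E.

Definition hm_norm (x : E) : R := ip_norm (@hm_ip _ _ _ E) x.

Definition adjoint_pair T S : Prop :=
  forall x y, hm_ip (T x) y = hm_ip x (S y).

Definition adjointable : set (E -> E) := [set T | exists S, adjoint_pair T S].

Definition norm_closure (B : set (E -> E)) : set (E -> E) :=
  [set T | adjointable T /\ forall e : R, 0 < e ->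
     exists2 S, B S & forall x, hm_norm (T x - S x) <= e * hm_norm x].

Definition Cstar_subalgebra_op (B : set (E -> E)) : Prop :=
  [/\ B `<=` adjointable, B (fun=> 0),
      forall (c : Cplx R) T S, B T -> B S -> B (fun x => c *: T x + S x),
      (forall T S, B T -> B S -> B (T \o S)) /\
      (forall T S, B T -> adjoint_pair T S -> B S) &
      norm_closure B `<=` B].

Definition Cstar_generated (B : set (E -> E)) : set (E -> E) :=
  smallest Cstar_subalgebra_op B.

(* Used for conditions [Q] prescribing an operator on a subset with dense span,
   so that there is at most one such operator. *)
Definition the_operator (Q : set (E -> E)) : E -> E :=
  xget (fun=> 0) (adjointable `&` Q).

End Operators.

(* [th] is the identification of the coefficient algebras [A] and [B], and [Psi]
   is the inverse of [Phi]. *)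
Definition hilbert_iso (R : realType) (P Q : Type) (A : set (P -> Cplx R))
    (B : set (Q -> Cplx R)) (th : (P -> Cplx R) -> Q -> Cplx R)
    (E : hilbert_module A) (F : hilbert_module B)
    (Phi : E -> F) (Psi : F -> E) : Prop :=
  [/\ cancel Phi Psi, cancel Psi Phi,
      forall (c : Cplx R) x y, Phi (c *: x + y) = c *: Phi x + Phi y,
      forall x y, hm_ip (Phi x) (Phi y) = th (hm_ip x y) &
      forall x a, A a -> Phi (hm_act x a) = hm_act (Phi x) (th a)].

Section L2G.
Variables (R : realType) (G : topologicalType) (o : groupoid_data G).
Variable E : hilbert_module (@algD R G o).
Variable tensor : (G -> Cplx R) -> (G -> Cplx R) -> E.
Local Notation Cc := (@Cc_span R G).
Local Notation D := (@algD R G o).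

(* [E], with [tensor f a] the class of f (.) a, is the separated completion of
   the algebraic tensor product of C_c(G) and D: linear maps out of the tensor
   product are given by bilinear maps, and its elements are the finite sums of
   elementary tensors. *)
Definition is_L2 : Prop :=
  [/\ forall (c : Cplx R) f g a, Cc f -> Cc g -> D a ->
        tensor (fun x => c * f x + g x) a = c *: tensor f a + tensor g a,
      forall (c : Cplx R) f a b, Cc f -> D a -> D b ->
        tensor f (fun x => c * a x + b x) = c *: tensor f a + tensor f b,
      forall f a g b, Cc f -> D a -> Cc g -> D b ->
        hm_ip (tensor f a) (tensor g b) =
        (fun x => (a x)^* * restr (units o) (conv o (star o f) g) x * b x),
      forall f a b, Cc f -> D a -> D b ->
        hm_act (tensor f a) b = tensor f (fun x => a x * b x) &
      forall (xi : E) (e : R), 0 < e ->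
        exists (n : nat) (f a : 'I_n -> G -> Cplx R),
          (forall i, Cc (f i) /\ D (a i)) /\
          hm_norm (xi - \sum_(i < n) tensor (f i) (a i)) < e].

Definition L_op (f : G -> Cplx R) : E -> E :=
  the_operator [set T | forall g a, Cc g -> D a ->
    T (tensor g a) = tensor (conv o f g) a].

Definition Cstar_red : set (E -> E) := norm_closure (L_op @` Cc).

End L2G.

(* Here [H] is a Hausdorff groupoid and [Z] its unit space. *)
Section L2Hausdorff.
Variables (R : realType) (H : topologicalType) (o : groupoid_data H).
Variable Z : set H.
Variable E : hilbert_module (@C0 R H Z).
Variable emb : (H -> Cplx R) -> E.
Local Notation Cc := (@Cc_on R H setT).

(* [E], with [emb] the canonical map, is the completion of C_c(H). *)
Definition is_L2_hausdorff : Prop :=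
  [/\ forall (c : Cplx R) f g, Cc f -> Cc g ->
        emb (fun x => c * f x + g x) = c *: emb f + emb g,
      forall f g, Cc f -> Cc g ->
        hm_ip (emb f) (emb g) = restr Z (conv o (star o f) g),
      forall f h, Cc f -> C0 Z h ->
        hm_act (emb f) h = emb (fun x => f x * h (gsrc o x)) &
      forall (xi : E) (e : R), 0 < e ->
        exists2 f, Cc f & hm_norm (xi - emb f) < e].

Definition L_op_hausdorff (f : H -> Cplx R) : E -> E :=
  the_operator [set T | forall g, Cc g -> T (emb g) = emb (conv o f g)].

Definition Cstar_red_hausdorff : set (E -> E) :=
  norm_closure (L_op_hausdorff @` Cc).

Definition range_rep (h : H -> Cplx R) : E -> E :=
  the_operator [set T | forall f, Cc f ->
    T (emb f) = emb (fun x => h (grng o x) * f x)].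

End L2Hausdorff.

(* Main.v *)
(* The singletons of points of G are dense in HG, so an identity between continuous
   functions on HG, such as inner products and convolutions, may be checked on them,
   that is, in G.  A function f in C_c(G) extends to HG by A |-> sum of f over A.

   Every F in C_c(HG) is a finite sum of functions f s^*(a), exactly and not only as a
   limit, with f in C_c(G) supported in a bisection and a in C_c((HG)^0): near a point
   of the support there is k supported in a bisection with extension 1, k F is a
   function of the source wherever k is nonzero, and F = k^2 F + (1 - k^2) F telescopes.
   So f (.) a |-> f s^*(a), which preserves inner products by a computation at units
   of G, has dense range and extends to an isomorphism Phi.

   For f supported in a bisection, f^* * f lives on the unit space, so convolution by f
   is bounded; L(f s^*(a)) = L(f) r^*(a), and Ad_Phi maps L_G(f) to L(f).  With the
   decomposition of C_c(HG) this places the reduced C*-algebra of HG in the algebra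
   generated by Ad_Phi(C*_r(G)) and r^*; conversely r^*(h) = L(h) for h compactly
   supported on the unit space. *)
Require Import Defs.
From HB Require Import structures.
From mathcomp Require Import all_boot all_order all_algebra.
From mathcomp Require Import complex finmap.
From mathcomp Require Import all_classical all_reals all_analysis.
From mathcomp Require Import ring lra.
Set Implicit Arguments.
Unset Strict Implicit.
Unset Printing Implicit Defensive.
Import Order.TTheory GRing.Theory Num.Theory.
Import numFieldNormedType.Exports.
Local Open Scope classical_set_scope.
Local Open Scope ring_scope.

(** * Topological preliminaries *)

(** Limit sets of nets are hard to compute with. Written as limit sets of ultrafilters, their
    inverses, sources and left translates are limit sets of image ultrafilters, and every point [A]
    of HG turns out to be a coset: [A = x SS(A)] for each [x] in [A]. Hence a point is determined by
    its source and one element, and statements about HG become computations with one representative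
    in [G].

    A function in C_c(G) need not be continuous on [G], so limits are taken on HG, and values at
    units of [G] serve as test data. The coefficients of both modules agree because D consists of
    the restrictions of C_0 functions: one inclusion extends functions to HG, the other needs an
    approximation on HG.

    Modules and operators are given by specifications, not by constructions. A map is therefore
    defined on an indexed dense family and extended by a Lipschitz estimate, which also shows that
    it does not depend on the index; an operator chosen by [xget] is identified by its values on a
    dense set. *)

Lemma filter_meet (T : Type) (F : set_system T) (A B : set T) : ProperFilter F ->
  F A -> F B -> exists x, A x /\ B x.
Proof.
move=> PF FA FB; have h : F (A `&` B) by exact: filterI.
by have /filter_ex := h.
Qed.

Definition limset (X : topologicalType) (F : set_system X) : set X :=
  [set p | nbhs p `<=` F].

Lemma open_nbhsP (X : topologicalType) (x : X) A : nbhs x A ->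
  exists W, [/\ open W, W x & W `<=` A].
Proof. by rewrite nbhsE => -[W [oW Wx] sWA]; exists W. Qed.

(** * Subspaces presented as subtypes *)

Section SetTypeTopology.
Variables (X : topologicalType).
Implicit Types (K U : set X).

Lemma nbhs_set_type U (x : set_type U) (A : set (set_type U)) :
  nbhs x A <-> exists2 V, nbhs (set_val x) V & set_val @^-1` V `<=` A.
Proof.
split=> [/open_nbhsP[B [[W oW <-] Wx sBA]]|[V nV sVA]].
  by exists W => //; apply: open_nbhs_nbhs.
have [W [oW Wx sWV]] := open_nbhsP nV.
rewrite nbhsE; exists (set_val @^-1` W); last by move=> y /sWV/sVA.
by split => //; exists W.
Qed.

Lemma set_val_continuous U : continuous (@set_val X U).
Proof. exact: initial_continuous. Qed.

Lemma set_val_mk U x (Ux : U x) : exists y : set_type U, set_val y = x.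
Proof. by exists (exist _ x (mem_set Ux)). Qed.

(** Disjointness is asked only inside [U]: the ambient space is not Hausdorff, and this form lets a
    proof stay with open sets of [X] instead of the subtype. *)
Lemma hausdorff_set_typeP U : hausdorff_space (set_type U) <->
  forall x y, U x -> U y -> x <> y ->
    exists V W, [/\ open V, open W, V x, W y & forall z, U z -> V z -> W z -> False].
Proof.
split=> [hU x y Ux Uy xy|hU x y clxy].
  have [x' ex] := set_val_mk Ux; have [y' ey] := set_val_mk Uy; subst x y.
  apply: contrapT => hn; apply: xy; congr set_val; apply: hU => A B.
  move=> /nbhs_set_type[V nV sVA] /nbhs_set_type[W nW sWB].
  apply: contrapT => AB; apply: hn.
  exists (interior V), (interior W); split; try exact: open_interior.
  - exact: nV.
  - exact: nW.
  move=> z Uz /interior_subset Vz /interior_subset Wz.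
  apply: AB; have [z' ez] := set_val_mk Uz; subst z; exists z'.
  by split; [exact: sVA|exact: sWB].
apply: contrapT => xy.
have [|V [W [oV oW Vx Wy VW]]] := hU _ _ (set_valP x) (set_valP y).
  by move=> e; apply: xy; exact: val_inj.
have [] := clxy (set_val @^-1` V) (set_val @^-1` W).
- by apply/nbhs_set_type; exists V => //; exact: open_nbhs_nbhs.
- by apply/nbhs_set_type; exists W => //; exact: open_nbhs_nbhs.
- by move=> z [/= Vz Wz]; exact: (VW _ (set_valP z)).
Qed.

Lemma hausdorff_set_typeS U K : U `<=` K -> hausdorff_space (set_type K) ->
  hausdorff_space (set_type U).
Proof.
move=> sUK /hausdorff_set_typeP hK; apply/hausdorff_set_typeP => x y Ux Uy xy.
have [V [W [oV oW Vx Wy VW]]] := hK x y (sUK _ Ux) (sUK _ Uy) xy.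
by exists V, W; split=> // z /sUK; exact: VW.
Qed.

Lemma hausdorff_space_setT : hausdorff_space X ->
  forall U, hausdorff_space (set_type U).
Proof.
move=> hX U; apply/hausdorff_set_typeP => x y _ _ /eqP xy.
move: hX; rewrite open_hausdorff => /(_ _ _ xy)[[A B] [/set_mem Ax /set_mem By] [oA oB /eqP AB]].
exists A, B; split=> // z _ Az Bz.
by have : (A `&` B) z by []; rewrite AB.
Qed.

Lemma compact_set_type K : compact K -> compact [set: set_type K].
Proof.
move=> cK F PF _.
have FK : (fmap set_val F) K.
  by apply: (@filterS _ F _ setT) => [x _|]; [exact: set_valP|exact: filterT].
have [p [Kp clp]] := cK _ _ FK.
have [x ex] := set_val_mk Kp; subst p.
exists x; split=> // A B FA /nbhs_set_type[V nV sVB].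
have [|y [Ay Vy]] := clp (set_val @` A) V _ nV.
  by apply: (@filterS _ F _ A) => // y Ay; exists y.
by case: Ay => z Az ez; exists z; split=> //; apply: sVB; rewrite /= ez.
Qed.

Lemma compact_set_val U (C : set (set_type U)) : compact C -> compact (set_val @` C).
Proof.
move=> cC; apply: continuous_compact => //.
by apply: continuous_subspaceT; exact: set_val_continuous.
Qed.

Lemma within_open_continuous (Y : topologicalType) U (f : X -> Y) : open U ->
  {within U, continuous f} <-> forall x, U x -> {for x, continuous f}.
Proof.
move=> oU; rewrite continuous_open_subspace //.
by split=> h x /=; [move=> Ux; apply: h; rewrite inE|rewrite inE; exact: h].
Qed.

(** A compact subset of a non-Hausdorff space need not be closed, so [V] and [W] are disjoint inside
    [U] only. This is what makes extension by zero continuous on [U] in [Cc_onP]. *)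
Lemma hausdorff_compact_sep U K x : hausdorff_space (set_type U) -> compact K ->
  K `<=` U -> U x -> ~ K x ->
  exists V W, [/\ open V, open W, V x, K `<=` W & forall z, U z -> V z -> W z -> False].
Proof.
move=> /hausdorff_set_typeP hU /compact_near_coveringP cK sKU Ux nKx.
(* Near covering along the filter of small neighbourhoods of [x] provides one neighbourhood that
   serves all points of [K] at once. *)
pose F := powerset_filter_from (nbhs x).
have [] := cK _ F (fun A y => exists2 W, nbhs y W & forall z, U z -> A z -> W z -> False).
- move=> y Ky.
  have [|V [W [oV oW Vx Wy VW]]] := hU x y Ux (sKU _ Ky).
    by move=> e; subst y.
  have nVx : nbhs x V by exact: open_nbhs_nbhs.
  exists (W, [set A | nbhs x A /\ A `<=` V]).
    split; first exact: open_nbhs_nbhs.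
    exists [set A | nbhs x A /\ A `<=` V] => //.
    split; first by move=> A [].
      by move=> A B [nA sA] nB sBA; split=> //; apply: subset_trans sA.
    by exists V; split.
  move=> [z A] [/= Wz [_ sAV]]; exists W; first exact: open_nbhs_nbhs.
  by move=> t Ut /sAV Vt; exact: VW.
move=> M [sM1 sM3 [V0 MV0]] sM.
have /sM hV0 := MV0.
have nV0 := sM1 _ MV0.
exists (interior V0), (\bigcup_(W in [set W | open W /\ forall z, U z -> V0 z -> W z -> False]) W).
split.
- exact: open_interior.
- by apply: bigcup_open => W [].
- exact: nV0.
- move=> y /hV0[W nW hW]; exists (interior W); last exact: nW.
  split; first exact: open_interior.
  by move=> z Uz Vz /interior_subset; exact: hW.
- by move=> z Uz /interior_subset Vz [W [_ hW] Wz]; exact: hW Vz Wz.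
Qed.

End SetTypeTopology.

(** * Locally compact spaces without the Hausdorff axiom *)

Section LocallyCompact.
Variable X : topologicalType.
Hypothesis hX : locally_compact_space X.
Implicit Types (x : X) (A U V : set X).

(** One compact Hausdorff neighbourhood suffices because a compact Hausdorff space is regular: a
    small closed neighbourhood is taken inside the subtype [K], and its image is compact in [X],
    though perhaps not closed there. *)
Lemma locally_compact_base x U : nbhs x U ->
  exists K, [/\ nbhs x K, compact K, K `<=` U & hausdorff_space (set_type K)].
Proof.
move=> nU; have [K [nK cK hK]] := hX x.
have Kx := nbhs_singleton nK; have [x' ex] := set_val_mk Kx; subst x.
have [|C nC sC] := compact_regular hK (compact_set_type cK) filterT
    (x := x') (t := set_val @^-1` (U `&` K)).
  by apply/nbhs_set_type; exists (U `&` K) => //; exact: filterI.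
exists (set_val @` closure C).
have sCK : set_val @` closure C `<=` U `&` K.
  by move=> _ [y Cy <-]; apply: sC.
split.
- have [V nV sVC] := (nbhs_set_type _ _).1 nC.
  apply: filterS (filterI nV nK) => y [Vy Ky].
  have [y' ey] := set_val_mk Ky; subst y.
  by exists y' => //; apply: subset_closure; exact: sVC.
- apply: compact_set_val; apply: (subclosed_compact _ (compact_set_type cK)) => //.
  exact: closed_closure.
- by move=> y /sCK[].
- by apply: hausdorff_set_typeS hK => y /sCK[].
Qed.

(** Makes points closed, so that constant nets have singleton limit sets in [fellH_single]. *)
Lemma locally_compact_T1 x y : x <> y -> exists2 U, open U & U x /\ ~ U y.
Proof.
move=> xy; have [K [nK cK /hausdorff_set_typeP hK]] := hX x.
have Kx := nbhs_singleton nK.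
case: (pselect (K y)) => Ky; last first.
  exists (interior K); first exact: open_interior.
  by split; [exact: nK|move=> /interior_subset].
have [V [W [oV oW Vx Wy VW]]] := hK x y Kx Ky xy.
by exists V => //; split=> // Vy; exact: (VW y).
Qed.

End LocallyCompact.

Lemma ultraP (X : Type) (F : set_system X) : ProperFilter F ->
  (forall A, F A \/ F (~` A)) -> UltraFilter F.
Proof.
move=> PF hF; split=> // G PG sFG; rewrite eqEsubset; split=> // A GA.
have [//|/sFG GnA] := hF A.
by have [z []] := filter_meet PG GA GnA.
Qed.

Lemma fmap_ultra (X Y : Type) (f : X -> Y) (F : set_system X) :
  UltraFilter F -> UltraFilter (fmap f F).
Proof.
move=> uF; apply: (@ultraP Y (fmap f F)) => A.
exact: (in_ultra_setVsetC (f @^-1` A) uF).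
Qed.

(** * The Fell topology *)

Section PrimitiveNets.
Variable X : topologicalType.

(* Refining the section filter of a primitive net to an ultrafilter keeps its limits. *)
Lemma primitive_limit_setP (A : set X) : primitive_limit_set A <->
  exists F : set_system X, UltraFilter F /\ A = limset F.
Proof.
split=> [[I [le [x [[[i0] lexx letr dir] prim ->]]]]|[F [uF ->]]].
  pose N : set_system X := [set S | exists i, forall j, le i j -> S (x j)].
  have PN : ProperFilter N.
    apply: Build_ProperFilter_ex => [S [i Si]|]; first by exists (x i); exact/Si/lexx.
    split; first by exists i0.
      move=> S T [i Si] [j Tj]; have [k [ik jk]] := dir i j.
      by exists k => l kl; split; [apply: Si; exact: letr kl|apply: Tj; exact: letr kl].
    by move=> S T sST [i Si]; exists i => j /Si/sST.
  have [F [uF sNF]] := ultraFilterLemma PN.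
  exists F; split=> //; rewrite eqEsubset; split=> p.
    by move=> hp S nS; apply: sNF; exact: hp.
  (* An ultrafilter containing all tails meets each of them, so its limits are cluster points of the
     net; primitivity makes them limits. *)
  move=> Fp; apply: prim => U nU i.
  have FU := Fp _ nU.
  have FS : F [set x j | j in le i].
    by apply: sNF; exists i => j ij; exists j.
  by have [z [Uz [j ij ej]]] := filter_meet _ FU FS; exists j; rewrite ?ej.
(* The canonical net of [F]: a member of [F] with a point chosen in it, ordered by reverse
   inclusion. It is primitive because the complement of a neighbourhood of a cluster point cannot
   belong to [F]. *)
pose I := {xS : X * set X | F xS.2 /\ xS.2 xS.1}.
pose le (i j : I) := (sval j).2 `<=` (sval i).2.
pose x (i : I) := (sval i).1.
have mk S : F S -> exists i : I, (sval i).2 = S.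
  by move=> FS; have /filter_ex[y Sy] := FS; exists (exist _ (y, S) (conj FS Sy)).
have limE p : net_lim le x p <-> limset F p.
  split=> [hp U /hp[i hi]|Fp U nU].
    have [Fi Si] := svalP i; apply: (filterS _ Fi) => y Sy.
    exact: (hi (exist _ (y, (sval i).2) (conj Fi Sy))).
  have [i ei] := mk _ (Fp _ nU); exists i => j ij.
  by rewrite -ei; apply: ij; have [] := svalP j.
exists I, le, x; split.
- split.
  + by have [i _] := mk _ (@filterT _ F _).
  + by move=> i y.
  + by move=> i j k ij jk y /jk/ij.
  + move=> i j; have [Fi _] := svalP i; have [Fj _] := svalP j.
    have [k ek] := mk _ (filterI Fi Fj); exists k.
    by rewrite /le ek; split=> y [].
- move=> p clp; apply/limE => U nU.
  have [//|FnU] := in_ultra_setVsetC U uF.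
  have [i ei] := mk _ FnU; have [j ij Uj] := clp U nU i.
  by have [_ /ij] := svalP j; rewrite ei.
- by rewrite eqEsubset; split=> p /limE.
Qed.

End PrimitiveNets.

Section FellTopology.
Variable X : topologicalType.
Implicit Types (A B : fellH X) (F : set_system X).

Definition hit (V : set X) : set (fellH X) := [set A | fset_of A `&` V !=set0].
Definition miss (Q : set X) : set (fellH X) := [set A | fset_of A `&` Q = set0].

Lemma fset_of_neq0 A : fset_of A !=set0.
Proof. exact: set_valP A. Qed.

Lemma fset_of_inj A B : fset_of A = fset_of B -> A = B.
Proof.
rewrite /fset_of => e; apply: val_inj; move: e; rewrite !set_valE.
case: (\val A) (\val B) => a pa [b pb] /= e; subst b.
by congr FellK; exact: Prop_irrelevance.
Qed.

Lemma fset_ofP A : exists F, UltraFilter F /\ fset_of A = limset F.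
Proof. by apply/primitive_limit_setP; exact: fellK_primitive. Qed.

Lemma fellH_mk F : UltraFilter F -> limset F !=set0 ->
  exists A, fset_of A = limset F.
Proof.
move=> uF ne; have pF : primitive_limit_set (limset F).
  by apply/primitive_limit_setP; exists F.
have [A eA] : exists A : fellH X, set_val A = FellK pF by exact: set_val_mk.
by exists A; rewrite /fset_of eA.
Qed.

Lemma fset_of_closed A : closed (fset_of A).
Proof.
have [F [uF ->]] := fset_ofP A; move=> p clp U /open_nbhsP[V [oV Vp sVU]]; apply: filterS sVU _.
have [|q [Fq Vq]] := clp V; first exact: open_nbhs_nbhs.
by apply: Fq; exact: open_nbhs_nbhs.
Qed.

Lemma open_fellK_subbase (W : set (fellK X)) : fellK_subbase W -> open W.
Proof.
move=> sW; exists [set W]; last by rewrite bigcup_set1.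
move=> _ ->; exists [fset W]%fset; last first.
  by rewrite eqEsubset; split=> A /=; [apply; rewrite /= inE|move=> WA i /=; rewrite inE => /eqP ->].
by move=> i /fset1P ->; rewrite inE.
Qed.

Lemma missP Q A : miss Q A <-> forall x, fset_of A x -> Q x -> False.
Proof.
split=> [AQ x Ax Qx|h]; last by rewrite /miss /= eqEsubset; split=> // x [/h].
by have : (fset_of A `&` Q) x by []; rewrite AQ.
Qed.

Lemma open_hit V : open V -> open (hit V).
Proof.
move=> oV; exists [set A | fellK_set A `&` V !=set0] => //.
by apply: open_fellK_subbase; left; exists V.
Qed.

Lemma open_miss Q : compact Q -> open (miss Q).
Proof.
move=> cQ; exists [set A | fellK_set A `&` Q = set0] => //.
by apply: open_fellK_subbase; right; exists Q.
Qed.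

Lemma fellH_cvg (FF : set_system (fellH X)) A : Filter FF ->
  (forall V, open V -> hit V A -> FF (hit V)) ->
  (forall Q, compact Q -> miss Q A -> FF (miss Q)) -> FF --> A.
Proof.
move=> fF hV hQ U /nbhs_set_type[W].
rewrite nbhsE => -[_ [[D sD <-] [W1 DW1 W1A]] sW1] sU.
apply: filterS sU _; apply: (@filterS _ _ _ (set_val @^-1` W1)).
  by move=> B W1B; apply: sW1; exists W1.
have [N sN eN] := sD _ DW1.
have NA (i : set (fellK X)) : i \in N -> i (set_val A).
  by move: W1A; rewrite -eN => h; apply: h.
apply: (@filterS _ _ _ (\bigcap_(i in [set` N]) (fun B : fellH X => i (set_val B)))).
  by move=> B hB; rewrite -eN => i iN; exact: hB.
apply: filter_bigI => i iN; have /set_mem[[V oV e]|[Q cQ e]] := sN _ iN.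
  by rewrite e; apply: hV => //; have := NA i iN; rewrite e.
by rewrite e; apply: hQ => //; have := NA i iN; rewrite e.
Qed.

End FellTopology.
Arguments hit {X} V.
Arguments miss {X} Q.

Section FellLocallyCompact.
Variable X : topologicalType.
Hypothesis hX : locally_compact_space X.
Implicit Types (A B : fellH X) (F : set_system X).

(** A quasi-compact set missed by [A] is covered by finitely many open sets that are eventually not
    hit, so the second half of the subbase may be tested at points. Convergence in HG is checked
    below in this form. *)
Lemma fellH_cvg_lc (FF : set_system (fellH X)) A : Filter FF ->
  (forall x V, open V -> V x -> fset_of A x -> FF (hit V)) ->
  (forall x, ~ fset_of A x -> exists V, [/\ open V, V x & FF (~` hit V)]) ->
  FF --> A.
Proof.
move=> fF h1 h2; apply: fellH_cvg => [V oV [x [Ax Vx]]|Q /compact_near_coveringP cQ AQ].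
  exact: h1 Ax.
have : \forall B \near FF, Q `<=` (fun y => ~ fset_of B y).
  apply: cQ => x Qx; have [|V [oV Vx FV]] := h2 x.
    by move=> Ax; have : (fset_of A `&` Q) x by []; rewrite AQ.
  exists (V, ~` hit V); first by split=> //; exact: open_nbhs_nbhs.
  by move=> [y B] [/= Vy nB] By; apply: nB; exists y.
apply: filterS => B h; rewrite /miss /= eqEsubset; split=> // y [By Qy].
exact: h Qy By.
Qed.

Lemma fellH_nbhs_hit A V x : open V -> V x -> fset_of A x -> nbhs A (hit V).
Proof. by move=> oV Vx Ax; apply: open_nbhs_nbhs; split; [exact: open_hit|exists x]. Qed.

(** A compact neighbourhood of [x] inside the open complement of [A] provides the subbasic set; this
    is the converse of the pointwise test in [fellH_cvg_lc]. *)
Lemma fellH_nbhs_nhit A x : ~ fset_of A x ->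
  exists V, [/\ open V, V x & nbhs A (~` hit V)].
Proof.
move=> nAx.
have [|K [nK cK sK hK]] := locally_compact_base hX (x := x) (U := ~` fset_of A).
  by apply: open_nbhs_nbhs; split=> //; apply: closed_openC; exact: fset_of_closed.
exists (interior K); split; [exact: open_interior|exact: nK|].
apply: (@filterS _ _ _ (miss K)) => [B BK [y [By Ky]]|].
  exact: ((missP _ _).1 BK y By (interior_subset Ky)).
apply: open_nbhs_nbhs; split; first exact: open_miss.
by apply/missP => y Ay /sK.
Qed.

(** If [x] in [A] were outside [B], some open [V] around [x] would be hit near [A] and not hit near
    [B]. Inseparable points thus contain each other. *)
Lemma fellH_hausdorff : hausdorff_space (fellH X).
Proof.
move=> A B clAB; apply: contrapT => AB.
suff main : forall A B, cluster (nbhs A) B -> fset_of A `<=` fset_of B.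
  apply: AB; apply: fset_of_inj; rewrite eqEsubset; split; apply: main => //.
  by move=> C D nC nD; rewrite setIC; exact: clAB.
move=> {AB clAB}A {}B clAB x Ax; apply: contrapT => /fellH_nbhs_nhit[V [oV Vx nB]].
by have [C [hC]] := clAB _ _ (fellH_nbhs_hit oV Vx Ax) nB.
Qed.

(* For an ultrafilter FF on HX, the sets hit by FF-most points and the complements of
   the compact sets missed by FF-most points generate a filter on X; any ultrafilter
   finer than it has the limit of FF as its limit set. *)
Lemma fellH_hit_compact Q : compact Q -> compact (hit Q : set (fellH X)).
Proof.
rewrite compact_ultra => cQ.
rewrite compact_ultra => FF uFF FQ.
pose B := [set S : set X | (exists2 V, open V & FF (hit V) /\ S = V) \/
                           (exists2 K, compact K & FF (miss K) /\ S = ~` K)].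
pose N := filter_from (finI_from B id) id.
(* Every finite intersection of generators belongs to all ultrafilters with limit set [A], for
   [FF]-most [A]. As such [A] exist, none is empty and the filter is proper. *)
have hN : forall S, finI_from B id S ->
    exists W, FF W /\ forall (A : fellH X) F, UltraFilter F -> fset_of A = limset F -> W A -> F S.
  move=> _ [D sD <-].
  exists (\bigcap_(S in [set` D]) [set A | forall F, UltraFilter F -> fset_of A = limset F -> F S]).
  split; last by move=> A F uF eF h; apply: filter_bigI => S SD; exact: h.
  apply: filter_bigI => S /sD/set_mem[[V oV [FV ->]]|[K cK [FK ->]]].
    apply: filterS FV => A [x [Ax Vx]] F uF eF.
    by move: Ax; rewrite eF; apply; exact: open_nbhs_nbhs.
  apply: filterS FK => A AK F uF eF.
  have [FK|//] := in_ultra_setVsetC K uF.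
  move: cK; rewrite compact_ultra => /(_ F uF FK)[x [Kx Fx]].
  by case: ((missP _ _).1 AK x _ Kx); rewrite eF.
have PN : ProperFilter N.
  apply: filter_from_proper; last first.
    move=> S /hN[W [FW hW]]; have [A WA] := @filter_ex _ FF _ _ FW.
    have [F [uF eF]] := fset_ofP A.
    by have /filter_ex := hW A F uF eF WA.
  apply: filter_from_filter; first by exists setT, fset0 => //; rewrite set_fset0 bigcap_set0.
  by move=> S T hS hT; exists (S `&` T) => //; exact: finI_fromI.
have [F [uF sNF]] := ultraFilterLemma PN.
have FB S : B S -> F S.
  by move=> BS; apply: sNF; exists S => //; exact: finI_from1.
have FFn V : ~ FF (hit V) -> FF (~` hit V).
  by have [] := in_ultra_setVsetC (hit V) uFF.
have FFn2 x : ~ limset F x -> exists V, [/\ open V, V x & FF (~` hit V)].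
  move=> nFx; apply: contrapT => hn; apply: nFx => S /open_nbhsP[V [oV Vx sVS]].
  apply: filterS sVS _; apply: FB; left; exists V => //; split=> //.
  by apply: contrapT => /FFn h; apply: hn; exists V; split=> //.
(* Otherwise each point of [Q] has an open neighbourhood that [FF]-most points do not hit, and
   compactness of [Q] makes [FF]-most points miss [Q]. *)
have [x [Qx Fx]] : exists x, Q x /\ limset F x.
  apply: contrapT => hn.
  have /compact_near_coveringP cQ' : compact Q by rewrite compact_ultra.
  have : \forall B \near FF, Q `<=` (fun y => ~ fset_of B y).
    apply: cQ' => x Qx; have [|V [oV Vx FV]] := FFn2 x.
      by move=> Fx; apply: hn; exists x.
    exists (V, ~` hit V); first by split=> //; exact: open_nbhs_nbhs.
    by move=> [y A] [/= Vy nA] Ay; apply: nA; exists y.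
  move=> h; have [A [[x [Ax Qx]] /(_ x Qx)]] := filter_meet _ FQ h.
  by [].
have [A eA] := fellH_mk uF (ex_intro _ x Fx).
exists A; split; first by exists x; rewrite eA.
apply: fellH_cvg_lc => [y V oV Vy Ay|y]; last by rewrite eA => /FFn2.
have [//|FnV] := in_ultra_setVsetC (hit V) uFF.
move: Ay; rewrite eA => Fy.
have [K [nK cK sK hK]] := locally_compact_base hX (open_nbhs_nbhs (conj oV Vy)).
have /FB FnK : B (~` K).
  right; exists K => //; split=> //.
  apply: filterS FnV => C nC; apply/missP => z Cz /sK Vz.
  by apply: nC; exists z.
by have [z []] := filter_meet _ (Fy _ nK) FnK.
Qed.

(** The principal ultrafilter at [x] has no limit other than [x], points being closed. *)
Lemma fellH_single x : exists A : fellH X, fset_of A = [set x].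
Proof.
have uF := principal_filter_ultra x.
have e : limset (principal_filter x) = [set x].
  rewrite eqEsubset; split=> y /= hy; last first.
    by rewrite hy => S nS; apply/principal_filterP; exact: nbhs_singleton.
  apply: contrapT => yx; have [U oU [Uy nUx]] := locally_compact_T1 hX yx.
  apply: nUx; apply/principal_filterP; apply: hy; exact: open_nbhs_nbhs.
by rewrite -e; apply: fellH_mk => //; rewrite e; exists x.
Qed.

(** A compact set disjoint from [A] cannot belong to [F], since it would contain a limit of [F]; so
    the singletons along [F] eventually miss it. A member of [F] says more than density: the points
    can be chosen in any other member of [F], such as the set of units. *)
Lemma fellH_dense A F (W : set (fellH X)) : UltraFilter F -> fset_of A = limset F ->
  nbhs A W -> F [set x | forall B, fset_of B = [set x] -> W B].
Proof.
move=> uF eA nW.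
pose NN : set_system (fellH X) := [set W | F [set x | forall B, fset_of B = [set x] -> W B]].
have fN : Filter NN.
  split; rewrite /NN /=.
  - by apply: filterS filterT => x _ B.
  - move=> P Q FP FQ; apply: (@filterS _ F _ _ _ _ (@filterI _ F _ _ _ FP FQ)).
    by move=> x [h1 h2] B eB; split; [exact: h1|exact: h2].
  - by move=> P Q sPQ; apply: filterS => x h B /h/sPQ.
suff h : NN --> A by exact: h.
apply: fellH_cvg_lc => [x V oV Vx|x nAx].
  rewrite eA => Fx; apply: filterS (Fx V (open_nbhs_nbhs (conj oV Vx))) => y Vy B eB.
  by exists y; rewrite eB.
have [|K [nK cK sK hK]] := locally_compact_base hX (x := x) (U := ~` fset_of A).
  by apply: open_nbhs_nbhs; split=> //; apply: closed_openC; exact: fset_of_closed.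
exists (interior K); split; [exact: open_interior|exact: nK|].
have [FK|FnK] := in_ultra_setVsetC K uF.
  move: cK; rewrite compact_ultra => /(_ F uF FK)[y [Ky Fy]].
  by case: (sK y Ky); rewrite eA.
apply: filterS FnK => y nKy B eB [z []]; rewrite eB /= => -> /interior_subset.
exact: nKy.
Qed.

End FellLocallyCompact.

Local Open Scope complex_scope.
(* [conv] alone is the convex combination of mathcomp-analysis. *)
Local Notation gconv := Defs.conv.

(** * Complex-valued functions *)

Section ComplexModulus.
Variable R : realType.
Implicit Types (z w : Cplx R) (e : R).

(** The norm of [Cplx R] has values in [Cplx R]; suprema and linear arithmetic require a real
    number. *)
Definition cabs z : R := complex.Re `|z|.

Lemma cabsE z : `|z| = (cabs z)%:C.
Proof. by rewrite /cabs normc_def. Qed.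

Lemma lecC e1 e2 : ((e1%:C : Cplx R) <= e2%:C) = (e1 <= e2).
Proof. by rewrite lecR. Qed.

Lemma ltcC e1 e2 : ((e1%:C : Cplx R) < e2%:C) = (e1 < e2).
Proof. by rewrite ltcR. Qed.

Lemma cabs_ge0 z : 0 <= cabs z.
Proof. by rewrite -lecC -cabsE; exact: normr_ge0. Qed.

Lemma cabs_le z e : (cabs z <= e) = (`|z| <= e%:C).
Proof. by rewrite cabsE lecC. Qed.

Lemma cabs_lt z e : (cabs z < e) = (`|z| < e%:C).
Proof. by rewrite cabsE ltcC. Qed.

Lemma cabsM z w : cabs (z * w) = cabs z * cabs w.
Proof.
apply: (fmorph_inj (real_complex R)).
by rewrite rmorphM /= -!cabsE normrM.
Qed.

Lemma cabsD z w : cabs (z + w) <= cabs z + cabs w.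
Proof. by rewrite cabs_le rmorphD /= -!cabsE ler_normD. Qed.

Lemma cabsN z : cabs (- z) = cabs z.
Proof. by rewrite /cabs normrN. Qed.

Lemma cabsB z w : cabs (z - w) = cabs (w - z).
Proof. by rewrite /cabs distrC. Qed.

Lemma cabsJ z : cabs z^* = cabs z.
Proof. by rewrite /cabs normcJ. Qed.

Lemma cabs0 : cabs 0 = 0.
Proof. by rewrite /cabs normr0. Qed.

Lemma cabs1 : cabs 1 = 1.
Proof. by rewrite /cabs normr1. Qed.

Lemma cabs_eq0 z : cabs z = 0 -> z = 0.
Proof. by move=> h; apply/eqP; rewrite -normr_eq0 cabsE h. Qed.

Lemma cabs_real e : cabs e%:C = `|e|.
Proof. by rewrite /cabs normc_def /= expr0n /= addr0 sqrtr_sqr. Qed.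

Lemma cabs_sum (I : Type) (s : seq I) (P : pred I) (F : I -> Cplx R) :
  cabs (\sum_(i <- s | P i) F i) <= \sum_(i <- s | P i) cabs (F i).
Proof.
elim/big_ind2: _ => [|x1 x2 y1 y2 h1 h2|//]; first by rewrite cabs0.
by apply: (le_trans (cabsD _ _)); exact: lerD.
Qed.

Lemma conjM z w : (z * w)^* = z^* * w^*.
Proof. exact: rmorphM. Qed.

Lemma conjB z w : (z - w)^* = z^* - w^*.
Proof. exact: rmorphB. Qed.

Lemma conj_sum (I : Type) (s : seq I) (P : pred I) (F : I -> Cplx R) :
  (\sum_(i <- s | P i) F i)^* = \sum_(i <- s | P i) (F i)^*.
Proof. by elim/big_rec2: _ => [|i y x _ <-]; [exact: rmorph0|exact: rmorphD]. Qed.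

Lemma conjKc z : (z^*)^* = z.
Proof. exact: conjcK. Qed.

Lemma mul_conj z : z^* * z = (cabs z ^+ 2)%:C.
Proof. by rewrite rmorphXn /= -cabsE mulrC sqr_normc. Qed.

Lemma cvg_cplxP (T : Type) (F : set_system T) (f : T -> Cplx R) (a : Cplx R) :
  Filter F ->
  f @ F --> a <-> forall e : R, 0 < e -> \forall x \near F, cabs (f x - a) < e.
Proof.
move=> fF; split=> [/cvgrPdist_lt h e e0|h].
  have e0' : 0 < (e%:C : Cplx R) by rewrite ltcC.
  by apply: filterS (h _ e0') => x; rewrite cabs_lt distrC.
apply/cvgrPdist_lt => e e0.
have ee : e = (complex.Re e)%:C.
  by move: e0; case: e => a' b; rewrite ltcE /= => /andP[/eqP -> _].
rewrite ee ltcC in e0.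
by apply: filterS (h _ e0) => x; rewrite cabs_lt -ee distrC.
Qed.

(* A one-constructor wrapper, so that unification does not unfold the topology of [Cplx R]. *)
Variant cont_at (T : topologicalType) (f : T -> Cplx R) (x : T) : Prop :=
  ContAt of {for x, continuous f}.

Lemma cont_atP (T : topologicalType) (f : T -> Cplx R) x :
  cont_at f x <-> forall e : R, 0 < e -> \forall y \near x, cabs (f y - f x) < e.
Proof.
by split=> [[/cvg_cplxP h]|h]; [exact: h|constructor; apply/cvg_cplxP; exact: h].
Qed.

Lemma conj_continuous : continuous (fun z : Cplx R => (z^* : Cplx R)).
Proof.
move=> z; suff [] : @cont_at (Cplx R) (fun z : Cplx R => (z^* : Cplx R)) z by [].
apply/cont_atP => e e0.
have /cont_atP h : @cont_at (Cplx R) id z by constructor; exact: cvg_id.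
by apply: filterS (h e e0) => w; rewrite -conjB cabsJ.
Qed.

Section Continuity.
Variable T : topologicalType.
Implicit Types (f g : T -> Cplx R) (x : T).

Lemma cont_conj f x : cont_at f x -> cont_at (fun x => ((f x)^* : Cplx R)) x.
Proof.
move=> [cf]; constructor.
by apply: (@continuous_comp T (Cplx R) (Cplx R) f _ x cf); exact: conj_continuous.
Qed.

Lemma cont_mul f g x : cont_at f x -> cont_at g x -> cont_at (fun x => f x * g x) x.
Proof. by move=> [cf] [cg]; constructor; exact: (continuousM cf cg). Qed.

Lemma cont_add f g x : cont_at f x -> cont_at g x -> cont_at (fun x => f x + g x) x.
Proof. by move=> [cf] [cg]; constructor; exact: (@continuousD _ (Cplx R) _ _ _ _ cf cg). Qed.

Lemma cont_const (c : Cplx R) x : cont_at (fun _ : T => c) x.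
Proof. by constructor; exact: cvg_cst. Qed.

Lemma cont_scale (c : Cplx R) f x : cont_at f x -> cont_at (fun x => c * f x) x.
Proof. by apply: cont_mul; exact: cont_const. Qed.

Lemma cont_sub f g x : cont_at f x -> cont_at g x -> cont_at (fun x => f x - g x) x.
Proof. by move=> [cf] [cg]; constructor; exact: (@continuousB _ (Cplx R) _ _ _ _ cf cg). Qed.

Lemma cont_near_eq f g x : (\forall y \near x, f y = g y) -> cont_at g x -> cont_at f x.
Proof.
move=> fg /cont_atP cg; apply/cont_atP => e e0.
have fgx := nbhs_singleton fg.
by apply: filterS2 fg (cg e e0) => y ->; rewrite fgx.
Qed.

Lemma cont_realC (f : T -> R) x : {for x, continuous f} ->
  cont_at (fun x => ((f x)%:C : Cplx R)) x.
Proof.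
move=> /cvgrPdist_lt cf; apply/cont_atP => e e0.
by apply: filterS (cf e e0) => y; rewrite -rmorphB /= cabs_real distrC.
Qed.

Lemma cont_comp (S : topologicalType) (h : S -> T) f (y : S) :
  {for y, continuous h} -> cont_at f (h y) -> cont_at (f \o h) y.
Proof. by move=> ch [cf]; constructor; exact: continuous_comp. Qed.

Lemma within_cont_at f (U : set T) : open U ->
  {within U, continuous f} <-> forall x, U x -> cont_at f x.
Proof.
move=> oU; rewrite within_open_continuous //.
by split=> h x Ux; [constructor|case: (h x Ux)]; [exact: h|].
Qed.

End Continuity.
End ComplexModulus.

(** * Compactly supported functions on open Hausdorff subsets *)

Section CompactSupport.
Variables (R : realType) (X : topologicalType).
Implicit Types (f g : X -> Cplx R) (U V S : set X).

(** Any compact set [S] in [U] off which [f] vanishes may replace the closure of the support.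
    Continuity at points of [U] outside [S] is automatic, because [S] can be separated from them
    inside the Hausdorff set [U]. *)
Lemma Cc_onP U f : open U -> hausdorff_space (set_type U) ->
  Cc_on U f <->
  exists S, [/\ compact S, S `<=` U, forall x, ~ S x -> f x = 0 &
                forall x, S x -> cont_at f x].
Proof.
move=> oU hU; split=> [[f0 /(within_cont_at _ oU) cf cS]|[S [cS sSU f0 cf]]].
  exists (U `&` closure [set x | f x != 0]); split=> //.
  - move=> x nS; have [Ux|/f0 //] := pselect (U x).
    apply/eqP; apply: contrapT => /negP fx; apply: nS; split=> //.
    exact: subset_closure.
  - by move=> x [/cf].
have near0 x : U x -> ~ S x -> \forall y \near x, ~ S y.
  move=> Ux nSx; have [V [W [oV oW Vx sSW VW]]] := hausdorff_compact_sep hU cS sSU Ux nSx.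
  apply: filterS (filterI (open_nbhs_nbhs (conj oV Vx)) (open_nbhs_nbhs (conj oU Ux))).
  by move=> y [Vy Uy] /sSW; exact: VW.
split.
- by move=> x nUx; apply: f0 => /sSU.
- apply/within_cont_at => // x Ux; have [/cf //|nSx] := pselect (S x).
  apply: (@cont_near_eq _ _ _ (fun=> 0)); last exact: cont_const.
  by apply: filterS (near0 x Ux nSx) => y /f0.
- have -> : U `&` closure [set x | f x != 0] = S `&` closure [set x | f x != 0].
    rewrite eqEsubset; split=> x [] hx clx; split=> //; last exact: sSU.
    apply: contrapT => nSx; have [y [/eqP fy nSy]] := clx _ (near0 x hx nSx).
    exact/fy/f0.
  by apply: compact_closedI => //; exact: closed_closure.
Qed.

Lemma Cc_on_continuous U f x : open U -> Cc_on U f -> U x -> cont_at f x.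
Proof. by move=> oU [_ /(within_cont_at _ oU) cf _] /cf. Qed.

Lemma Cc_on0 U : Cc_on U (fun=> 0 : Cplx R).
Proof.
split=> //; first by apply: continuous_subspaceT => x; exact: cvg_cst.
suff -> : [set x : X | (0 : Cplx R) != 0] = set0 by rewrite closure0 setI0; exact: compact0.
by rewrite eqEsubset; split=> // x /=; rewrite eqxx.
Qed.

Lemma Cc_on_sub U V f : open U -> open V -> hausdorff_space (set_type V) ->
  U `<=` V -> Cc_on U f -> Cc_on V f.
Proof.
move=> oU oV hV sUV; have hU := hausdorff_set_typeS sUV hV.
move=> /(Cc_onP _ oU hU)[S [cS sSU f0 cf]]; apply/(Cc_onP _ oV hV).
by exists S; split=> //; exact: subset_trans sUV.
Qed.

Lemma Cc_onM U f g : open U -> hausdorff_space (set_type U) ->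
  Cc_on U f -> (forall x, U x -> cont_at g x) -> Cc_on U (fun x => f x * g x).
Proof.
move=> oU hU /(Cc_onP _ oU hU)[S [cS sSU f0 cf]] cg; apply/(Cc_onP _ oU hU).
exists S; split; [exact: cS|exact: sSU| |] => x Sx; first by rewrite f0 // mul0r.
by apply: cont_mul; [exact: cf|exact/cg/sSU].
Qed.

Lemma Cc_onZD U (c : Cplx R) f g : open U -> hausdorff_space (set_type U) ->
  Cc_on U f -> Cc_on U g -> Cc_on U (fun x => c * f x + g x).
Proof.
move=> oU hU Cf Cg.
have /(Cc_onP _ oU hU)[S [cS sSU f0 cf]] := Cf.
have /(Cc_onP _ oU hU)[S' [cS' sSU' g0 cg]] := Cg.
apply/(Cc_onP _ oU hU); exists (S `|` S'); split.
- exact: compactU.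
- by move=> x [/sSU|/sSU'].
- by move=> x nS; rewrite f0 ?g0 ?mulr0 ?addr0 // => h; apply: nS; [right|left].
- move=> x Sx; have Ux : U x by case: Sx => [/sSU|/sSU'].
  apply: cont_add; first apply: cont_scale.
    exact: Cc_on_continuous Cf Ux.
  exact: Cc_on_continuous Cg Ux.
Qed.

Lemma Cc_on_bounded U f : open U -> hausdorff_space (set_type U) -> Cc_on U f ->
  exists M : R, 0 <= M /\ forall x, cabs (f x) <= M.
Proof.
move=> oU hU /(Cc_onP _ oU hU)[S [/compact_near_coveringP cS sSU f0 cf]].
have h : \forall M \near +oo%R, S `<=` (fun x => cabs (f x) <= M).
  apply: cS => x Sx; have /cont_atP/(_ 1 ltr01) cfx := cf x Sx.
  exists ([set y | cabs (f y - f x) < 1], [set M : R | cabs (f x) + 1 <= M]).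
    by split; [exact: cfx|apply: nbhs_pinfty_ge; exact: num_real].
  move=> [y M] /= [h1 h2]; apply: le_trans h2.
  rewrite -[f y](subrK (f x)) addrC; apply: (le_trans (cabsD _ _)).
  by rewrite lerD2l; exact: ltW.
have [M [M0 hM]] := @filter_meet _ _ _ _ _ (nbhs_pinfty_ge (num_real (0:R))) h.
exists M; split=> // x; have [/hM //|/f0 ->] := pselect (S x).
by rewrite cabs0.
Qed.

End CompactSupport.

(** * Bump functions *)

Section Bump.
Variables (R : realType) (X : topologicalType).
Hypothesis hX : locally_compact_space X.

(** Urysohn's lemma is applied in the compact Hausdorff neighbourhood [K], and the support must lie
    in the interior of [K] for the extension by zero to be continuous. The value is 1 on a
    neighbourhood of [q], so that at every point of a compact set one of finitely many bumps equals
    1. *)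
Lemma bump_function (U : set X) (q : X) : open U -> hausdorff_space (set_type U) -> U q ->
  exists k : X -> Cplx R, [/\ Cc_on U k,
    forall x, exists2 t : R, 0 <= t <= 1 & k x = t%:C &
    \forall x \near q, k x = 1].
Proof.
move=> oU hU Uq.
have [K [nK cK sKU hK]] := locally_compact_base hX (open_nbhs_nbhs (conj oU Uq)).
have Kq := nbhs_singleton nK; have [q' eq'] := set_val_mk Kq.
have nT : normal_space (set_type K) by exact: (compact_normal hK (compact_set_type cK)).
have cA : closed (~` (set_val @^-1` interior K) : set (set_type K)).
  by apply: open_closedC; exists (interior K) => //; exact: open_interior.
have cB : closed [set q'].
  by apply: accessible_closed_set1; exact: hausdorff_accessible.
have AB : ~` (set_val @^-1` interior K) `&` [set q'] = set0.
  rewrite eqEsubset; split=> // x [nx /= ex]; subst x; apply: nx.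
  by rewrite /= eq'; exact: nK.
have [f [cf f01 f0 f1]] := (@uniform_separatorP _ R _ _).1 ((@normal_separatorP R _).1 nT _ _ cA cB AB).
(* Zero up to 1/3 and one from 2/3 on: the support becomes a compact subset of the interior of [K],
   and the value 1 is reached on a neighbourhood of [q]. *)
pose h (t : R) : R := Num.min 1 (Num.max 0 (3 * t - 1)).
have ch : continuous h.
  move=> t; apply: (@continuous_min _ R (fun=> 1) (fun t => Num.max 0 (3 * t - 1))).
    exact: cvg_cst.
  apply: (@continuous_max _ R (fun=> 0) (fun t => 3 * t - 1)); first exact: cvg_cst.
  apply: (@continuousB R R R (fun t => 3 * t) (fun=> 1)); last exact: cvg_cst.
  by apply: (@continuousM R R (fun=> 3) id); [exact: cvg_cst|exact: cvg_id].
have h01 t : 0 <= h t <= 1.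
  by rewrite /h le_min ge_min lexx le_max lexx ler01.
have h0 t : t <= 1/3 -> h t = 0.
  by move=> t3; rewrite /h max_l; [rewrite min_r// ler01|lra].
have h1 t : 2/3 <= t -> h t = 1.
  by move=> t3; rewrite /h max_r ?min_l //; lra.
pose k (x : X) : R := if pselect (K x) is left Kx then h (f (exist _ x (mem_set Kx))) else 0.
have kE (x : set_type K) : k (set_val x) = h (f x).
  rewrite /k; case: pselect => [Kx|[]]; last exact: set_valP.
  by congr (h (f _)); exact: val_inj.
pose S := set_val @` [set x : set_type K | 1/3 <= f x].
have cS : compact S.
  apply: compact_set_val; apply: (subclosed_compact _ (compact_set_type cK)) => //.
  apply: (@closed_comp _ _ f [set t | 1/3 <= t]); first by move=> x _; exact: cf.
  exact: closed_ge.
have sSK : S `<=` interior K.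
  move=> _ [x /= fx <-]; apply: contrapT => nx.
  have /= fx0 : (f @` (~` (set_val @^-1` interior K))) (f x) by exists x.
  by have /= := f0 _ fx0; move: fx => /[swap] ->; lra.
exists (fun x => (k x)%:C); split.
- apply/Cc_onP => //; exists S; split=> //.
  + by move=> x /sSK/interior_subset/sKU.
  + move=> x nSx; have [Kx|nKx] := pselect (K x); last first.
      by rewrite /k; case: pselect.
    have [x' ex] := set_val_mk Kx; subst x; rewrite kE h0 //.
    by apply: ltW; rewrite ltNge; apply/negP => fx; apply: nSx; exists x'.
  + move=> x /sSK Kx; have := interior_subset Kx => Kx'.
    have [x' ex] := set_val_mk Kx'; subst x; apply: cont_realC.
    apply/cvgrPdist_lt => e e0.
    have /cvgrPdist_lt/(_ e e0)/nbhs_set_type[V nV sV] :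
      {for x', continuous (h \o f)} by apply: continuous_comp; [exact: cf|exact: ch].
    apply: filterS (filterI nV Kx) => y [Vy Ky].
    have [y' ey] := set_val_mk Ky; subst y.
    by rewrite !kE; exact: (sV y').
- by move=> x; exists (k x) => //; rewrite /k; case: pselect => // _; rewrite lexx ler01.
- have fq : f q' = 1 by apply: f1; exists q'.
  have /nbhs_set_type[V nV sV] : \forall x \near q', 2/3 <= f x.
    have /cvgrPdist_lt/(_ (1/3)) : {for q', continuous f} by exact: cf.
    move=> hh; have /hh : (0 : R) < 1/3 by lra.
    by apply: filterS => x; rewrite fq ltr_norml => /andP[]; lra.
  rewrite eq' in nV; apply: filterS (filterI nV nK) => y [Vy Ky].
  by have [y' ey] := set_val_mk Ky; subst y; rewrite kE h1 //; exact: sV.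
Qed.

End Bump.

(** * Groupoids and convolution *)

Section GroupoidAlgebra.
Variables (G : topologicalType) (o : groupoid_data G).
Hypothesis gG : is_groupoid o.
Local Notation r := (grng o).
Local Notation s := (gsrc o).
Local Notation inv := (ginv o).
Local Notation "x ** y" := (gmul o x y) (at level 40, left associativity).
Implicit Types x y z u : G.

Lemma g_rr x : r (r x) = r x. Proof. by have [h _ _ _ _] := gG; case: (h x). Qed.
Lemma g_sr x : s (r x) = r x. Proof. by have [h _ _ _ _] := gG; case: (h x). Qed.
Lemma g_rs x : r (s x) = s x. Proof. by have [h _ _ _ _] := gG; case: (h x). Qed.
Lemma g_rM x y : s x = r y -> r (x ** y) = r x.
Proof. by move=> e; have [_ h _ _ _] := gG; case: (h x y e). Qed.
Lemma g_sM x y : s x = r y -> s (x ** y) = s y.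
Proof. by move=> e; have [_ h _ _ _] := gG; case: (h x y e). Qed.
Lemma g_A x y z : s x = r y -> s y = r z -> x ** y ** z = x ** (y ** z).
Proof. by have [_ _ h _ _] := gG; exact: h. Qed.
Lemma g_rx x : r x ** x = x. Proof. by have [_ _ _ h _] := gG; case: (h x). Qed.
Lemma g_xs x : x ** s x = x. Proof. by have [_ _ _ h _] := gG; case: (h x). Qed.
Lemma g_ri x : r (inv x) = s x. Proof. by have [_ _ _ _ h] := gG; case: (h x). Qed.
Lemma g_si x : s (inv x) = r x. Proof. by have [_ _ _ _ h] := gG; case: (h x). Qed.
Lemma g_xi x : x ** inv x = r x. Proof. by have [_ _ _ _ h] := gG; case: (h x). Qed.
Lemma g_ix x : inv x ** x = s x. Proof. by have [_ _ _ _ h] := gG; case: (h x). Qed.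

Lemma g_Ki x y : s x = r y -> inv x ** (x ** y) = y.
Proof. by move=> e; rewrite -g_A ?g_si // g_ix e g_rx. Qed.

Lemma g_iK x y : r x = r y -> x ** (inv x ** y) = y.
Proof. by move=> e; rewrite -g_A ?g_si ?g_ri // g_xi e g_rx. Qed.

Lemma g_invK x : inv (inv x) = x.
Proof. have e1 : s (inv (inv x)) = r (inv x) by rewrite g_si.
have e2 : s (inv x) = r x by rewrite g_si.
by have := g_A e1 e2; rewrite g_ix g_ix g_si g_rx => e; rewrite [RHS]e -[LHS]g_xs g_si g_ri. Qed.

Lemma g_invM x y : s x = r y -> inv (x ** y) = inv y ** inv x.
Proof.
move=> e; have e' : s (inv y) = r (inv x) by rewrite g_si g_ri.
have h : (x ** y) ** (inv y ** inv x) = r x.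
  rewrite g_A //; last by rewrite g_rM // g_ri.
  by rewrite g_iK ?g_ri // g_xi.
have := @g_Ki (x ** y) (inv y ** inv x); rewrite h g_sM // g_rM // g_ri => <- //.
by rewrite -(@g_rM x y e) -g_si g_xs.
Qed.

Lemma g_unitP u : units o u <-> r u = u.
Proof. by split=> [[x _ <-]|<-]; [exact: g_rr|exists u]. Qed.

Lemma g_unit_s u : units o u -> s u = u.
Proof. by move=> /g_unitP <-; rewrite g_sr. Qed.

Lemma g_unit_i u : units o u -> inv u = u.
Proof.
move=> uu; have e := (g_unitP u).1 uu; have e' := g_unit_s uu.
by rewrite -[LHS]g_rx g_ri e' g_xi.
Qed.

Lemma g_unit_r x : units o (r x). Proof. by exists x. Qed.
Lemma g_unit_src x : units o (s x). Proof. by apply/g_unitP; exact: g_rs. Qed.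

End GroupoidAlgebra.

(** * Sums with finite support *)

Section FiniteSupport.
Variable R : realType.

Lemma fsum_single (T : choiceType) (A : set T) (F : T -> Cplx R) z0 :
  A z0 -> (forall z, A z -> z <> z0 -> F z = 0) -> \sum_(z \in A) F z = F z0.
Proof.
move=> Az0 hF; rewrite -[RHS](@fsbig_set1 _ _ +%R _ z0 F); symmetry; apply: fsbig_widen => z.
  by move=> ->.
by move=> [Az /= nz]; exact: hF.
Qed.

Lemma fsum_supp (T : choiceType) (A B : set T) (F : T -> Cplx R) : B `<=` A ->
  (forall z, A z -> ~ B z -> F z = 0) -> \sum_(z \in A) F z = \sum_(z \in B) F z.
Proof.
by move=> sBA hF; symmetry; apply: fsbig_widen => // z [Az nB]; exact: hF.
Qed.

Lemma fsum_conj (T : choiceType) (A : set T) (F : T -> Cplx R) :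
  (\sum_(z \in A) F z)^* = \sum_(z \in A) (F z)^*.
Proof.
have e : A `&` (fun z => (F z)^*) @^-1` [set~ 0] = A `&` F @^-1` [set~ 0].
  rewrite eqEsubset; split=> z [Az] /= nz; split=> // h; apply: nz.
    by rewrite h; exact: rmorph0.
  by rewrite -[F z]conjKc h; exact: rmorph0.
rewrite conj_sum; suff -> : finite_support 0 A F = finite_support 0 A (fun z => (F z)^*) by [].
by rewrite /finite_support !unlock e.
Qed.

(** The finiteness hypotheses are essential: a sum with infinite support is 0 by convention, which
    breaks additivity. *)
Lemma fsum_add (T : choiceType) (A : set T) (F F' : T -> Cplx R) :
  finite_set (A `&` [set z | F z <> 0]) -> finite_set (A `&` [set z | F' z <> 0]) ->
  \sum_(z \in A) (F z + F' z) = \sum_(z \in A) F z + \sum_(z \in A) F' z.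
Proof.
move=> fF fF'.
pose B := (A `&` [set z | F z <> 0]) `|` (A `&` [set z | F' z <> 0]).
have sBA : B `<=` A by move=> z [] [].
have hB z : A z -> ~ B z -> F z = 0 /\ F' z = 0.
  move=> Az nB; split; apply: contrapT => h; apply: nB; [by left|by right].
have fB : finite_set B by rewrite finite_setU.
rewrite !(fsum_supp sBA).
- exact: fsbig_split.
- by move=> z Az /(hB z Az)[].
- by move=> z Az /(hB z Az)[].
- by move=> z Az /(hB z Az)[-> ->]; rewrite addr0.
Qed.

End FiniteSupport.

(** * The convolution algebra of fibrewise finite functions *)

Section AlgebraicConvolution.
Variables (R : realType) (G : topologicalType) (o : groupoid_data G).
Hypothesis gG : is_groupoid o.
Local Notation r := (grng o).
Local Notation s := (gsrc o).
Local Notation inv := (ginv o).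
Local Notation "x ** y" := (gmul o x y) (at level 40, left associativity).
Implicit Types (f g h : G -> Cplx R) (x y z u : G).

(** The algebraic condition under which convolution is bilinear, associative and compatible with
    [star]. Range and source fibres both occur because [star] exchanges them. It serves for [G] and
    for HG. *)
Definition fibre_finite f := forall u,
  finite_set [set z | r z = u /\ f z <> 0] /\ finite_set [set z | s z = u /\ f z <> 0].

Lemma fibre_finite0 : fibre_finite (fun=> 0).
Proof.
by move=> u; split; apply: (@sub_finite_set _ _ set0) => // z [].
Qed.

Lemma fibre_finiteD f g : fibre_finite f -> fibre_finite g ->
  fibre_finite (fun x => f x + g x).
Proof.
move=> ff fg u; have [f1 f2] := ff u; have [g1 g2] := fg u.
have h z : f z + g z <> 0 -> f z <> 0 \/ g z <> 0.
  move=> fgz; have [fz|] := pselect (f z = 0); last by left.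
  by right=> gz; apply: fgz; rewrite fz gz addr0.
split.
  apply: (@sub_finite_set _ _ ([set z | r z = u /\ f z <> 0] `|` [set z | r z = u /\ g z <> 0])).
    by move=> z [ez /h[]]; [left|right].
  by rewrite finite_setU.
apply: (@sub_finite_set _ _ ([set z | s z = u /\ f z <> 0] `|` [set z | s z = u /\ g z <> 0])).
  by move=> z [ez /h[]]; [left|right].
by rewrite finite_setU.
Qed.

Lemma fibre_finiteM f g : fibre_finite f -> fibre_finite (fun x => f x * g x).
Proof.
move=> ff u; have [f1 f2] := ff u.
have h z : f z * g z <> 0 -> f z <> 0 by move=> /[swap] ->; rewrite mul0r.
by split; [apply: sub_finite_set f1|apply: sub_finite_set f2] => z [ez /h].
Qed.

Lemma fibre_finite_star f : fibre_finite f -> fibre_finite (star o f).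
Proof.
move=> ff u; have [f1 f2] := ff u.
have h z : star o f z <> 0 -> f (inv z) <> 0.
  by move=> hz fz; apply: hz; rewrite /star fz; exact: rmorph0.
split.
  apply: sub_finite_set (finite_image inv f2) => z [ez /h fz].
  by exists (inv z); [rewrite /= (g_si gG) ez|rewrite (g_invK gG)].
apply: sub_finite_set (finite_image inv f1) => z [ez /h fz].
by exists (inv z); [rewrite /= (g_ri gG) ez|rewrite (g_invK gG)].
Qed.

Lemma fibre_finite_conv f g : fibre_finite f -> fibre_finite g ->
  fibre_finite (gconv o f g).
Proof.
move=> ff fg.
have h x : gconv o f g x <> 0 -> exists z y, [/\ x = z ** y, s z = r y, f z <> 0 & g y <> 0].
  move=> hx; apply: contrapT => hn; apply: hx; apply: fsbig1 => z /= ez.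
  have [->|fz] := pselect (f z = 0); first by rewrite mul0r.
  have [->|gz] := pselect (g (inv z ** x) = 0); first by rewrite mulr0.
  case: hn; exists z, (inv z ** x).
  by split=> //; [rewrite (g_iK gG)|rewrite (g_rM gG) ?(g_ri gG) // (g_si gG)].
move=> u; have [f1 f2] := ff u; have [g1 g2] := fg u; split.
  apply: sub_finite_set (bigcup_finite f1
    (fun z _ => finite_image (fun y => z ** y) (fg (s z)).1)) => x [ex /h[z [y [exy e fz gy]]]].
  by move: ex; rewrite exy (g_rM gG) // => ex; exists z => //; exists y.
apply: sub_finite_set (bigcup_finite g2
  (fun y _ => finite_image (fun z => z ** y) (ff (r y)).2)) => x [ex /h[z [y [exy e fz gy]]]].
by move: ex; rewrite exy (g_sM gG) // => ex; exists y => //; exists z.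
Qed.

Lemma conv_suppE f g x : gconv o f g x =
  \sum_(z \in [set z | r z = r x /\ f z <> 0]) f z * g (inv z ** x).
Proof.
by apply: fsum_supp => [z []//|z /= ez nz]; have [->|] := pselect (f z = 0); rewrite ?mul0r // => fz; case: nz.
Qed.

Lemma conv_assoc f g h x : fibre_finite f -> fibre_finite g -> fibre_finite h ->
  gconv o (gconv o f g) h x = gconv o f (gconv o g h) x.
Proof.
move=> ff fg fh.
pose P := [set w | r w = r x /\ f w <> 0].
(* A finite set carrying both iterated sums in [z], which permits their exchange. *)
pose Q := [set z | r z = r x /\ gconv o f g z <> 0] `|`
  \bigcup_(w in P) ((fun y => w ** y) @` [set y | r y = s w /\ g y <> 0]).
have fP : finite_set P := (ff (r x)).1.
have fQ : finite_set Q.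
  rewrite finite_setU; split; first exact: (fibre_finite_conv ff fg (r x)).1.
  by apply: bigcup_finite => // w _; apply: finite_image; exact: (fg (s w)).1.
have rQ z : Q z -> r z = r x.
  by move=> [[]//|[w [ew _] [y [ey _] <-]]]; rewrite (g_rM gG).
transitivity (\sum_(z \in Q) \sum_(w \in P) f w * g (inv w ** z) * h (inv z ** x)).
  rewrite conv_suppE; have sQ : [set z | r z = r x /\ gconv o f g z <> 0] `<=` Q by left.
  rewrite -(fsum_supp sQ); last first.
    move=> z Qz nz; have [->|] := pselect (gconv o f g z = 0); rewrite ?mul0r // => cz.
    by case: nz; split=> //; exact: rQ.
  apply: eq_fsbigr => z /set_mem/rQ ez.
  by rewrite conv_suppE ez mulr_fsuml.
rewrite exchange_fsbig // conv_suppE; apply: eq_fsbigr => w /set_mem[ew fw].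
rewrite [gconv o g h _]conv_suppE mulr_fsumr.
have rwx : r (inv w ** x) = s w by rewrite (g_rM gG) ?(g_ri gG) ?(g_si gG).
rewrite rwx.
(* Substitution [z = w ** y], with [y] in the support of [g]. *)
pose S := (fun y => w ** y) @` [set y | r y = s w /\ g y <> 0].
rewrite (@fsum_supp _ _ Q S).
- rewrite fsbig_image; last first.
    move=> y y' /set_mem[ey _] /set_mem[ey' _] e.
    by rewrite -(@g_Ki _ _ gG w y) // e (g_Ki gG).
  apply: eq_fsbigr => y /set_mem[ey gy].
  by rewrite (g_Ki gG) // (g_invM gG) // (g_A gG) ?mulrA ?(g_si gG) ?(g_ri gG).
- by move=> _ [y [ey gy] <-]; right; exists w => //; exists y.
- move=> z /rQ ez nz; have [->|gz] := pselect (g (inv w ** z) = 0).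
    by rewrite mulr0 mul0r.
  case: nz; exists (inv w ** z); last by rewrite (g_iK gG) // ew.
  by split=> //; rewrite (g_rM gG) ?(g_ri gG) // (g_si gG) ew.
Qed.

Lemma star_conv f g x : fibre_finite f -> fibre_finite g ->
  star o (gconv o f g) x = gconv o (star o g) (star o f) x.
Proof.
move=> ff fg; rewrite /star /gconv fsum_conj (g_ri gG).
rewrite (@reindex_fsbig _ _ _ _ _ (fun y => inv x ** y) [set y | r y = r x]).
  apply: eq_fsbigr => y /set_mem/= ey.
  rewrite conjM mulrC (g_invM gG) ?(g_si gG) // (g_invK gG).
  have -> : inv y ** x ** inv x = inv y.
    by rewrite (g_A gG) ?(g_si gG) ?(g_ri gG) // (g_xi gG) -ey -(g_si gG) (g_xs gG).
  by rewrite (g_invM gG) ?(g_si gG) // (g_invK gG).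
split.
- by move=> y /= ey; rewrite (g_rM gG) ?(g_si gG) // (g_ri gG).
- move=> y y' /set_mem/= ey /set_mem/= ey' e.
  by rewrite -(@g_iK _ _ gG x y) // e (g_iK gG).
- move=> y /= ey; exists (x ** y); last by rewrite (g_Ki gG).
  by rewrite /= (g_rM gG).
Qed.

Lemma starK f : star o (star o f) = f.
Proof. by apply/funext => x; rewrite /star conjKc (g_invK gG). Qed.

Lemma convDl f f' g x : fibre_finite f -> fibre_finite f' ->
  gconv o (fun x => f x + f' x) g x = gconv o f g x + gconv o f' g x.
Proof.
move=> ff ff'; rewrite /gconv -fsum_add.
- by apply: eq_fsbigr => z _; rewrite mulrDl.
- by apply: sub_finite_set (ff (r x)).1 => z [ez fz]; split=> // h; apply: fz; rewrite h mul0r.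
- by apply: sub_finite_set (ff' (r x)).1 => z [ez fz]; split=> // h; apply: fz; rewrite h mul0r.
Qed.

Lemma convDr f g g' x : fibre_finite f ->
  gconv o f (fun x => g x + g' x) x = gconv o f g x + gconv o f g' x.
Proof.
move=> ff; rewrite /gconv -fsum_add.
- by apply: eq_fsbigr => z _; rewrite mulrDr.
- by apply: sub_finite_set (ff (r x)).1 => z [ez fz]; split=> // h; apply: fz; rewrite h mul0r.
- by apply: sub_finite_set (ff (r x)).1 => z [ez fz]; split=> // h; apply: fz; rewrite h mul0r.
Qed.

End AlgebraicConvolution.

(** * Bisections of an etale groupoid *)

(** Finite subcovers with data attached. [T] is an arbitrary type, hence lists with [List.In]; the
    filter of lists that contain a given finite list turns a near covering into the selection of one
    list. *)
Lemma compact_list_cover (X : topologicalType) (T : Type) (ok : T -> Prop)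
    (P : T -> X -> Prop) (S : set X) : compact S ->
  (forall x, S x -> exists2 t, ok t & \forall y \near x, P t y) ->
  exists l : seq T, (forall t, List.In t l -> ok t) /\
    forall x, S x -> exists2 t, List.In t l & P t x.
Proof.
move=> /compact_near_coveringP cS hS.
pose okl (l : seq T) := forall t, List.In t l -> ok t.
pose F : set_system (seq T) := [set A | exists2 l0, okl l0 &
  forall l, okl l -> (forall t, List.In t l0 -> List.In t l) -> A l].
have fF : Filter F.
  split.
  - by exists [::].
  - move=> A B [l1 o1 h1] [l2 o2 h2]; exists (l1 ++ l2).
      by move=> t /List.in_app_iff[/o1|/o2].
    move=> l ol sl; split.
      by apply: h1 => // t tl; apply: sl; apply/List.in_app_iff; left.
    by apply: h2 => // t tl; apply: sl; apply/List.in_app_iff; right.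
  - by move=> A B sAB [l1 o1 h1]; exists l1 => // l ol sl; apply: sAB; exact: h1.
have [l ol hl] : F (fun l => S `<=` (fun x => exists2 t, List.In t l & P t x)).
  apply: (cS (seq T) F (fun l x => exists2 t, List.In t l & P t x) fF) => x /hS[t okt nt].
  exists (P t, [set l | List.In t l]).
    split=> //=; exists [:: t]; first by move=> t' [<-|].
    by move=> l ol; apply; left.
  by move=> [y l] [/= Py tl]; exists t.
by exists l; split=> // x Sx; exact: (hl l).
Qed.

Section TopologicalGroupoid.
Variables (G : topologicalType) (o : groupoid_data G).
Hypothesis tG : topological_groupoid o.
Local Notation r := (grng o).
Local Notation s := (gsrc o).
Local Notation inv := (ginv o).
Local Notation "x ** y" := (gmul o x y) (at level 40, left associativity).
Implicit Types (x y z u : G) (U V W : set G).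

Lemma gpdG : is_groupoid o. Proof. by case: tG. Qed.
Local Notation gG := gpdG.

Lemma inv_cont : continuous inv. Proof. by case: tG. Qed.

Lemma mul_nbhs x y W : s x = r y -> nbhs (x ** y) W ->
  exists U V, [/\ nbhs x U, nbhs y V &
    forall x' y', U x' -> V y' -> s x' = r y' -> W (x' ** y')].
Proof.
move=> e nW; have [_ _ /subspace_continuousP cm] := tG.
have [[U V] /= [nU nV] sUV] := cm (x, y) e W nW.
by exists U, V; split=> // x' y' Ux' Vy' e'; apply: (sUV (x', y')).
Qed.

(** [topological_groupoid] asks for a continuous product and inverse only; [r x = x ** inv x] gives
    the rest. *)
Lemma rng_cont : continuous r.
Proof.
move=> x W; rewrite /= -[nbhs (r x) W]/(nbhs (r x) W) -(g_xi gG) => nW.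
have [U [V [nU nV UV]]] := mul_nbhs (esym (g_ri gG x)) nW.
apply: filterS (filterI nU (inv_cont nV)) => y [Uy Vy] /=.
by rewrite -(g_xi gG); apply: UV => //; rewrite (g_ri gG).
Qed.

Lemma src_cont : continuous s.
Proof.
have -> : s = r \o inv by apply/funext => x /=; rewrite (g_ri gG).
by move=> x; apply: continuous_comp; [exact: inv_cont|exact: rng_cont].
Qed.

Lemma inv_open V : open V -> open (inv @^-1` V).
Proof. by move=> oV; apply: open_comp => // x _; exact: inv_cont. Qed.

Hypothesis etG : etale o.

(** Near a unit, [z] and [r z] both lie in a set on which [r] is injective, and they have the same
    range. *)
Lemma units_open : open (units o).
Proof.
rewrite openE => u /(g_unitP gG) eu.
have [V [oV Vu _ [_ _ [g _ gr]]]] := etG u.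
have nV : nbhs u V by exact: open_nbhs_nbhs.
have nrV : nbhs u (r @^-1` V) by apply: rng_cont; rewrite eu.
apply: filterS (filterI nV nrV) => z [Vz Vrz]; apply/(g_unitP gG).
by rewrite -[LHS](gr _ Vrz) (g_rr gG) gr.
Qed.

Lemma open_in_units V : open_in (units o) V -> open V.
Proof. by move=> [W oW ->]; apply: openI => //; exact: units_open. Qed.

Lemma rng_section x : exists V (f : G -> G), [/\ open V, V x, open (r @` V),
  (forall y, V y -> f (r y) = y) & forall u, (r @` V) u -> {for u, continuous f}].
Proof.
have [V [oV Vx /open_in_units orV [_ _ [g cg gr]]]] := etG x.
by exists V, g; split=> //; apply/within_open_continuous.
Qed.

(** [sr] and [ss] invert the range and source maps of the open bisection [V]. They are total
    functions constrained only over the images of [V], so values elsewhere have to be guarded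
    against. *)
Record bisection_with (V : set G) (sr ss : G -> G) : Prop := BisectionWith {
  bi_open : open V;
  bi_ropen : open (r @` V);
  bi_sopen : open (s @` V);
  bi_rK : forall y, V y -> sr (r y) = y;
  bi_sK : forall y, V y -> ss (s y) = y;
  bi_rcont : forall u, (r @` V) u -> {for u, continuous sr};
  bi_scont : forall u, (s @` V) u -> {for u, continuous ss} }.

Definition bisection V := exists sr ss, bisection_with V sr ss.

(** Inside the open set [t(U)], the image of [V] is the preimage of [V] under the continuous section
    [f]. *)
Lemma section_image_open U V (t f : G -> G) : open U -> open V -> V `<=` U -> open (t @` U) ->
  (forall y, U y -> f (t y) = y) -> (forall u, (t @` U) u -> {for u, continuous f}) ->
  open (t @` V).
Proof.
move=> oU oV sVU otU fK cf; rewrite openE => _ [y Vy <-].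
have Uy := sVU _ Vy; have tUy : (t @` U) (t y) by exists y.
have n1 : nbhs (t y) (t @` U) by exact: open_nbhs_nbhs.
have n2 : nbhs (t y) (f @^-1` V).
  by apply: (cf _ tUy); rewrite fK //; exact: open_nbhs_nbhs.
apply: filterS (filterI n1 n2) => _ [[z Uz <-] /= Vz].
by rewrite fK // in Vz; exists z.
Qed.

Lemma bisectionS U V sr ss : bisection_with U sr ss -> open V -> V `<=` U ->
  bisection_with V sr ss.
Proof.
move=> [oU orU osU rK sK cr cs] oV sVU; split=> //.
- exact: (section_image_open oU oV sVU orU rK cr).
- exact: (section_image_open oU oV sVU osU sK cs).
- by move=> y /sVU/rK.
- by move=> y /sVU/sK.
- by move=> _ [y /sVU Uy <-]; apply: cr; exists y.
- by move=> _ [y /sVU Uy <-]; apply: cs; exists y.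
Qed.

(** A local section of [r] at [x] is intersected with the inverse of one at [inv x], which is a
    local section of [s]. *)
Lemma bisection_ex x U : open U -> U x -> exists V sr ss,
  [/\ bisection_with V sr ss, V x & V `<=` U].
Proof.
move=> oU Ux.
have [V1 [f1 [oV1 V1x orV1 f1K cf1]]] := rng_section x.
have [V2 [f2 [oV2 V2x orV2 f2K cf2]]] := rng_section (inv x).
pose V := V1 `&` (inv @^-1` V2) `&` U.
have oV : open V by apply: openI => //; apply: openI => //; exact: inv_open.
have sV1 : V `<=` V1 by move=> y [[]].
have rV2 : r @` V2 = s @` (inv @^-1` V2).
  rewrite eqEsubset; split=> _ [y Vy <-]; exists (inv y);
    rewrite /= ?(g_invK gG) ?(g_si gG) ?(g_ri gG) //.
have f2K' y : (inv @^-1` V2) y -> inv (f2 (s y)) = y.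
  by move=> /= Vy; rewrite -(g_ri gG) f2K // (g_invK gG).
have cf2' u : (s @` (inv @^-1` V2)) u -> {for u, continuous (inv \o f2)}.
  rewrite -rV2 => Vu; apply: continuous_comp; first exact: cf2.
  exact: inv_cont.
exists V, f1, (inv \o f2); split; last by move=> y [].
- split=> //.
  + exact: (section_image_open oV1 oV sV1 orV1 f1K cf1).
  + have sV2 : V `<=` inv @^-1` V2 by move=> y [[]].
    rewrite rV2 in orV2.
    exact: (@section_image_open _ V s (inv \o f2) (inv_open oV2) oV sV2 orV2 f2K' cf2').
  + by move=> y /sV1/f1K.
  + by move=> y [[_ Vy] _] /=; exact: f2K'.
  + by move=> _ [y /sV1 Vy <-]; apply: cf1; exists y.
  + by move=> _ [y [[_ Vy] _] <-]; apply: cf2'; exists y.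
- by [].
Qed.

Lemma bisection_inv V sr ss : bisection_with V sr ss ->
  bisection_with (inv @^-1` V) (inv \o ss) (inv \o sr).
Proof.
move=> [oV orV osV rK sK cr cs].
have er : r @` (inv @^-1` V) = s @` V.
  rewrite eqEsubset; split=> _ [y Vy <-]; exists (inv y);
    rewrite /= ?(g_invK gG) ?(g_si gG) ?(g_ri gG) //.
have es : s @` (inv @^-1` V) = r @` V.
  rewrite eqEsubset; split=> _ [y Vy <-]; exists (inv y);
    rewrite /= ?(g_invK gG) ?(g_si gG) ?(g_ri gG) //.
split; rewrite ?er ?es //.
- exact: inv_open.
- by move=> y /= Vy; rewrite -(g_si gG) sK // (g_invK gG).
- by move=> y /= Vy; rewrite -(g_ri gG) rK // (g_invK gG).
- by move=> u /cs h; apply: continuous_comp => //; exact: inv_cont.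
- by move=> u /cr h; apply: continuous_comp => //; exact: inv_cont.
Qed.

Hypothesis hU : hausdorff_space (set_type (units o)).

Lemma units_sep u v : units o u -> units o v -> u <> v ->
  exists V W, [/\ nbhs u V, nbhs v W & forall z, V z -> W z -> False].
Proof.
move=> uu uv /((hausdorff_set_typeP _).1 hU u v uu uv)[V [W [oV oW Vu Wv VW]]].
exists (V `&` units o), W; split.
- by apply: filterI; apply: open_nbhs_nbhs; split=> //; exact: units_open.
- exact: open_nbhs_nbhs.
- by move=> z [Vz uz] Wz; exact: VW Wz.
Qed.

Lemma units_lim_unique (F : set_system G) u v : ProperFilter F -> units o u -> units o v ->
  limset F u -> limset F v -> u = v.
Proof.
move=> PF uu uv Fu Fv; apply: contrapT => /(units_sep uu uv)[V [W [nV nW VW]]].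
by have [z [Vz Wz]] := filter_meet PF (Fu _ nV) (Fv _ nW); exact: VW Wz.
Qed.

(** Points of [V] are separated by their ranges in the Hausdorff unit space. Bisections and products
    of bisections are Hausdorff for this reason. *)
Lemma rng_inj_hausdorff V : (forall x y, V x -> V y -> r x = r y -> x = y) ->
  hausdorff_space (set_type V).
Proof.
move=> rinj; apply/hausdorff_set_typeP => x y Vx Vy xy.
have [|A [B [nA nB AB]]] := units_sep (g_unit_r o x) (g_unit_r o y).
  by move=> e; apply: xy; exact: rinj.
exists (interior (r @^-1` A)), (interior (r @^-1` B)); split; try exact: open_interior.
- exact: (rng_cont nA).
- exact: (rng_cont nB).
- by move=> z _ /interior_subset Az /interior_subset Bz; exact: AB Bz.
Qed.

Lemma bisection_hausdorff V : bisection V -> hausdorff_space (set_type V).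
Proof.
move=> [sr [ss bV]]; apply: rng_inj_hausdorff => x y Vx Vy e.
by rewrite -[x](bi_rK bV Vx) e (bi_rK bV Vy).
Qed.

Lemma bisection_open V : bisection V -> open V.
Proof. by move=> [sr [ss []]]. Qed.

(** * Compactly supported functions on bisections *)

Section CcBisections.
Variable R : realType.
Hypothesis hX : locally_compact_space G.
Implicit Types f g : G -> Cplx R.

(** The span of functions supported in bisections, inductive so that bilinear statements reduce to
    single bisections. [Cc_spanP] identifies it with [Cc_span]. *)
Inductive bispan : (G -> Cplx R) -> Prop :=
| bispan0 : bispan (fun=> 0)
| bispanD V f g : bisection V -> Cc_on V f -> bispan g -> bispan (fun x => f x + g x).

Lemma bispan_bis V f : bisection V -> Cc_on V f -> bispan f.
Proof.
move=> bV Cf; have -> : f = (fun x => f x + (fun=> 0) x).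
  by apply/funext => x; rewrite addr0.
by apply: bispanD bV Cf _; exact: bispan0.
Qed.

Lemma bispan_add f g : bispan f -> bispan g -> bispan (fun x => f x + g x).
Proof.
move=> bf bg; elim: bf => [|V f1 f2 bV Cf1 _ IH].
  by rewrite (_ : (fun x => _) = g) //; apply/funext => x; rewrite add0r.
rewrite (_ : (fun x => _) = fun x => f1 x + (f2 x + g x)); last first.
  by apply/funext => x; rewrite addrA.
exact: bispanD bV Cf1 IH.
Qed.

Lemma Cc_on_scale V (c : Cplx R) f : bisection V -> Cc_on V f -> Cc_on V (fun x => c * f x).
Proof.
move=> bV Cf; have oV := bisection_open bV; have hV := bisection_hausdorff bV.
have := Cc_onZD c oV hV Cf (Cc_on0 _ V).
by rewrite (_ : (fun x => _ + 0) = fun x => c * f x) //; apply/funext => x; rewrite addr0.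
Qed.

Lemma bispan_scale (c : Cplx R) f : bispan f -> bispan (fun x => c * f x).
Proof.
elim=> [|V f1 f2 bV Cf1 _ IH].
  by rewrite (_ : (fun x => _) = fun=> 0); [exact: bispan0|apply/funext => x; rewrite mulr0].
rewrite (_ : (fun x => _) = fun x => c * f1 x + c * f2 x); last first.
  by apply/funext => x; rewrite mulrDr.
exact: (bispanD bV (Cc_on_scale c bV Cf1) IH).
Qed.

(** Splitting off [k f] leaves [(1 - k) f], which vanishes where [k = 1]; after the whole list
    nothing is left. No sum of bumps has to be inverted. *)
Lemma bispan_telescope U (l : seq (G -> Cplx R)) : open U -> hausdorff_space (set_type U) ->
  (forall k, List.In k l -> exists V, [/\ bisection V, V `<=` U & Cc_on V k]) ->
  forall f, Cc_on U f -> (forall x, f x <> 0 -> exists2 k, List.In k l & k x = 1) -> bispan f.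
Proof.
move=> oU hausU; elim: l => [|k l IH] hl f Cf hf.
  rewrite (_ : f = fun=> 0); first exact: bispan0.
  by apply/funext => x; apply: contrapT => /hf[].
have [V [bV sVU Ck]] := hl k (or_introl erefl).
have oV := bisection_open bV; have hV := bisection_hausdorff bV.
have CkU : Cc_on U k by exact: Cc_on_sub sVU Ck.
rewrite (_ : f = fun x => k x * f x + f x * (1 - k x)); last first.
  by apply/funext => x; rewrite mulrBr mulr1 addrC mulrC subrK.
apply: bispanD bV _ _.
  by apply: Cc_onM => // x /sVU Ux; exact: Cc_on_continuous Cf Ux.
apply: IH => [k' kl'||x].
- by apply: hl; right.
- apply: Cc_onM => // x Ux; apply: cont_sub; first exact: cont_const.
  exact: Cc_on_continuous CkU Ux.
- move=> h; have fx : f x <> 0 by move=> e; apply: h; rewrite e mul0r.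
  have [k' [<-|kl'] k'x] := hf x fx; last by exists k'.
  by case: h; rewrite k'x subrr mulr0.
Qed.

Lemma bump_bisection x U : open U -> U x -> exists V (k : G -> Cplx R),
  [/\ bisection V, V `<=` U, Cc_on V k,
    forall y, exists2 t : R, 0 <= t <= 1 & k y = t%:C & \forall y \near x, k y = 1].
Proof.
move=> oU Ux; have [V [sr [ss [bV Vx sVU]]]] := bisection_ex oU Ux.
have bV' : bisection V by exists sr, ss.
have [k [Ck k01 k1]] := bump_function R hX (bisection_open bV') (bisection_hausdorff bV') Vx.
by exists V, k.
Qed.

Lemma Cc_on_bispan U f : open U -> hausdorff_space (set_type U) -> Cc_on U f -> bispan f.
Proof.
move=> oU hausU Cf; have /(Cc_onP _ oU hausU)[S [cS sSU f0 _]] := Cf.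
have [x Sx|l [okl hl]] := @compact_list_cover G (G -> Cplx R)
    (fun k => exists V, [/\ bisection V, V `<=` U & Cc_on V k]) (fun k x => k x = 1) S cS.
  have [V [k [bV sVU Ck _ k1]]] := bump_bisection oU (sSU _ Sx).
  by exists k => //; exists V.
apply: (bispan_telescope oU hausU okl Cf) => x fx; apply: hl.
by apply: contrapT => /f0.
Qed.

Lemma Cc_spanP f : Cc_span f <-> bispan f.
Proof.
split=> [[n [U [c [g [hg ->]]]]]|].
  elim: n => [|n IH] in U c g hg *.
    rewrite (_ : (fun x => _) = fun=> 0); first exact: bispan0.
    by apply/funext => x; rewrite big_ord0.
  rewrite (_ : (fun x => _) = fun x => c ord0 * g ord0 x +
      \sum_(i < n) c (lift ord0 i) * g (lift ord0 i) x); last first.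
    by apply/funext => x; rewrite big_ord_recl.
  apply: bispan_add; last by apply: (IH (fun i => U (lift ord0 i))
    (fun i => c (lift ord0 i)) (fun i => g (lift ord0 i))).
  by apply: bispan_scale; have [oU hausU Cg] := hg ord0; exact: Cc_on_bispan Cg.
elim=> [|V f1 f2 bV Cf1 _ [n [U [c [g [hg ->]]]]]].
  exists 0%N, (fun=> set0), (fun=> 0), (fun=> fun=> 0); split; first by case.
  by apply/funext => x; rewrite big_ord0.
exists n.+1, (fun i => if unlift ord0 i is Some j then U j else V),
  (fun i => if unlift ord0 i is Some j then c j else 1),
  (fun i => if unlift ord0 i is Some j then g j else f1); split.
  move=> i; case: (unlift ord0 i) => [j|]; first exact: hg.
  by split; [exact: bisection_open|exact: bisection_hausdorff|].
apply/funext => x; rewrite big_ord_recl unlift_none mul1r; congr (_ + _).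
by apply: eq_bigr => i _; rewrite liftK.
Qed.

Lemma Cc_span_bis V f : bisection V -> Cc_on V f -> Cc_span f.
Proof. by move=> bV Cf; apply/Cc_spanP; exact: bispan_bis bV Cf. Qed.

Lemma fibre_finite_bis V f : bisection V -> (forall x, ~ V x -> f x = 0) -> fibre_finite o f.
Proof.
move=> [sr [ss bV]] f0 u; split.
  apply: (@sub_finite_set _ _ [set sr u]) => // z [<- fz]; rewrite /= (bi_rK bV) //.
  by apply: contrapT => /f0.
apply: (@sub_finite_set _ _ [set ss u]) => // z [<- fz]; rewrite /= (bi_sK bV) //.
by apply: contrapT => /f0.
Qed.

Lemma Cc_on_out V f : Cc_on V f -> forall x, ~ V x -> f x = 0.
Proof. by case. Qed.

Lemma Cc_span_fibre_finite f : Cc_span f -> fibre_finite o f.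
Proof.
move=> /Cc_spanP; elim=> [|V f1 f2 bV Cf1 _ IH]; first exact: fibre_finite0.
by apply: fibre_finiteD => //; apply: fibre_finite_bis bV _; exact: Cc_on_out.
Qed.

Lemma Cc_on_star V f : bisection V -> Cc_on V f ->
  bisection (inv @^-1` V) /\ Cc_on (inv @^-1` V) (star o f).
Proof.
move=> [sr [ss bV]] Cf.
have bV' : bisection (inv @^-1` V) by do 2 eexists; exact: bisection_inv bV.
split=> //.
have oV := bi_open bV; have hV : hausdorff_space (set_type V).
  by apply: bisection_hausdorff; exists sr, ss.
have /(Cc_onP _ oV hV)[S [cS sSV f0 cf]] := Cf.
apply/Cc_onP; [exact: inv_open|exact: bisection_hausdorff|].
exists (inv @` S); split.
- by apply: continuous_compact => //; apply: continuous_subspaceT; exact: inv_cont.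
- by move=> _ [x Sx <-] /=; rewrite (g_invK gG); exact: sSV.
- move=> x nS; rewrite /star f0 ?rmorph0 // => Sx; apply: nS.
  by exists (inv x) => //; rewrite (g_invK gG).
- move=> _ [x Sx <-]; apply: cont_conj; apply: cont_comp; first exact: inv_cont.
  by rewrite (g_invK gG); exact: cf.
Qed.

(** A range fibre meets [V] at most in the point [sr (r x)]. The second condition guards against a
    total [sr], whose value at a unit outside the image of [V] may happen to lie in [V]. *)
Lemma conv_bis V sr ss f g x : bisection_with V sr ss -> (forall x, ~ V x -> f x = 0) ->
  gconv o f g x = if pselect (V (sr (r x)) /\ r (sr (r x)) = r x)
    then f (sr (r x)) * g (inv (sr (r x)) ** x) else 0.
Proof.
move=> bV f0; case: pselect => [[Vz ez]|nV].
  apply: fsum_single => //= z ez' nz; have [Vz'|/f0 ->] := pselect (V z); last by rewrite mul0r.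
  by case: nz; rewrite -(bi_rK bV Vz') ez'.
apply: fsbig1 => z /= ez; have [Vz|/f0 ->] := pselect (V z); last by rewrite mul0r.
by case: nV; rewrite -ez (bi_rK bV Vz).
Qed.

(** The product set of [V] and [W], described by left division by the element of [V] with the same
    range; openness then follows from continuity of this division. *)
Definition bimul V sr W : set G := [set x | (r @` V) (r x) /\ W (inv (sr (r x)) ** x)].

Lemma sec_r V sr ss u : bisection_with V sr ss -> (r @` V) u -> V (sr u) /\ r (sr u) = u.
Proof. by move=> bV [y Vy <-]; rewrite (bi_rK bV). Qed.

Lemma div_cont V sr ss x : bisection_with V sr ss -> (r @` V) (r x) ->
  {for x, continuous (fun y => inv (sr (r y)) ** y)}.
Proof.
move=> bV Vx N /= nN; have [Vz ez] := sec_r bV Vx.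
have e : s (inv (sr (r x))) = r x by rewrite (g_si gG).
have [A [B [nA nB AB]]] := mul_nbhs e nN.
have c1 : {for x, continuous (fun y => inv (sr (r y)))}.
  apply: (@continuous_comp _ _ _ (sr \o r) inv); last exact: inv_cont.
  by apply: continuous_comp; [exact: rng_cont|exact: (bi_rcont bV)].
have n3 : nbhs x (r @^-1` (r @` V)).
  by apply: rng_cont; apply: open_nbhs_nbhs; split=> //; exact: bi_ropen bV.
have n1 : nbhs x ((fun y => inv (sr (r y))) @^-1` A) by exact: c1.
suff : nbhs x (fun y => N (inv (sr (r y)) ** y)) by [].
apply: filterS (filterI (filterI n1 nB) n3) => y [[Ay By] /= Vy].
by apply: AB => //; rewrite (g_si gG); case: (sec_r bV Vy).
Qed.

Lemma bimul_open V sr ss W : bisection_with V sr ss -> open W -> open (bimul V sr W).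
Proof.
move=> bV oW; rewrite openE => x [Vx Wx].
have n3 : nbhs x (r @^-1` (r @` V)).
  by apply: rng_cont; apply: open_nbhs_nbhs; split=> //; exact: bi_ropen bV.
have n4 : nbhs x ((fun y => inv (sr (r y)) ** y) @^-1` W).
  by apply: (div_cont bV Vx); apply: open_nbhs_nbhs.
by apply: filterS (filterI n3 n4) => y [].
Qed.

(** The range of [x] determines the factor in [V], whose source determines the factor in [W]; so [r]
    is injective on the product. *)
Lemma bimul_hausdorff V sr ss W : bisection_with V sr ss -> bisection W ->
  hausdorff_space (set_type (bimul V sr W)).
Proof.
move=> bV [sr' [ss' bW]]; apply: rng_inj_hausdorff => x y [Vx Wx] [Vy Wy] e.
have [_ ex] := sec_r bV Vx; have [_ ey] := sec_r bV Vy.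
rewrite -[x](g_iK gG ex) -[y](g_iK gG ey) -e; congr (_ ** _).
rewrite -[LHS](bi_rK bW Wx) -[RHS](bi_rK bW) -?e //; last by rewrite e.
by congr (sr' _); rewrite !(g_rM gG) // (g_si gG) ?ex // -e.
Qed.

Lemma Cc_on_conv V sr ss W f g : bisection_with V sr ss -> bisection W ->
  Cc_on V f -> Cc_on W g -> Cc_on (bimul V sr W) (gconv o f g).
Proof.
move=> bV bW Cf Cg; have oV := bi_open bV; have oW := bisection_open bW.
have hV : hausdorff_space (set_type V) by apply: bisection_hausdorff; exists sr, ss.
have hW := bisection_hausdorff bW.
have /(Cc_onP _ oV hV)[K [cK sKV f0 cf]] := Cf.
have /(Cc_onP _ oW hW)[L [cL sLW g0 cg]] := Cg.
have fV0 := Cc_on_out Cf.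
apply/Cc_onP; [exact: bimul_open bV oW|exact: bimul_hausdorff bV bW|].
(* The composable pairs form a closed set because the units are Hausdorff; hence the composable part
   of [K] times [L], and its image [S], are compact. *)
pose C := [set p : G * G | s p.1 = r p.2].
have cC : closed C.
  rewrite -[C]setCK; apply: open_closedC; rewrite openE => -[x y] /= exy.
  have [A [B [nA nB AB]]] := units_sep (g_unit_src gG x) (g_unit_r o y) exy.
  exists (s @^-1` A, r @^-1` B); first by split; [exact: src_cont|exact: rng_cont].
  by move=> [x' y'] [/= Ax By] e; apply: (AB (s x')) => //; rewrite e.
have cKL : compact ((K `*` L) `&` C) by apply: compact_closedI => //; exact: compact_setX.
pose S := (fun p : G * G => p.1 ** p.2) @` ((K `*` L) `&` C).
have rzy z y : K z -> s z = r y -> [/\ (r @` V) (r (z ** y)), sr (r (z ** y)) = z &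
    inv (sr (r (z ** y))) ** (z ** y) = y].
  move=> Kz e; rewrite (g_rM gG) // (bi_rK bV (sKV _ Kz)) (g_Ki gG) //.
  by split=> //; exists z => //; exact: sKV.
exists S; split.
- apply: continuous_compact => //; have [_ _] := tG.
  by apply: continuous_subspaceW => p [].
- move=> _ [[z y] [[/= Kz Ly] e] <-]; have [h1 h2 h3] := rzy z y Kz e.
  by split=> //; rewrite h3; exact: sLW.
- move=> x nS; rewrite (conv_bis _ _ bV fV0); case: pselect => //= -[Vz ez].
  have [Kz|/f0 ->] := pselect (K (sr (r x))); last by rewrite mul0r.
  have [Ly|/g0 ->] := pselect (L (inv (sr (r x)) ** x)); last by rewrite mulr0.
  case: nS; exists (sr (r x), inv (sr (r x)) ** x); last by rewrite /= (g_iK gG).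
  by split=> //; rewrite /C /= (g_rM gG) ?(g_ri gG) // (g_si gG).
- move=> _ [[z y] [[/= Kz Ly] e] <-]; have [h1 h2 h3] := rzy z y Kz e.
  set x := z ** y in h1 h2 h3 *.
  (* [conv_bis] gives this formula wherever the range lies in the image of [V], an open
     condition. *)
  apply: (@cont_near_eq _ _ _ (fun x => f (sr (r x)) * g (inv (sr (r x)) ** x))).
    have n3 : nbhs x (r @^-1` (r @` V)).
      by apply: rng_cont; apply: open_nbhs_nbhs; split=> //; exact: bi_ropen bV.
    apply: filterS n3 => x' /= Vx'; rewrite (conv_bis _ _ bV fV0).
    by case: pselect => // -[]; exact: (sec_r bV).
  apply: cont_mul.
    apply: (@cont_comp _ _ _ (sr \o r)); last by rewrite /= h2; exact: cf.
    by apply: continuous_comp; [exact: rng_cont|exact: (bi_rcont bV)].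
  apply: (@cont_comp _ _ _ (fun x => inv (sr (r x)) ** x)); first exact: div_cont bV h1.
  by rewrite h3; exact: cg.
Qed.

Lemma bispan_conv f g : bispan f -> bispan g -> bispan (gconv o f g).
Proof.
move=> bf bg.
have fin h : bispan h -> fibre_finite o h by move=> /Cc_spanP/Cc_span_fibre_finite.
elim: bf => [|V f1 f2 bV Cf1 bf2 IH].
  rewrite (_ : gconv o _ g = fun=> 0); first exact: bispan0.
  by apply/funext => x; apply: fsbig1 => z _; rewrite mul0r.
rewrite (_ : gconv o _ g = fun x => gconv o f1 g x + gconv o f2 g x); last first.
  by apply/funext => x; apply: convDl; apply: fin => //; exact: bispan_bis bV Cf1.
apply: bispan_add => // {IH bf2 f2}; elim: bg => [|W g1 g2 bW Cg1 bg2 IH].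
  rewrite (_ : gconv o f1 _ = fun=> 0); first exact: bispan0.
  by apply/funext => x; apply: fsbig1 => z _; rewrite mulr0.
rewrite (_ : gconv o f1 _ = fun x => gconv o f1 g1 x + gconv o f1 g2 x); last first.
  by apply/funext => x; apply: convDr; apply: fin; exact: bispan_bis bV Cf1.
apply: bispan_add => //; have [sr [ss bV']] := bV.
apply: (@Cc_on_bispan (bimul V sr W)).
- exact: bimul_open bV' (bisection_open bW).
- exact: bimul_hausdorff bV' bW.
- exact: Cc_on_conv bV' bW Cf1 Cg1.
Qed.

Lemma Cc_span_conv f g : Cc_span f -> Cc_span g -> Cc_span (gconv o f g).
Proof. by move=> /Cc_spanP bf /Cc_spanP bg; apply/Cc_spanP; exact: bispan_conv. Qed.

End CcBisections.
End TopologicalGroupoid.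

(** * The groupoid of limit sets *)

Section FellGroupoid.
Variables (G : topologicalType) (o : groupoid_data G).
Hypothesis tG : topological_groupoid o.
Hypothesis etG : etale o.
Hypothesis hU : hausdorff_space (set_type (units o)).
Hypothesis hX : locally_compact_space G.
Local Notation r := (grng o).
Local Notation s := (gsrc o).
Local Notation inv := (ginv o).
Local Notation "x ** y" := (gmul o x y) (at level 40, left associativity).
Local Notation gG := (gpdG tG).
Local Notation H := (fellH G).
Local Notation oH := (fell_groupoid o).
Local Notation RR := (grng oH).
Local Notation SS := (gsrc oH).
Local Notation II := (ginv oH).
Implicit Types (x y z w u : G) (A B C : H) (V W : set G).

Lemma limset_cont (f : G -> G) (F : set_system G) x : {for x, continuous f} ->
  limset F x -> limset (fmap f F) (f x).
Proof. by move=> cf Fx N nN; apply: Fx; exact: cf. Qed.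

Lemma limset_units (F : set_system G) (f : G -> G) x y : ProperFilter F ->
  (forall z, units o (f z)) -> {for x, continuous f} -> {for y, continuous f} ->
  limset F x -> limset F y -> f x = f y.
Proof.
move=> PF uf cx cy Fx Fy.
apply: (units_lim_unique tG etG hU (F := fmap f F)) => //; exact: limset_cont.
Qed.

(** [r] maps continuously into the Hausdorff unit space, where an ultrafilter has at most one
    limit. *)
Lemma el_r A x y : fset_of A x -> fset_of A y -> r x = r y.
Proof.
have [F [uF ->]] := fset_ofP A => Fx Fy.
by apply: (limset_units (F := F)) => //; [exact: g_unit_r|exact: rng_cont|exact: rng_cont].
Qed.

Lemma el_s A x y : fset_of A x -> fset_of A y -> s x = s y.
Proof.
have [F [uF ->]] := fset_ofP A => Fx Fy.
by apply: (limset_units (F := F)) => //; [move=> z; exact: (g_unit_src gG)|exact: src_cont|exact: src_cont].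
Qed.

(* If a net t converges to x, y and z, then t = t t^-1 t converges to x y^-1 z. *)
Lemma el_coset A x y z : fset_of A x -> fset_of A y -> fset_of A z ->
  fset_of A (x ** inv y ** z).
Proof.
move=> Ax Ay Az; have exy := el_s Ax Ay; have eyz := el_r Ay Az; move: Ax Ay Az.
have [F [uF ->]] := fset_ofP A => Fx Fy Fz N nN.
have e1 : s x = r (inv y) by rewrite (g_ri gG).
have e2 : s (x ** inv y) = r z by rewrite (g_sM gG) // (g_si gG).
have [U [W [nU nW UW]]] := mul_nbhs tG e2 nN.
have [U1 [W1 [nU1 nW1 UW1]]] := mul_nbhs tG e1 nU.
have nW1' : nbhs y (inv @^-1` W1) by exact: inv_cont.
have FF : F (U1 `&` (inv @^-1` W1) `&` W).
  by apply: filterI; [apply: filterI; [exact: Fx|exact: Fy]|exact: Fz].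
apply: filterS FF => t [[Ut Wt] Wt'].
have e3 : s t = r (inv t) by rewrite (g_ri gG).
rewrite -[t](g_rx gG) -(g_xi gG); apply: UW => //; last by rewrite (g_sM gG) // (g_si gG).
by apply: UW1 => //; rewrite (g_ri gG).
Qed.

Lemma to_fellHE A (S : set G) : (exists B, fset_of B = S) -> fset_of (to_fellH A S) = S.
Proof. by move=> [B eB]; rewrite /to_fellH; case: xgetP => [C _ //|/(_ B)]. Qed.

(** The image of an ultrafilter under [inv] has the inverse limit set, so the default value of
    [to_fellH] does not occur. *)
Lemma fset_invE A w : fset_of (II A) w <-> fset_of A (inv w).
Proof.
suff -> : fset_of (II A) = set_inv o (fset_of A).
  split=> [[x Ax <-]|Aw]; first by rewrite (g_invK gG).
  by exists (inv w) => //; rewrite (g_invK gG).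
apply: to_fellHE; have [F [uF eF]] := fset_ofP A.
have h : limset (fmap inv F) = set_inv o (fset_of A).
  rewrite eF eqEsubset; split=> [x Fx|_ [x Fx <-]]; last first.
    by apply: limset_cont => //; exact: inv_cont.
  exists (inv x); last by rewrite (g_invK gG).
  move=> N nN; have FN : F (inv @^-1` (inv @^-1` N)).
    exact: (limset_cont (inv_cont tG (x := x)) Fx nN).
  by apply: filterS FN => t /=; rewrite (g_invK gG).
rewrite -h; apply: fellH_mk; first exact: fmap_ultra.
by rewrite h; have [x Ax] := fset_of_neq0 A; exists (inv x), x.
Qed.

(** Since [inv t ** t = s t], the set that defines the source is the limit set of the image
    ultrafilter under [s]. The right side describes it as the coset of any [x] in [A]; later proofs
    use this form instead of [set_mul]. *)
Lemma fset_srcE A x w : fset_of A x ->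
  fset_of (SS A) w <-> r w = s x /\ fset_of A (x ** w).
Proof.
move=> Ax; suff -> : fset_of (SS A) = set_mul o (set_inv o (fset_of A)) (fset_of A).
  split=> [[_ [z [[y Ay <-] Az e ->]]]|[e Axw]].
    have eyz : s (inv y) = r z by [].
    rewrite (g_rM gG) // (g_ri gG) (el_s Ay Ax); split=> //.
    rewrite -(g_A gG) ?(g_ri gG) // ?(el_s Ax Ay) //; exact: el_coset.
  exists (inv x), (x ** w); split=> //; first by exists x.
    by rewrite (g_si gG) (g_rM gG).
  by rewrite (g_Ki gG).
apply: to_fellHE; have [F [uF eF]] := fset_ofP A.
have h : limset (fmap s F) = set_mul o (set_inv o (fset_of A)) (fset_of A).
  rewrite eqEsubset; split=> [z Fz|_ [_ [z [[y Ay <-] Az e ->]]] N nN].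
    (* [z] and [s x] are limits of the same ultrafilter, so their ranges agree. *)
    have erz : r z = s x.
      have := @limset_units (fmap s F) r z (s x) _.
      rewrite (g_rs gG) => -> //; try exact: rng_cont; try exact: g_unit_r.
      by apply: limset_cont; [exact: src_cont|rewrite -eF].
    exists (inv x), (x ** z); split=> //; first by exists x.
    (* [t = t ** s t] converges to [x ** z]. *)
    - rewrite eF => N nN; have [U [W [nU nW UW]]] := mul_nbhs tG (esym erz) nN.
      have FU : F U by move: Ax; rewrite eF; apply.
      have FW : F (s @^-1` W) := Fz _ nW.
      apply: filterS (filterI FU FW) => t [Ut Wst].
      by rewrite -(g_xs gG t); apply: UW => //; rewrite (g_rs gG).
    - by rewrite (g_si gG) (g_rM gG).
    - by rewrite (g_Ki gG).
  have [U [W [nU nW UW]]] := mul_nbhs tG e nN.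
  have nU' : nbhs y (inv @^-1` U) by exact: inv_cont.
  rewrite eF in Ay Az; apply: (@filterS _ F _ ((inv @^-1` U) `&` W)) => [t [Ut Wt]|].
    by rewrite /= -(g_ix gG); apply: UW => //; rewrite (g_si gG).
  by apply: filterI; [exact: Ay|exact: Az].
rewrite -h; apply: fellH_mk; first exact: fmap_ultra.
exists (s x); rewrite h; exists (inv x), x; split=> //; first by exists x.
  by rewrite (g_si gG).
by rewrite (g_ix gG).
Qed.

(** Reduces the range to a source, which is already known to be a limit set. *)
Lemma rng_srcI A : RR A = SS (II A).
Proof.
have e : fset_of (II A) = set_inv o (fset_of A).
  rewrite eqEsubset; split=> x; first by move/fset_invE => h; exists (inv x); rewrite ?(g_invK gG).
  by move=> [y Ay <-]; apply/fset_invE; rewrite (g_invK gG).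
have e2 : set_inv o (set_inv o (fset_of A)) = fset_of A.
  rewrite /set_inv; rewrite image_comp (_ : inv \o inv = id) ?image_id //.
  by apply/funext => x /=; rewrite (g_invK gG).
have [x Ax] := fset_of_neq0 (II A).
have ex : exists B, fset_of B = set_mul o (fset_of A) (set_inv o (fset_of A)).
  exists (SS (II A)); rewrite eqEsubset.
  have hS := fset_srcE _ Ax; split=> w.
    move=> /hS[ew Aw]; have Ax2 := (fset_invE _ _).1 Ax; have Aw2 := (fset_invE _ _).1 Aw.
    exists (inv x), (x ** w); split=> //.
    - by exists (inv (x ** w)); rewrite ?(g_invK gG).
    - by rewrite (g_si gG) (g_rM gG).
    - by rewrite (g_Ki gG).
  move=> [y [_ [Ay [z Az <-] eyz ->]]]; apply/hS; have Ax2 := (fset_invE _ _).1 Ax.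
  have eyx : r y = s x by rewrite (el_r Ay Ax2) (g_ri gG).
  rewrite (g_rM gG) //; split=> //; apply/fset_invE.
  rewrite (g_invM gG); last by rewrite (g_rM gG).
  rewrite (g_invM gG) // (g_invK gG); exact: el_coset.
have eR : fset_of (RR A) = set_mul o (fset_of A) (set_inv o (fset_of A)) by exact: to_fellHE.
have eS : fset_of (SS (II A)) = set_mul o (set_inv o (fset_of (II A))) (fset_of (II A)).
  by apply: to_fellHE; rewrite e e2.
by apply: fset_of_inj; rewrite eR eS e e2.
Qed.

Lemma fset_rngE A x w : fset_of A x ->
  fset_of (RR A) w <-> s w = r x /\ fset_of A (w ** x).
Proof.
move=> Ax; have Ax' : fset_of (II A) (inv x) by apply/fset_invE; rewrite (g_invK gG).
(* The source is closed under inversion: [b ** inv y] equals [b ** inv (b ** y) ** b], which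
   [el_coset] puts in [B]. *)
have uu B y : fset_of (SS B) y -> fset_of (SS B) (inv y).
  move=> By; have [b Bb] := fset_of_neq0 B; move: (By) => /(fset_srcE _ Bb)[ey Bby].
  have es : s (b ** y) = s b by exact: el_s Bby Bb.
  have esy : s y = s b by rewrite -es (g_sM gG).
  apply/(fset_srcE _ Bb); rewrite (g_ri gG) esy; split=> //.
  have e1 : s (inv y) = r (inv b) by rewrite (g_si gG) (g_ri gG).
  have -> : b ** inv y = b ** inv (b ** y) ** b; last exact: el_coset.
  rewrite (g_invM gG) // (g_A gG); last 2 first.
    by rewrite (g_rM gG) // (g_ri gG) esy.
    by rewrite (g_sM gG) // (g_si gG).
  by rewrite (g_A gG) ?(g_si gG) ?(g_ri gG) // (g_ix gG) -ey -(g_si gG) (g_xs gG).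
have uu' B y : fset_of (SS B) y <-> fset_of (SS B) (inv y).
  by split=> [/uu//|/uu]; rewrite (g_invK gG).
rewrite rng_srcI uu' (fset_srcE _ Ax') (g_ri gG) (g_si gG) fset_invE.
split=> -[e h]; split=> //; move: h; rewrite (g_invM gG) ?(g_invK gG) //;
  by rewrite ?(g_si gG) ?(g_ri gG).
Qed.

(** A bisection through [z] makes left division by [z] a continuous map [phi] near the elements of
    [A], and the image ultrafilter under [phi] converges exactly to the points of the translate
    [z^-1 A]. Quotients in HG and local sections of its range and source maps are obtained from
    this. *)
Lemma fell_translate A z y : fset_of A y -> r z = r y ->
  exists B, forall w, fset_of B w <-> r w = s z /\ fset_of A (z ** w).
Proof.
move=> Ay ezy.
have [V [sr [ss [bV Vz _]]]] := bisection_ex tG etG openT (I : setT z).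
have Vrz : (r @` V) (r z) by exists z.
have srz := bi_rK bV Vz.
pose phi t := inv (sr (r t)) ** t.
have [F [uF eF]] := fset_ofP A.
have Vra a : fset_of A a -> (r @` V) (r a) by move=> Aa; rewrite (el_r Aa Ay) -ezy.
have Fr : F (r @^-1` (r @` V)).
  have Fy : limset F y by rewrite -eF.
  apply: Fy; apply: rng_cont => //; apply: open_nbhs_nbhs; split; first exact: (bi_ropen bV).
  exact: Vra.
have h w : limset (fmap phi F) w <-> r w = s z /\ fset_of A (z ** w).
  split=> [Fw|[ew Aw]]; last first.
    have c := div_cont tG bV (Vra _ Aw).
    have : limset (fmap phi F) (phi (z ** w)) by apply: limset_cont c _; rewrite -eF.
    by rewrite /phi (g_rM gG) // srz (g_Ki gG).
  have csr a : r a = r y -> {for a, continuous (sr \o r)}.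
    move=> ea; apply: continuous_comp; first exact: rng_cont.
    by apply: (bi_rcont bV); rewrite ea -ezy.
  have Fy : limset F y by rewrite -eF.
  have Fsr : limset (fmap (sr \o r) F) z.
    by rewrite -[z]srz ezy; exact: (limset_cont (csr y erefl) Fy).
  (* [r (phi t) = s (sr (r t))] converges to [s z], and limits in the unit space are unique. *)
  have ew : r w = s z.
    apply: (units_lim_unique tG etG hU (F := fmap (r \o phi) F)).
    - exact: g_unit_r.
    - exact: (g_unit_src gG).
    - exact: (limset_cont (rng_cont tG (x := w)) Fw).
    - move=> N nN; have FN : F ((sr \o r) @^-1` (s @^-1` N)).
        exact: (limset_cont (src_cont tG (x := z)) Fsr nN).
      have : F (phi @^-1` (r @^-1` N)); last by [].
      apply: filterS (filterI FN Fr) => t [/= Nt Vt].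
      have [_ et] := sec_r bV Vt.
      by rewrite /phi (g_rM gG) ?(g_ri gG) // (g_si gG).
  split=> //; rewrite eF => N nN.
  have [U [W [nU nW UW]]] := mul_nbhs tG (esym ew) nN.
  have F1 : F ((sr \o r) @^-1` U) := Fsr _ nU.
  have F2 : F (phi @^-1` W) := Fw _ nW.
  apply: filterS (filterI (filterI F1 F2) Fr) => t [[/= Ut Wt] Vt].
  have [_ et] := sec_r bV Vt.
  rewrite -(g_iK gG et); apply: UW => //.
  by rewrite (g_rM gG) ?(g_ri gG) // (g_si gG).
have [|B eB] := fellH_mk (fmap_ultra phi uF).
  exists (inv z ** y); apply/h; rewrite (g_iK gG) //; split=> //.
  by rewrite (g_rM gG) ?(g_ri gG) // (g_si gG).
by exists B => w; rewrite eB; exact: h.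
Qed.

(** Convolution on HG involves products in the form [C^-1 A] with equal ranges. [C] is a coset of
    this common range, which [A] absorbs, so one element [z] of [C] already gives the quotient. *)
Lemma fset_divE A C z w : RR C = RR A -> fset_of C z ->
  fset_of (gmul oH (II C) A) w <-> r w = s z /\ fset_of A (z ** w).
Proof.
move=> eCA Cz; have [y Ay] := fset_of_neq0 A.
have rz_in : fset_of (RR C) (r z).
  by apply/(fset_rngE _ Cz); rewrite (g_sr gG) (g_rx gG).
have ezy : r z = r y.
  by move: rz_in; rewrite eCA => /(fset_rngE _ Ay)[]; rewrite (g_sr gG).
have key w' : set_mul o (fset_of (II C)) (fset_of A) w' <-> r w' = s z /\ fset_of A (z ** w').
  split=> [[i [a [/fset_invE Ci Aa e ->]]]|[e Aw]].
    have es : s z = r i by rewrite (el_s Cz Ci) (g_si gG).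
    rewrite (g_rM gG) // -es; split=> //.
    have : fset_of (RR C) (z ** i).
      apply/(fset_rngE _ Ci); rewrite (g_sM gG) // (g_ri gG).
      rewrite (g_A gG) // ?(g_ri gG) // (g_xi gG) -es (g_xs gG).
      by split.
    rewrite eCA => /(fset_rngE _ Aa)[_]; rewrite (g_A gG) //.
  exists (inv z), (z ** w'); split=> //.
  - by apply/fset_invE; rewrite (g_invK gG).
  - by rewrite (g_si gG) (g_rM gG).
  - by rewrite (g_Ki gG).
have [B hB] := fell_translate Ay ezy.
have e : fset_of (gmul oH (II C) A) = set_mul o (fset_of (II C)) (fset_of A).
  apply: to_fellHE; exists B; rewrite eqEsubset; split=> w'.
    by move=> /hB/key.
  by move=> /key/hB.
by rewrite e; exact: key.
Qed.

(** Both points are the coset of [x] modulo their common source. *)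
Lemma fell_eq_src A B x : SS A = SS B -> fset_of A x -> fset_of B x -> A = B.
Proof.
move=> e; suff main A' B' : SS A' = SS B' -> fset_of A' x -> fset_of B' x ->
    fset_of A' `<=` fset_of B'.
  by move=> Ax Bx; apply: fset_of_inj; rewrite eqEsubset; split; exact: main.
move=> e' Ax Bx w Aw.
have ew := el_r Ax Aw.
have : fset_of (SS A') (inv x ** w).
  apply/(fset_srcE _ Ax); rewrite (g_iK gG) // (g_rM gG) ?(g_ri gG) // (g_si gG) //.
by rewrite e' => /(fset_srcE _ Bx)[_]; rewrite (g_iK gG).
Qed.

Lemma fell_eq_rng A B x : RR A = RR B -> fset_of A x -> fset_of B x -> A = B.
Proof.
rewrite !rng_srcI => e Ax Bx.
have : II A = II B.
  by apply: (fell_eq_src (x := inv x) e); apply/fset_invE; rewrite (g_invK gG).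
move=> eI; apply: fset_of_inj; rewrite eqEsubset; split=> y Ay.
  rewrite -(g_invK gG y); apply/fset_invE; rewrite -eI; apply/fset_invE.
  by rewrite (g_invK gG).
rewrite -(g_invK gG y); apply/fset_invE; rewrite eI; apply/fset_invE.
by rewrite (g_invK gG).
Qed.

(** If a unit lies in [A], the open set of units belongs to the ultrafilter of [A], and singletons
    of units converge to [A]. So the closure that defines the unit space of HG is a hit set, and it
    is open as well as closed. *)
Lemma fell_unitsP A : fell_units o A <-> exists2 u, units o u & fset_of A u.
Proof.
split=> [clA|[u uu Au] N nN].
  have [x Ax] := fset_of_neq0 A; exists (r x); first exact: g_unit_r.
  apply: contrapT => /(fellH_nbhs_nhit hX)[V [oV Vu nA]].
  have nV : nbhs x (r @^-1` V) by apply: rng_cont => //; exact: open_nbhs_nbhs.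
  have [W [oW Wx sW]] := open_nbhsP nV.
  have [B [[u uu eB] [[y [By Wy]] nB]]] := clA _ (filterI (fellH_nbhs_hit oW Wx Ax) nA).
  apply: nB; exists y; split=> //; move: By; rewrite eB /= => ey.
  by have := sW _ Wy; rewrite /= ey ((g_unitP gG u).1 uu).
have [F [uF eF]] := fset_ofP A.
have FN := fellH_dense hX uF eF nN.
have Fu : F (units o).
  by move: Au; rewrite eF; apply; apply: open_nbhs_nbhs; split=> //; exact: units_open.
have [x [hx ux]] := filter_meet _ FN Fu.
have [B eB] := fellH_single hX x.
by exists B; split; [exists x|exact: hx].
Qed.

Lemma fell_units_open : open (fell_units o).
Proof.
have -> : fell_units o = hit (units o).
  rewrite eqEsubset; split=> A; first by move=> /fell_unitsP[u uu Au]; exists u.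
  by move=> [u [Au uu]]; apply/fell_unitsP; exists u.
by apply: open_hit; exact: units_open.
Qed.

Lemma fell_units_closed : closed (fell_units o).
Proof. exact: closed_closure. Qed.

Lemma fell_units_src A : fell_units o (SS A).
Proof.
have [x Ax] := fset_of_neq0 A; apply/fell_unitsP; exists (s x); first exact: (g_unit_src gG).
by apply/(fset_srcE _ Ax); rewrite (g_rs gG) (g_xs gG).
Qed.

Lemma fell_inv_cont : continuous II.
Proof.
move=> A; apply: (@fellH_cvg_lc _ (fmap II (nbhs A)) (II A) (fmap_filter II (nbhs_filter A))) => [x V oV Vx /fset_invE Ax|x nAx].
  have oV' := inv_open tG oV.
  have Vx' : (inv @^-1` V) (inv x) by rewrite /= (g_invK gG).
  apply: filterS (fellH_nbhs_hit oV' Vx' Ax) => B [y [By Vy]].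
  by exists (inv y); split=> //; apply/fset_invE; rewrite (g_invK gG).
have /(fellH_nbhs_nhit hX)[V [oV Vx nA]] : ~ fset_of A (inv x).
  by move=> h; apply: nAx; exact/fset_invE.
exists (inv @^-1` V); split=> //; first exact: inv_open.
apply: filterS nA => B nB [y [/fset_invE By Vy]]; apply: nB; by exists (inv y).
Qed.

Lemma fell_src_cont : continuous SS.
Proof.
move=> A; have [x Ax] := fset_of_neq0 A.
apply: (@fellH_cvg_lc _ (fmap SS (nbhs A)) (SS A) (fmap_filter SS (nbhs_filter A))) => [w V oV Vw /(fset_srcE _ Ax)[ew Aw]|w nw].
  have e : s (inv x) = r (x ** w) by rewrite (g_si gG) (g_rM gG).
  have nV : nbhs (inv x ** (x ** w)) V by rewrite (g_Ki gG) //; exact: open_nbhs_nbhs.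
  have [U [W [nU nW UW]]] := mul_nbhs tG e nV.
  have [U' [oU' Ux sU]] := open_nbhsP (inv_cont tG nU).
  have [W' [oW' Ww sW]] := open_nbhsP nW.
  apply: filterS (filterI (fellH_nbhs_hit oU' Ux Ax) (fellH_nbhs_hit oW' Ww Aw)).
  move=> B [[b [Bb Ub]] [c [Bc Wc]]]; exists (inv b ** c); split.
    apply/(fset_srcE _ Bb); rewrite (g_iK gG) ?(el_r Bb Bc) // (g_rM gG) ?(g_ri gG) //.
    by rewrite (g_si gG); exact: el_r Bb Bc.
  by apply: UW; [exact: sU|exact: sW|rewrite (g_si gG); exact: el_r Bb Bc].
(* For [w] outside the source: either the ranges fit and [x ** w] is outside [A], or [r w] and [s x]
   are distinct units that can be separated. *)
have [ew|/(units_sep tG etG hU (g_unit_r o w) (g_unit_src gG x))] := pselect (r w = s x).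
  have /(fellH_nbhs_nhit hX)[N [oN Nw nA]] : ~ fset_of A (x ** w).
    by move=> h; apply: nw; apply/(fset_srcE _ Ax).
  have [U [W [nU nW UW]]] := mul_nbhs tG (esym ew) (open_nbhs_nbhs (conj oN Nw)).
  have [U' [oU' Ux sU]] := open_nbhsP nU.
  have [W' [oW' Ww sW]] := open_nbhsP nW.
  exists W'; split=> //.
  apply: filterS (filterI (fellH_nbhs_hit oU' Ux Ax) nA) => B [[b [Bb Ub]] nB] [w' [Sw' Ww']].
  have [ew' Bw'] := (fset_srcE _ Bb).1 Sw'.
  by apply: nB; exists (b ** w'); split=> //; apply: UW; [exact: sU|exact: sW|].
move=> [V [W [nV nW VW]]].
have [V' [oV' Vw sV]] := open_nbhsP (rng_cont tG nV).
have [W' [oW' Wx sW]] := open_nbhsP (src_cont tG nW).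
exists V'; split=> //.
apply: filterS (fellH_nbhs_hit oW' Wx Ax) => B [b [Bb Wb]] [w' [Sw' Vw']].
have [ew' Bw'] := (fset_srcE _ Bb).1 Sw'.
by apply: (VW (s b)); [rewrite -ew'; exact: sV|exact: sW].
Qed.

Lemma fell_rng_cont : continuous RR.
Proof.
have -> : RR = SS \o II by apply/funext => A; exact: rng_srcI.
by move=> A; apply: continuous_comp; [exact: fell_inv_cont|exact: fell_src_cont].
Qed.

End FellGroupoid.

(** * Extension of functions from G to HG *)

Section ClosureExtension.
Variables (R : realType) (T : topologicalType).
Implicit Types (F : T -> Cplx R) (S : set T).

Lemma closure_eq F F' S A : closure S A -> cont_at F A -> cont_at F' A ->
  (forall B, S B -> F B = F' B) -> F A = F' A.
Proof.
move=> clA cF cF' h; apply/eqP; rewrite -subr_eq0; apply/eqP; apply: cabs_eq0.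
have /cont_atP c := cont_sub cF cF'.
apply/eqP; rewrite eq_le cabs_ge0 andbT; apply/ler_addgt0Pr => e e0; rewrite add0r.
have [B [SB]] := clA _ (c e e0); rewrite (h B SB) subrr sub0r cabsN; exact: ltW.
Qed.

Lemma closure_le F S A (M : R) : closure S A -> cont_at F A ->
  (forall B, S B -> cabs (F B) <= M) -> cabs (F A) <= M.
Proof.
move=> clA /cont_atP c h; apply/ler_addgt0Pr => e e0.
have [B [SB hB]] := clA _ (c e e0).
rewrite -[F A](subrK (F B)) addrC; apply: (le_trans (cabsD _ _)).
by apply: lerD; [exact: h|rewrite cabsB; exact: ltW].
Qed.

Lemma compact_cabs_bounded F S : compact S -> (forall x, S x -> cont_at F x) ->
  exists M : R, 0 <= M /\ forall x, S x -> cabs (F x) <= M.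
Proof.
move=> /compact_near_coveringP cS cf.
have h : \forall M \near +oo%R, S `<=` (fun x => cabs (F x) <= M).
  apply: cS => x Sx; have /cont_atP/(_ 1 ltr01) cfx := cf x Sx.
  exists ([set y | cabs (F y - F x) < 1], [set M : R | cabs (F x) + 1 <= M]).
    by split; [exact: cfx|apply: nbhs_pinfty_ge; exact: num_real].
  move=> [y M] /= [h1 h2]; apply: le_trans h2.
  rewrite -[F y](subrK (F x)) addrC; apply: (le_trans (cabsD _ _)).
  by rewrite lerD2l; exact: ltW.
have [M [M0 hM]] := @filter_meet _ _ _ _ _ (nbhs_pinfty_ge (num_real (0:R))) h.
by exists M; split.
Qed.

End ClosureExtension.

Section Extension.
Variables (R : realType) (G : topologicalType) (o : groupoid_data G).
Hypothesis tG : topological_groupoid o.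
Hypothesis etG : etale o.
Hypothesis hU : hausdorff_space (set_type (units o)).
Hypothesis hX : locally_compact_space G.
Local Notation r := (grng o).
Local Notation s := (gsrc o).
Local Notation inv := (ginv o).
Local Notation "x ** y" := (gmul o x y) (at level 40, left associativity).
Local Notation gG := (gpdG tG).
Local Notation H := (fellH G).
Local Notation oH := (fell_groupoid o).
Local Notation RR := (grng oH).
Local Notation SS := (gsrc oH).
Local Notation II := (ginv oH).
Local Notation bis := (bisection o).
Implicit Types (x y z w u : G) (A B C : H) (V W : set G) (f g : G -> Cplx R).
Implicit Types (F K a : H -> Cplx R).

Definition extS f A : Cplx R := \sum_(x \in fset_of A) f x.

Definition CcH F := Cc_on setT F.

Lemma setTH_hausdorff : hausdorff_space (set_type (setT : set H)).
Proof. by apply: hausdorff_space_setT; exact: fellH_hausdorff. Qed.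

Lemma CcHP F : CcH F <-> exists S, [/\ compact S, forall A, ~ S A -> F A = 0 &
  forall A, S A -> cont_at F A].
Proof.
rewrite /CcH; split=> [/(Cc_onP _ openT setTH_hausdorff)[S [cS _ h1 h2]]|[S [cS h1 h2]]].
  by exists S.
by apply/Cc_onP; [exact: openT|exact: setTH_hausdorff|exists S; split].
Qed.

Lemma CcH_cont F A : CcH F -> cont_at F A.
Proof. by move=> CF; apply: (Cc_on_continuous openT CF). Qed.

Lemma CcHM F K : CcH F -> (forall A, cont_at K A) -> CcH (fun A => F A * K A).
Proof. by move=> CF cK; apply: Cc_onM => //; [exact: openT|exact: setTH_hausdorff]. Qed.

Lemma CcHZD (c : Cplx R) F K : CcH F -> CcH K -> CcH (fun A => c * F A + K A).
Proof. by move=> CF CK; apply: Cc_onZD => //; [exact: openT|exact: setTH_hausdorff]. Qed.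

Lemma CcHD F K : CcH F -> CcH K -> CcH (fun A => F A + K A).
Proof.
move=> CF CK; have := CcHZD 1 CF CK.
by rewrite (_ : (fun A => _) = fun A => F A + K A) //; apply/funext => A; rewrite mul1r.
Qed.

Lemma CcH0 : CcH (fun=> 0). Proof. exact: Cc_on0. Qed.

Lemma bis_r_inj V x y : bis V -> V x -> V y -> r x = r y -> x = y.
Proof. by move=> [sr [ss bV]] Vx Vy e; rewrite -(bi_rK bV Vx) e (bi_rK bV Vy). Qed.

Lemma bis_s_inj V x y : bis V -> V x -> V y -> s x = s y -> x = y.
Proof. by move=> [sr [ss bV]] Vx Vy e; rewrite -(bi_sK bV Vx) e (bi_sK bV Vy). Qed.

(** The elements of [A] have the same range, so [A] meets a set on which [r] is injective at most
    once. *)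
Lemma extS_in V f A x : (forall y z, V y -> V z -> r y = r z -> y = z) ->
  (forall x, ~ V x -> f x = 0) -> fset_of A x -> V x -> extS f A = f x.
Proof.
move=> iV f0 Ax Vx; apply: fsum_single => // z Az zx; apply: f0 => Vz; apply: zx.
by apply: iV => //; exact: (el_r tG etG hU Az Ax).
Qed.

Lemma extS_out V f A : (forall x, ~ V x -> f x = 0) ->
  (forall x, fset_of A x -> V x -> False) -> extS f A = 0.
Proof. by move=> f0 hA; apply: fsbig1 => x Ax; apply: f0 => /(hA x Ax). Qed.

Lemma extS_single f A x : fset_of A = [set x] -> extS f A = f x.
Proof. by move=> e; rewrite /extS e; apply: fsum_single => // z -> []. Qed.

Lemma extS0 A : extS (fun=> 0) A = 0.
Proof. exact: fsbig1. Qed.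

Lemma fset_fibre_finite f A : fibre_finite o f -> finite_set (fset_of A `&` [set z | f z <> 0]).
Proof.
move=> ff; have [x Ax] := fset_of_neq0 A.
by apply: sub_finite_set (ff (r x)).1 => z [Az fz]; split=> //; exact: (el_r tG etG hU Az Ax).
Qed.

Lemma extSD f g A : fibre_finite o f -> fibre_finite o g ->
  extS (fun x => f x + g x) A = extS f A + extS g A.
Proof. by move=> ff fg; apply: fsum_add; exact: fset_fibre_finite. Qed.

(** If [A] meets [V] at [x], points of HG near [A] meet every small neighbourhood of [x], and the
    extension takes the value of [f] there. A jump of [f] along a net in [G] with several limits
    disappears, since these limits lie in one point of HG. *)
Lemma extS_CcH V f : bis V -> Cc_on V f -> CcH (extS f).
Proof.
move=> bV Cf; have oV := bisection_open bV; have hV := bisection_hausdorff tG etG hU bV.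
have /(Cc_onP _ oV hV)[S [cS sSV f0 cf]] := Cf.
have iV x y := @bis_r_inj V x y bV; have fV0 := Cc_on_out Cf.
apply/CcHP; exists (hit S); split.
- exact: fellH_hit_compact.
- by move=> A nS; apply: (extS_out f0) => x Ax Sx; apply: nS; exists x.
- move=> A [x [Ax Sx]]; have Vx := sSV _ Sx; apply/cont_atP => e e0.
  have /cont_atP/(_ e e0) nx := cf x Sx.
  have [N [oN Nx sN]] := open_nbhsP (filterI nx (open_nbhs_nbhs (conj oV Vx))).
  apply: filterS (fellH_nbhs_hit oN Nx Ax) => B [y [By Ny]].
  have [hy Vy] := sN _ Ny.
  by rewrite (extS_in iV fV0 Ax Vx) (extS_in iV fV0 By Vy).
Qed.

Lemma extS_Cc_span f : Cc_span f -> CcH (extS f).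
Proof.
move=> /(Cc_spanP tG etG hU hX); elim=> [|V f1 f2 bV Cf1 bf2 IH].
  by rewrite (_ : extS _ = fun=> 0); [exact: CcH0|apply/funext => A; exact: extS0].
rewrite (_ : extS _ = fun A => extS f1 A + extS f2 A).
  by apply: CcHD => //; exact: extS_CcH bV Cf1.
apply/funext => A; apply: extSD; first by apply: fibre_finite_bis bV _; exact: Cc_on_out.
by apply: (Cc_span_fibre_finite tG etG hU hX); apply/(Cc_spanP tG etG hU hX).
Qed.

Definition singles : set H := [set A | exists x, fset_of A = [set x]].

Lemma singles_dense A : closure singles A.
Proof.
move=> N nN; have [F [uF eF]] := fset_ofP A.
have FN := fellH_dense hX uF eF nN.
have [x hx] := @filter_ex _ F _ _ FN.
by have [B eB] := fellH_single hX x; exists B; split; [exists x|exact: hx].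
Qed.

Lemma eq_on_singles F K : (forall A, cont_at F A) -> (forall A, cont_at K A) ->
  (forall x A, fset_of A = [set x] -> F A = K A) -> F = K.
Proof.
move=> cF cK h; apply/funext => A.
by apply: (closure_eq (singles_dense (A := A))) => // B [x]; exact: h.
Qed.

Lemma ext_CcE f : Cc_span f -> ext_Cc f = extS f.
Proof.
move=> Cf; rewrite /ext_Cc; case: xgetP => [F _ [CF hF]|/(_ (extS f)) []]; last first.
  by split; [exact: extS_Cc_span|move=> x A; exact: extS_single].
apply: eq_on_singles => [A|A|x A e].
- exact: CcH_cont.
- by apply: CcH_cont; exact: extS_Cc_span.
- by rewrite (hF x A e) (extS_single f e).
Qed.

Lemma CcH_star F : CcH F -> CcH (star oH F).
Proof.
move=> /CcHP[S [cS F0 cF]]; apply/CcHP; exists (II @` S); split.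
- apply: continuous_compact => //; apply: continuous_subspaceT.
  exact: (fell_inv_cont tG).
- move=> A nS; rewrite /star F0 ?rmorph0 // => SA; apply: nS; exists (II A) => //.
  apply: fset_of_inj; rewrite eqEsubset; split=> x.
    by move=> /(fset_invE tG)/(fset_invE tG); rewrite (g_invK gG).
  by move=> Ax; do 2 apply/(fset_invE tG); rewrite (g_invK gG).
- move=> _ [A SA <-]; apply: cont_conj; apply: (@cont_comp _ _ _ II).
    exact: (fell_inv_cont tG).
  have -> : II (II A) = A.
    apply: fset_of_inj; rewrite eqEsubset; split=> x.
      by move=> /(fset_invE tG)/(fset_invE tG); rewrite (g_invK gG).
    by move=> Ax; do 2 apply/(fset_invE tG); rewrite (g_invK gG).
  exact: cF.
Qed.

(** * Sections of the source map of HG over a bisection *)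

Section SourceSection.
Variables (V : set G) (sr ss : G -> G).
Hypothesis bV : bisection_with o V sr ss.
Let bV' : bis V. Proof. by exists sr, ss. Qed.

Lemma src_fibre_mem B b w : fset_of B b ->
  fset_of B w <-> r w = r b /\ fset_of (SS B) (inv b ** w).
Proof.
move=> Bb; split=> [Bw|[e]].
  have e := el_r tG etG hU Bw Bb; split=> //.
  apply/(fset_srcE tG etG hU _ Bb).
  by rewrite (g_iK gG) // (g_rM gG) ?(g_si gG) // (g_ri gG).
by move=> /(fset_srcE tG etG hU _ Bb)[_]; rewrite (g_iK gG).
Qed.

(** The element of [B] in [V] has a source determined by [SS B], and [V] meets a source fibre at
    most once; so this element moves little with [SS B]. *)
Lemma src_section_near A0 x0 (U : set G) : fset_of A0 x0 -> V x0 -> nbhs x0 U ->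
  \forall A \near SS A0, forall B b, SS B = A -> fset_of B b -> V b -> U b.
Proof.
move=> A0x Vx nU.
have [U' [oU' U'x sU]] := open_nbhsP (filterI nU (open_nbhs_nbhs (conj (bi_open bV) Vx))).
have bU' : bisection_with o U' sr ss by apply: bisectionS bV oU' _ => y /sU[].
have Sx : fset_of (SS A0) (s x0).
  by apply/(fset_srcE tG etG hU _ A0x); rewrite (g_rs gG) (g_xs gG).
have sx : (s @` U') (s x0) by exists x0.
apply: filterS (fellH_nbhs_hit (bi_sopen bU') sx Sx) => A [v [Av [y U'y ey]]] B b eB Bb Vb.
have [Uy Vy] := sU _ U'y.
rewrite -eB in Av; have [ev _] := (fset_srcE tG etG hU _ Bb).1 Av.
suff -> : b = y by [].
by apply: (bis_s_inj bV') => //; rewrite -ev -ey (g_rs gG).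
Qed.

(** Continuity at [SS A0] of the partial section that sends a source to the point above it meeting
    [V]. It is phrased for all such points, so that existence and uniqueness are separate
    matters. *)
Lemma src_section_cvg A0 x0 N : fset_of A0 x0 -> V x0 -> nbhs A0 N ->
  \forall A \near SS A0, forall B, SS B = A -> hit V B -> N B.
Proof.
move=> A0x Vx nN.
pose FF : set_system H := [set M | \forall A \near SS A0, forall B, SS B = A -> hit V B -> M B].
have fF : Filter FF.
  split.
  - by apply: (@filterS _ (nbhs (SS A0)) _ setT) => //; exact: filterT.
  - move=> P Q hP hQ; apply: (@filterS _ (nbhs (SS A0)) _ _ _ _ (@filterI _ (nbhs (SS A0)) _ _ _ hP hQ)).
    by move=> A [h1 h2] B e hB; split; [exact: h1 e hB|exact: h2 e hB].
  - move=> P Q sPQ hP; apply: (@filterS _ (nbhs (SS A0)) _ _ _ _ hP).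
    by move=> A h B e hB; apply: sPQ; exact: h e hB.
suff : FF --> A0 by apply.
apply: fellH_cvg_lc => [w W oW Ww A0w|w nw].
  have [e hw] := (src_fibre_mem w A0x).1 A0w.
  have e1 : s x0 = r (inv x0 ** w) by rewrite (g_rM gG) ?(g_si gG) // (g_ri gG).
  have nW : nbhs (x0 ** (inv x0 ** w)) W by rewrite (g_iK gG) //; exact: open_nbhs_nbhs.
  have [U [M [nU nM UM]]] := mul_nbhs tG e1 nW.
  have [M' [oM' Mw sM]] := open_nbhsP nM.
  apply: filterS (filterI (src_section_near A0x Vx nU) (fellH_nbhs_hit oM' Mw hw)).
  move=> A [hU' [h [Ah Mh]]] B eB [b [Bb Vb]].
  rewrite -eB in Ah; have [eh Bbh] := (fset_srcE tG etG hU _ Bb).1 Ah.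
  exists (b ** h); split=> //; apply: UM => //; last exact: sM.
  exact: hU' eB Bb Vb.
have [e|ne] := pselect (r w = r x0); last first.
  have [P [Q [nP nQ PQ]]] := units_sep tG etG hU (g_unit_r o w) (g_unit_r o x0) ne.
  have [P' [oP' Pw sP]] := open_nbhsP (rng_cont tG nP).
  exists P'; split=> //.
  apply: filterS (src_section_near A0x Vx (rng_cont tG nQ)) => A hU' B eB [b [Bb Vb]] [w' [Bw' Pw']].
  apply: (PQ (r w')); first exact: sP.
  by rewrite (el_r tG etG hU Bw' Bb); exact: hU' eB Bb Vb.
have /(fellH_nbhs_nhit hX)[M [oM Mw nM]] : ~ fset_of (SS A0) (inv x0 ** w).
  by move=> h; apply: nw; apply/(src_fibre_mem w A0x).
have e1 : s (inv x0) = r w by rewrite (g_si gG).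
have [U [W [nU nW UW]]] := mul_nbhs tG e1 (open_nbhs_nbhs (conj oM Mw)).
have [W' [oW' Ww sW]] := open_nbhsP nW.
exists W'; split=> //.
apply: filterS (filterI (src_section_near A0x Vx (inv_cont tG nU)) nM).
move=> A [hU' nA] B eB [b [Bb Vb]] [w' [Bw' Ww']]; apply: nA.
have [e' hw'] := (src_fibre_mem w' Bb).1 Bw'.
exists (inv b ** w'); rewrite -eB; split=> //; apply: UW.
- exact: hU' eB Bb Vb.
- exact: sW.
- by rewrite (g_si gG).
Qed.

(** The point above [A] is the translate [x A], where [x] is the element of [V] with source [v]. *)
Lemma src_section_ex A v : fell_units o A -> fset_of A v -> (s @` V) v ->
  exists B, SS B = A /\ hit V B.
Proof.
move=> /(fell_unitsP tG etG hX)[u uu Au] Av [x Vx ev].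
have es := g_unit_s gG uu; have er := (g_unitP gG u).1 uu.
have rv : r v = v by rewrite -ev (g_rs gG).
have e : r (inv x) = r v by rewrite (g_ri gG) ev rv.
have [B hB] := fell_translate tG etG hU Av e.
have Bx : fset_of B x.
  by apply/hB; rewrite (g_si gG) (g_ix gG) ev.
exists B; split; last by exists x.
apply: fset_of_inj; rewrite eqEsubset; split=> w.
  by move=> /(fset_srcE tG etG hU _ Bx)[ew /hB[_]]; rewrite (g_Ki gG).
move=> Aw; apply/(fset_srcE tG etG hU _ Bx).
have ew : r w = s x by rewrite (el_r tG etG hU Aw Av) rv.
split=> //; apply/hB; rewrite (g_Ki gG) // (g_rM gG) // (g_si gG); by split.
Qed.

Lemma src_section_uniq B B' : SS B = SS B' -> hit V B -> hit V B' -> B = B'.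
Proof.
move=> e [b [Bb Vb]] [b' [Bb' Vb']].
have Sb : fset_of (SS B) (s b).
  by apply/(fset_srcE tG etG hU _ Bb); rewrite (g_rs gG) (g_xs gG).
have ebb : b = b'.
  apply: (bis_s_inj bV') => //; rewrite e in Sb.
  by have [<- _] := (fset_srcE tG etG hU _ Bb').1 Sb; rewrite (g_rs gG).
by subst b'; exact: (fell_eq_src tG etG hU e Bb Bb').
Qed.

(** [a] takes the value of [K] at the unique point above its argument that meets [V]. It vanishes
    off the image of the compact set [hit L] under the source map, and it is continuous there by
    [src_section_cvg], because such points exist above a whole neighbourhood. *)
Lemma src_descend K (L : set G) : compact L -> L `<=` V ->
  (forall A, cont_at K A) -> (forall A, ~ hit L A -> K A = 0) ->
  exists a, [/\ CcH a, forall A, ~ fell_units o A -> a A = 0 &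
    forall A, hit V A -> a (SS A) = K A].
Proof.
move=> cL sLV cK K0.
pose P A B := SS B = A /\ hit V B.
pose a A := if pselect (exists B, P A B) is left ex then K (projT1 (cid ex)) else 0.
have aE A : hit V A -> a (SS A) = K A.
  move=> hA; rewrite /a; case: pselect => [ex|[]]; last by exists A.
  case: (cid ex) => B [eB hB] /=; congr K.
  exact: src_section_uniq.
have a0 A : (forall B, P A B -> K B = 0) -> a A = 0.
  by move=> h; rewrite /a; case: pselect => [ex|//]; case: (cid ex) => B /= /h.
exists a; split=> //; last first.
  by move=> A nA; apply: a0 => B [eB _]; case: nA; rewrite -eB; exact: (fell_units_src tG).
apply/CcHP; exists (SS @` hit L); split.
- apply: continuous_compact; last exact: fellH_hit_compact.
  by apply: continuous_subspaceT; exact: (fell_src_cont tG etG hU hX).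
- move=> A nA; apply: a0 => B [eB _]; apply: K0 => hB; apply: nA; by exists B.
- move=> _ [A [x [Ax Lx]] <-]; have Vx := sLV _ Lx.
  have hA : hit V A by exists x.
  apply/cont_atP => e e0; have /cont_atP/(_ e e0) nK := cK A.
  have n1 := src_section_cvg Ax Vx nK.
  have Sx : fset_of (SS A) (s x).
    by apply/(fset_srcE tG etG hU _ Ax); rewrite (g_rs gG) (g_xs gG).
  have sx : (s @` V) (s x) by exists x.
  have n2 := fellH_nbhs_hit (bi_sopen bV) sx Sx.
  have n3 : nbhs (SS A) (fell_units o).
    apply: open_nbhs_nbhs; split; first exact: (fell_units_open tG etG hX).
    exact: (fell_units_src tG etG hU hX).
  apply: filterS (filterI (filterI n1 n2) n3) => A' [[h1 [v [A'v sv]]] uA'].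
  have [B [eB hB]] := src_section_ex uA' A'v sv.
  by rewrite -eB !aE //; exact: h1 eB hB.
Qed.

End SourceSection.
End Extension.

(** * Compactly supported functions on HG *)

Section FellConvolution.
Variables (R : realType) (G : topologicalType) (o : groupoid_data G).
Hypothesis tG : topological_groupoid o.
Hypothesis etG : etale o.
Hypothesis hU : hausdorff_space (set_type (units o)).
Hypothesis hX : locally_compact_space G.
Local Notation r := (grng o).
Local Notation s := (gsrc o).
Local Notation inv := (ginv o).
Local Notation "x ** y" := (gmul o x y) (at level 40, left associativity).
Local Notation gG := (gpdG tG).
Local Notation H := (fellH G).
Local Notation oH := (fell_groupoid o).
Local Notation RR := (grng oH).
Local Notation SS := (gsrc oH).
Local Notation II := (ginv oH).
Local Notation bis := (bisection o).
Implicit Types (x y z w u : G) (A B C : H) (V W : set G) (f g : G -> Cplx R).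
Implicit Types (F K a : H -> Cplx R).

(* [f . s^*(a)], with [f] extended to HG. *)
Definition elem f a : H -> Cplx R := fun A => extS f A * a (SS A).

Definition CcY a := CcH a /\ forall A, ~ fell_units o A -> a A = 0.

Inductive tspan : (H -> Cplx R) -> Prop :=
| tspan0 : tspan (fun=> 0)
| tspanD V f a F : bis V -> Cc_on V f -> CcY a -> tspan F ->
    tspan (fun A => elem f a A + F A).

Lemma cont_src a A : (forall B, cont_at a B) -> cont_at (fun A => a (SS A)) A.
Proof.
by move=> ca; apply: (@cont_comp _ _ _ SS) => //; exact: (fell_src_cont tG etG hU hX).
Qed.

Lemma cont_rng a A : (forall B, cont_at a B) -> cont_at (fun A => a (RR A)) A.
Proof.
by move=> ca; apply: (@cont_comp _ _ _ RR) => //; exact: (fell_rng_cont tG etG hU hX).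
Qed.

Lemma elem_CcH V f a : bis V -> Cc_on V f -> (forall A, cont_at a A) -> CcH (elem f a).
Proof.
move=> bV Cf ca; apply: (CcHM hX); first exact: (extS_CcH tG etG hU hX bV Cf).
by move=> A; exact: cont_src.
Qed.

Lemma tspan_CcH F : tspan F -> CcH F.
Proof.
elim=> [|V f a F' bV Cf [Ca _] _ IH]; first exact: CcH0.
by apply: (CcHD hX) => //; apply: elem_CcH bV Cf _ => A; exact: (CcH_cont A Ca).
Qed.

(* A point of HG meeting the bisection [V] is determined by its source, hence [g F]
   is a function of the source wherever [g] is nonzero. *)
Lemma elem_of_square V g F : bis V -> Cc_on V g -> CcH F ->
  exists a, CcY a /\ forall A, extS g A * (extS g A * F A) = elem g a A.
Proof.
move=> bV Cg CF; have oV := bisection_open bV.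
have hV := bisection_hausdorff tG etG hU bV.
have /(Cc_onP _ oV hV)[L [cL sLV g0 _]] := Cg.
have iV x y := @bis_r_inj G o V x y bV.
have CeF := CcHM hX (extS_CcH tG etG hU hX bV Cg) (fun A => CcH_cont A CF).
have [sr [ss bV']] := bV.
have [|A nA|a [Ca a0 aE]] := src_descend tG etG hU hX bV' (K := fun A => extS g A * F A) cL sLV.
- by move=> A; exact: CcH_cont CeF.
- by rewrite (extS_out (V := L)) ?mul0r // => x Ax Lx; apply: nA; exists x.
exists a; split=> // A; rewrite /elem.
have [hA|nA] := pselect (hit V A); first by rewrite aE.
by rewrite (extS_out (Cc_on_out Cg)) ?mul0r // => x Ax Vx; apply: nA; exists x.
Qed.

(* [F = k^2 F + (1 - k^2) F], and [k^2 F] is elementary by [elem_of_square]. *)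
Lemma CcH_telescope (l : seq (G -> Cplx R)) :
  (forall k, List.In k l -> exists2 V, bis V & Cc_on V k) ->
  forall F, CcH F -> (forall A, F A <> 0 -> exists2 k, List.In k l & extS k A = 1) -> tspan F.
Proof.
elim: l => [|k l IH] hl F CF hF.
  rewrite (_ : F = fun=> 0); first exact: tspan0.
  by apply/funext => x; apply: contrapT => /hF[].
have [V bV Ck] := hl k (or_introl erefl).
have [a [Ya ea]] := elem_of_square bV Ck CF.
pose F' A := F A * (1 - extS k A * extS k A).
have -> : F = fun A => elem k a A + F' A.
  by apply/funext => A; rewrite -ea /F'; ring.
have ck A : cont_at (extS k) A by apply: CcH_cont; exact: (extS_CcH tG etG hU hX bV Ck).
apply: tspanD bV Ck Ya _; apply: IH => [k' kl'||A].
- by apply: hl; right.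
- apply: (CcHM hX) => // A; apply: cont_sub; first exact: cont_const.
  exact: cont_mul.
- move=> h; have FA : F A <> 0 by move=> e; apply: h; rewrite /F' e mul0r.
  have [k' [<-|kl'] k'A] := hF A FA; last by exists k'.
  by case: h; rewrite /F' k'A mulr1 subrr mulr0.
Qed.

(** The bump is 1 on an open set [N] of [G], so its extension is 1 on the open set [hit N] of HG. *)
Lemma extS_bump A x (U : set G) : fset_of A x -> open U -> U x ->
  exists V (k : G -> Cplx R), [/\ bis V, V `<=` U, Cc_on V k,
    forall y, exists2 t : R, 0 <= t <= 1 & k y = t%:C &
    exists N, [/\ open N, N x, N `<=` V & forall B, hit N B -> extS k B = 1]].
Proof.
move=> Ax oU Ux; have [V [k [bV sVU Ck k01 k1]]] := bump_bisection tG etG hU R hX oU Ux.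
exists V, k; split=> //.
have kV0 := Cc_on_out Ck.
have Vx : V x.
  apply: contrapT => /kV0; rewrite (nbhs_singleton k1) => /eqP.
  by rewrite oner_eq0.
have [N [oN Nx sN]] := open_nbhsP (filterI k1 (open_nbhs_nbhs (conj (bisection_open bV) Vx))).
exists N; split=> //; first by move=> y /sN[].
move=> B [y [By Ny]]; have [ky Vy] := sN _ Ny.
by rewrite (extS_in tG etG hU (fun x y => @bis_r_inj G o V x y bV) kV0 By Vy).
Qed.

Lemma CcH_tspan F : CcH F -> tspan F.
Proof.
move=> CF; have /(CcHP hX)[S [cS F0 _]] := CF.
have [A SA|l [okl hl]] := @compact_list_cover H (G -> Cplx R)
    (fun k => exists2 V, bis V & Cc_on V k) (fun k A => extS k A = 1) S cS.
  have [x Ax] := fset_of_neq0 A.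
  have [V [k [bV _ Ck _ [N [oN Nx _ kN]]]]] := extS_bump Ax openT (I : setT x).
  exists k; first by exists V.
  by apply: filterS (fellH_nbhs_hit oN Nx Ax) => B; exact: kN.
apply: (CcH_telescope okl CF) => A FA; apply: hl.
by apply: contrapT => /F0.
Qed.

(** The point is [RR(A) z], obtained as the inverse of the left translate [z^-1 RR(A)]. *)
Lemma rng_section_ex A y z : fset_of A y -> r z = r y ->
  exists C, fset_of C z /\ RR C = RR A.
Proof.
move=> Ay e.
have Ru : fset_of (RR A) (r y).
  by apply/(fset_rngE tG etG hU _ Ay); rewrite (g_sr gG) (g_rx gG).
have e' : r z = r (r y) by rewrite (g_rr gG).
have [B hB] := fell_translate tG etG hU Ru e'.
have Bz : fset_of B (inv z) by apply/hB; rewrite (g_ri gG) (g_xi gG) e.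
exists (II B); split; first by apply/(fset_invE tG).
have IK : II (II B) = B.
  apply: fset_of_inj; rewrite eqEsubset; split=> w.
    by move=> /(fset_invE tG)/(fset_invE tG); rewrite (g_invK gG).
  by move=> Bw; do 2 apply/(fset_invE tG); rewrite (g_invK gG).
rewrite (rng_srcI tG etG hU) IK.
apply: fset_of_inj; rewrite eqEsubset; split=> w.
  by move=> /(fset_srcE tG etG hU _ Bz)[ew /hB[_]]; rewrite (g_iK gG) // ew (g_si gG).
move=> Aw; apply/(fset_srcE tG etG hU _ Bz).
have ew : r w = r z by rewrite (el_r tG etG hU Aw Ru) (g_rr gG).
rewrite (g_si gG); split=> //; apply/hB; rewrite (g_iK gG) //.
by rewrite (g_rM gG) ?(g_ri gG) // (g_si gG).
Qed.

Lemma rng_eq_r C A z y : RR C = RR A -> fset_of C z -> fset_of A y -> r z = r y.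
Proof.
move=> e Cz Ay.
have : fset_of (RR C) (r z) by apply/(fset_rngE tG etG hU _ Cz); rewrite (g_sr gG) (g_rx gG).
by rewrite e => /(fset_rngE tG etG hU _ Ay)[]; rewrite (g_sr gG).
Qed.

(** With [b = inv z ** y] in the quotient, [b ** w] lies in the quotient exactly when [y ** w] lies
    in [A]. This and [rng_div] let a function of the source pass through a convolution. *)
Lemma src_div C A : RR C = RR A -> SS (gmul oH (II C) A) = SS A.
Proof.
move=> e; have [z Cz] := fset_of_neq0 C; have [y Ay] := fset_of_neq0 A.
have ezy := rng_eq_r e Cz Ay.
have hB w := fset_divE tG etG hU w e Cz.
have es : s (inv z) = r y by rewrite (g_si gG).
have Bb : fset_of (gmul oH (II C) A) (inv z ** y).
  by apply/hB; rewrite (g_iK gG) // (g_rM gG) // (g_ri gG).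
have esb : s (inv z ** y) = s y by rewrite (g_sM gG).
have assoc w : r w = s y -> z ** (inv z ** y ** w) = y ** w.
  by move=> ew; rewrite -(g_A gG) ?esb ?(g_rM gG) ?(g_ri gG) // (g_iK gG).
apply: fset_of_inj; rewrite eqEsubset; split=> w.
  move=> /(fset_srcE tG etG hU _ Bb)[ew /hB[_]]; rewrite esb in ew; rewrite assoc // => Ayw.
  by apply/(fset_srcE tG etG hU _ Ay).
move=> /(fset_srcE tG etG hU _ Ay)[ew Ayw].
apply/(fset_srcE tG etG hU _ Bb); rewrite esb; split=> //; apply/hB.
by rewrite assoc // (g_rM gG) ?esb // (g_rM gG) // (g_ri gG).
Qed.

Lemma rng_div C A : RR C = RR A -> RR (gmul oH (II C) A) = SS C.
Proof.
move=> e; have [z Cz] := fset_of_neq0 C; have [y Ay] := fset_of_neq0 A.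
have ezy := rng_eq_r e Cz Ay.
have hB w := fset_divE tG etG hU w e Cz.
have es : s (inv z) = r y by rewrite (g_si gG).
have Bb : fset_of (gmul oH (II C) A) (inv z ** y).
  by apply/hB; rewrite (g_iK gG) // (g_rM gG) // (g_ri gG).
have rb : r (inv z ** y) = s z by rewrite (g_rM gG) // (g_ri gG).
(* Both sides express that [z ** w ** inv z] lies in the common range of [C] and [A]. *)
have key w : s w = s z -> r w = s z ->
    fset_of A (z ** (w ** (inv z ** y))) <-> fset_of C (z ** w).
  move=> sw rw; have s1 : s w = r (inv z) by rewrite (g_ri gG).
  have s2 : s z = r w by [].
  have -> : z ** (w ** (inv z ** y)) = z ** w ** inv z ** y.
    rewrite (g_A gG) ?(g_sM gG) // (g_A gG) //; last by rewrite (g_rM gG) // (g_ri gG).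
  have sq : s (z ** w ** inv z) = r y by rewrite (g_sM gG) // (g_sM gG).
  have rz : s (z ** w ** inv z) = r z by rewrite sq.
  have e2 : z ** w ** inv z ** z = z ** w.
    by rewrite (g_A gG) ?(g_sM gG) ?(g_si gG) // (g_ix gG) -sw -(@g_sM _ _ gG z w) // (g_xs gG).
  split=> [Ah|Ch].
    have : fset_of (RR A) (z ** w ** inv z) by apply/(fset_rngE tG etG hU _ Ay).
    by rewrite -e => /(fset_rngE tG etG hU _ Cz)[_]; rewrite e2.
  have : fset_of (RR C) (z ** w ** inv z).
    by apply/(fset_rngE tG etG hU _ Cz); rewrite e2.
  by rewrite e => /(fset_rngE tG etG hU _ Ay)[_].
apply: fset_of_inj; rewrite eqEsubset; split=> w.
  move=> /(fset_rngE tG etG hU _ Bb)[sw /hB[]]; rewrite rb in sw.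
  have e1 : s w = r (inv z ** y) by rewrite rb.
  rewrite (g_rM gG) // => rw /(key _ sw rw) Cw.
  by apply/(fset_srcE tG etG hU _ Cz).
move=> /(fset_srcE tG etG hU _ Cz)[rw Cw].
have sw : s w = s z by have := el_s tG etG hU Cw Cz; rewrite (g_sM gG).
apply/(fset_rngE tG etG hU _ Bb); rewrite rb; split=> //; apply/hB.
by rewrite (g_rM gG) ?rb //; split=> //; apply/key.
Qed.

(** Each side has at most one term: [A] meets the product of [V] and [W] at most once, and if [x] is
    the common point with factor [z] in [V], the only contributing [C] is the one through [z]. *)
Lemma extS_conv V W f g A : bis V -> bis W -> Cc_on V f -> Cc_on W g ->
  gconv oH (extS f) (extS g) A = extS (gconv o f g) A.
Proof.
move=> bV bW Cf Cg; have f0 := Cc_on_out Cf; have g0 := Cc_on_out Cg.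
have iV x y := @bis_r_inj G o V x y bV; have iW x y := @bis_r_inj G o W x y bW.
have [sr [ss bV']] := bV.
pose Q := bimul o V sr W.
have iQ x y : Q x -> Q y -> r x = r y -> x = y.
  move=> [Vx Wx] [Vy Wy] e.
  have [_ ex] := sec_r bV' Vx; have [_ ey] := sec_r bV' Vy.
  rewrite -[x](g_iK gG ex) -[y](g_iK gG ey) -e; congr (_ ** _).
  rewrite e in Wx ex *; apply: iW => //.
  by rewrite !(g_rM gG) // (g_si gG) ?ex // ey.
have fg0 x : ~ Q x -> gconv o f g x = 0.
  move=> nQ; rewrite (conv_bis _ _ bV' f0); case: pselect => //= -[Vz ez].
  have [Wy|/g0 ->] := pselect (W (inv (sr (r x)) ** x)); last by rewrite mulr0.
  by case: nQ; split=> //; exists (sr (r x)).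
have [[x [Ax Qx]]|nA] := pselect (hit Q A); last first.
  rewrite (extS_out fg0); last by move=> x Ax Qx; apply: nA; exists x.
  apply: fsbig1 => C /= eC.
  have [[z [Cz Vz]]|nC] := pselect (hit V C); last first.
    by rewrite (extS_out f0) ?mul0r // => z Cz Vz; apply: nC; exists z.
  rewrite (extS_out (A := gmul oH (II C) A) g0) ?mulr0 // => y By Wy; apply: nA.
  have [ry Azy] := (fset_divE tG etG hU y eC Cz).1 By.
  exists (z ** y); split=> //; split.
    by exists z => //; rewrite (g_rM gG).
  by rewrite (g_rM gG) // (bi_rK bV') // (g_Ki gG).
have [Vrx Wy] := Qx; have [Vz rz] := sec_r bV' Vrx.
set z := sr (r x) in Wy Vz rz.
have [C [Cz eC]] := rng_section_ex Ax rz.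
have By : fset_of (gmul oH (II C) A) (inv z ** x).
  apply/(fset_divE tG etG hU _ eC Cz); rewrite (g_iK gG) //; split=> //.
  by rewrite (g_rM gG) ?(g_ri gG) // (g_si gG).
rewrite /Defs.conv (fsum_single (z0 := C)) //; last first.
  move=> C' eC0 nC'; have eC' : RR C' = RR A by [].
  rewrite (extS_out f0) ?mul0r // => z' C'z' Vz'; apply: nC'.
  have ez : z' = z by apply: iV => //; rewrite rz (rng_eq_r eC' C'z' Ax).
  by subst z'; apply: (fell_eq_rng tG etG hU (x := z)) => //; rewrite eC' eC.
rewrite (extS_in tG etG hU iV f0 Cz Vz) (extS_in tG etG hU iW g0 By Wy).
rewrite (extS_in tG etG hU iQ fg0 Ax Qx) (conv_bis _ _ bV' f0).
by case: pselect => // -[].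
Qed.

(** A point of HG that meets [V] is determined by its range, and also by its source. *)
Lemma extS_fibre_finite V f : bis V -> Cc_on V f -> fibre_finite oH (extS f).
Proof.
move=> bV Cf A; have f0 := Cc_on_out Cf.
have hitV C : extS f C <> 0 -> hit V C.
  by move=> fC; apply: contrapT => nC; apply: fC; apply: (extS_out f0) => x Cx Vx; apply: nC; exists x.
have sub1 (P : set H) : (forall C C', P C -> P C' -> C = C') -> finite_set P.
  move=> h; have [[C PC]|nP] := pselect (exists C, P C).
    by apply: (@sub_finite_set _ _ [set C]) => // C' PC'; exact: h.
  by apply: (@sub_finite_set _ _ set0) => // C PC; apply: nP; exists C.
split; apply: sub1 => C C' [eC /hitV[x [Cx Vx]]] [eC' /hitV[x' [Cx' Vx']]].
  have e : RR C = RR C' by rewrite eC eC'.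
  have exx : x = x' by apply: (bis_r_inj bV) => //; exact: rng_eq_r e Cx Cx'.
  by subst x'; exact: (fell_eq_rng tG etG hU e Cx Cx').
have e : SS C = SS C' by rewrite eC eC'.
have [sr [ss bV']] := bV.
by apply: (src_section_uniq tG etG hU bV' e); [exists x|exists x'].
Qed.

Lemma elem_fibre_finite V f a : bis V -> Cc_on V f -> fibre_finite oH (elem f a).
Proof. by move=> bV Cf; apply: fibre_finiteM; exact: extS_fibre_finite bV Cf. Qed.

Lemma CcH_fibre_finite F : CcH F -> fibre_finite oH F.
Proof.
move=> /CcH_tspan; elim=> [|V f a F' bV Cf _ _ IH]; first exact: fibre_finite0.
by apply: fibre_finiteD => //; exact: elem_fibre_finite bV Cf.
Qed.

(** [SS C] is the range of [C^-1 A], so the coefficient of the left factor becomes a function of the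
    range on the right factor. *)
Lemma conv_elem_l f a F A :
  gconv oH (elem f a) F A = gconv oH (extS f) (fun B => F B * a (RR B)) A.
Proof.
apply: eq_fsbigr => C /set_mem eC.
by rewrite /elem (rng_div eC) -mulrA; congr (_ * _); rewrite mulrC.
Qed.

Lemma conv_elem_r F g c A :
  gconv oH F (elem g c) A = gconv oH F (extS g) A * c (SS A).
Proof.
rewrite /Defs.conv mulr_fsuml; apply: eq_fsbigr => C /set_mem eC.
by rewrite /elem (src_div eC) mulrA.
Qed.

Lemma CcH_conv F K : CcH F -> CcH K -> CcH (gconv oH F K).
Proof.
move=> /CcH_tspan tF; elim: tF K => [|V f a F' bV Cf [Ca a0] tF' IH] K CK.
  rewrite (_ : gconv oH _ K = fun=> 0); first exact: CcH0.
  by apply/funext => A; apply: fsbig1 => C _; rewrite mul0r.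
rewrite (_ : gconv oH _ K = fun A => gconv oH (elem f a) K A + gconv oH F' K A); last first.
  apply/funext => A; apply: convDl; first exact: elem_fibre_finite bV Cf.
  by apply: CcH_fibre_finite; exact: tspan_CcH.
apply: (CcHD hX); last exact: IH.
rewrite (_ : gconv oH _ K = gconv oH (extS f) (fun B => K B * a (RR B))); last first.
  by apply/funext => A; exact: conv_elem_l.
have CK' : CcH (fun B => K B * a (RR B)).
  by apply: (CcHM hX) => // A; apply: cont_rng => B; exact: (CcH_cont B Ca).
move: CK' => /CcH_tspan; move: (fun B => _) => K'.
elim=> [|W g c K2 bW Cg [Cc _] _ IH2].
  rewrite (_ : gconv oH _ _ = fun=> 0); first exact: CcH0.
  by apply/funext => A; apply: fsbig1 => C _; rewrite mulr0.
have ff := extS_fibre_finite bV Cf.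
rewrite (_ : gconv oH _ _ = fun A => extS (gconv o f g) A * c (SS A) + gconv oH (extS f) K2 A).
  apply: (CcHD hX) => //; apply: (CcHM hX).
    apply: (extS_Cc_span tG etG hU hX); apply: (Cc_span_conv tG etG hU hX).
      exact: (Cc_span_bis tG etG hU hX bV Cf).
    exact: (Cc_span_bis tG etG hU hX bW Cg).
  by move=> A; apply: cont_src => B; exact: (CcH_cont B Cc).
apply/funext => A; rewrite (convDr _ _ _ ff) conv_elem_r.
by rewrite (extS_conv _ bV bW Cf Cg).
Qed.

Definition single x : H := projT1 (cid (fellH_single hX x)).

Lemma singleE x : fset_of (single x) = [set x].
Proof. by rewrite /single; case: cid. Qed.

Lemma single_eq A x : fset_of A = [set x] -> A = single x.
Proof. by move=> e; apply: fset_of_inj; rewrite singleE. Qed.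

Lemma single_in x : fset_of (single x) x.
Proof. by rewrite singleE. Qed.

Lemma single_rng x : RR (single x) = single (r x).
Proof.
apply: single_eq; rewrite eqEsubset; split=> w /=.
  move=> /(fset_rngE tG etG hU _ (single_in x))[e]; rewrite singleE /= => ewx.
  by rewrite -[w](g_xs gG) e -(g_xi gG) -(g_A gG) ?(g_ri gG) // ewx.
by move=> ->; apply/(fset_rngE tG etG hU _ (single_in x)); rewrite (g_sr gG) (g_rx gG) singleE.
Qed.

Lemma single_src x : SS (single x) = single (s x).
Proof.
apply: single_eq; rewrite eqEsubset; split=> w /=.
  move=> /(fset_srcE tG etG hU _ (single_in x))[e]; rewrite singleE /= => ewx.
  by rewrite -[w](g_Ki gG (esym e)) ewx (g_ix gG).
by move=> ->; apply/(fset_srcE tG etG hU _ (single_in x)); rewrite (g_rs gG) (g_xs gG) singleE.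
Qed.

Lemma single_inv x : II (single x) = single (inv x).
Proof.
apply: single_eq; rewrite eqEsubset; split=> w /=.
  by move=> /(fset_invE tG); rewrite singleE /= => <-; rewrite (g_invK gG).
by move=> ->; apply/(fset_invE tG); rewrite (g_invK gG) singleE.
Qed.

Lemma single_div x z : r z = r x -> gmul oH (II (single z)) (single x) = single (inv z ** x).
Proof.
move=> e; have eR : RR (single z) = RR (single x) by rewrite !single_rng e.
have es : s (inv z) = r x by rewrite (g_si gG).
apply: single_eq; rewrite eqEsubset; split=> w /=.
  move=> /(fset_divE tG etG hU w eR (single_in z))[rw]; rewrite singleE /= => <-.
  by rewrite (g_Ki gG).
move=> ->; apply/(fset_divE tG etG hU _ eR (single_in z)).
by rewrite (g_iK gG) // singleE (g_rM gG) // (g_ri gG).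
Qed.

Lemma single_rng_eq C x : RR C = RR (single x) -> exists2 z, r z = r x & C = single z.
Proof.
move=> e; have [z Cz] := fset_of_neq0 C.
have ez := rng_eq_r e Cz (single_in x).
exists z => //; apply: (fell_eq_rng tG etG hU (x := z)) => //; last exact: single_in.
by rewrite e !single_rng ez.
Qed.

Definition resS F : G -> Cplx R := fun x => F (single x).

Lemma resSE F x : resS F x = F (single x).
Proof. by []. Qed.

(** A point of HG whose range is the singleton of a unit is itself a singleton, so over units of [G]
    both groupoids have the same fibres. *)
Lemma resS_conv F K x : gconv oH F K (single x) = gconv o (resS F) (resS K) x.
Proof.
rewrite /Defs.conv (@reindex_fsbig _ _ _ _ _ single [set z | r z = r x]).
  by apply: eq_fsbigr => z /set_mem ez; rewrite (single_div ez).
split.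
- move=> z ez; suff : RR (single z) = RR (single x) by [].
  by rewrite !single_rng ez.
- move=> z z' _ _ e; have : fset_of (single z) z' by rewrite e; exact: single_in.
  by rewrite singleE.
- by move=> C /= /single_rng_eq[z ez ->]; exists z.
Qed.

Lemma resS_star F x : star oH F (single x) = star o (resS F) x.
Proof. by rewrite /star single_inv. Qed.

Lemma resS_fibre_finite F : CcH F -> fibre_finite o (resS F).
Proof.
move=> CF u; have [h1 h2] := CcH_fibre_finite CF (single u).
have inj P : {in single @^-1` P &, injective single}.
  move=> z z' _ _ e; have : fset_of (single z) z' by rewrite e; exact: single_in.
  by rewrite singleE.
split.
  apply: sub_finite_set (finite_preimage (inj _) h1) => z [ez Fz].
  by split=> //; rewrite single_rng ez.
apply: sub_finite_set (finite_preimage (inj _) h2) => z [ez Fz].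
by split=> //; rewrite single_src ez.
Qed.

End FellConvolution.

(** * The algebra D *)

Section ComplexTopology.
Variable R : realType.
Implicit Types (z w : Cplx R) (V : set (Cplx R)).

Lemma cplx_open_ball z (d : R) : open [set w : Cplx R | cabs (w - z) < d].
Proof.
rewrite openE => w /= hw.
have /cont_atP h : @cont_at R (Cplx R) id w by constructor; exact: cvg_id.
have e0 : 0 < d - cabs (w - z) by rewrite subr_gt0.
apply: filterS (h _ e0) => v /= hv; rewrite -(subrK w v) -addrA.
apply: (le_lt_trans (cabsD _ _)); rewrite -ltrBrDr; exact: hv.
Qed.

Lemma cplx_open_nbhd V z : open V -> V z ->
  exists2 d : R, 0 < d & forall w, cabs (w - z) < d -> V w.
Proof.
rewrite openE => oV Vz; have := oV z Vz; rewrite /interior => /nbhs_ballP[d /= d0 hd].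
have ed : d = (complex.Re d)%:C.
  by move: d0; case: (d) => a' b; rewrite ltcE /= => /andP[/eqP -> _].
rewrite ed ltcC in d0; exists (complex.Re d) => // w hw; apply: hd.
by rewrite -ball_normE /= ed distrC -cabs_lt.
Qed.

Lemma cabs_i : cabs ('i : Cplx R) = 1.
Proof. by rewrite /cabs normc_def /= expr0n expr1n add0r sqrtr1. Qed.

Lemma cplx_sub_parts z (p q : R) : z - (p%:C + 'i * q%:C) =
  (complex.Re z - p)%:C + 'i * (complex.Im z - q)%:C.
Proof.
apply/eqP; rewrite eq_complex; case: z => a b /=; apply/andP; split; apply/eqP; ring.
Qed.

Lemma invn_lt (e : R) : 0 < e -> exists n : nat, n.+1%:R^-1 < e.
Proof.
move=> e0; have [n _ hn] := near_infty_natSinv_lt (PosNum e0).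
by exists n; apply: hn => /=.
Qed.

Lemma cplx_rat_approx z (d : R) : 0 < d ->
  exists p q : rat, cabs (z - ((ratr p : R)%:C + 'i * (ratr q : R)%:C)) < d.
Proof.
move=> d0; case: z => a b; have d2 : 0 < d / 2 by rewrite divr_gt0.
have [p] := @rat_in_itvoo R (a - d / 2) (a + d / 2) ltac:(lra).
rewrite in_itv /= => /andP[p1 p2].
have [q] := @rat_in_itvoo R (b - d / 2) (b + d / 2) ltac:(lra).
rewrite in_itv /= => /andP[q1 q2].
exists p, q.
rewrite cplx_sub_parts /=; apply: (le_lt_trans (cabsD _ _)).
rewrite cabsM !cabs_real cabs_i.
have h1 : `|a - ratr p| < d / 2 by rewrite ltr_norml; apply/andP; split; lra.
have h2 : `|b - ratr q| < d / 2 by rewrite ltr_norml; apply/andP; split; lra.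
lra.
Qed.

Lemma cplx_complete (u : nat -> Cplx R) :
  (forall e : R, 0 < e -> exists N, forall m n, (N <= m)%N -> (N <= n)%N -> cabs (u m - u n) < e) ->
  exists l, forall e : R, 0 < e -> exists N, forall n, (N <= n)%N -> cabs (u n - l) < e.
Proof.
move=> cu.
have Re_le z : `|complex.Re z| <= cabs z.
  rewrite -lecC -cabsE; exact: normc_ge_Re.
have Im_le z : `|complex.Im z| <= cabs z.
  have := Re_le (z * 'i); rewrite cabsM cabs_i.
  by rewrite mulr1; case: z => a b /=; rewrite mulr0 mulr1 sub0r normrN.
have real_lim (p : Cplx R -> R) : (forall z w, p (z - w) = p z - p w) ->
    (forall z, `|p z| <= cabs z) -> exists l : R, (p \o u) @ \oo --> l.
  move=> pB ple; suff : cvgn (p \o u) by exists (limn (p \o u)).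
  apply/cauchy_cvgP/cauchy_ballP => e e0.
  have [N hN] := cu _ e0.
  exists ((p \o u) @` [set n | (N <= n)%N], (p \o u) @` [set n | (N <= n)%N]) => /=.
    by split; exists N => // n Nn; exists n.
  move=> [_ _] /= [[m Nm <-] [n Nn <-]]; rewrite -ball_normE /= -pB.
  exact: (le_lt_trans (ple _) (hN _ _ Nm Nn)).
have [a ha] := real_lim (@complex.Re R) (fun z w => raddfB _ z w) Re_le.
have [b hb] := real_lim (@complex.Im R) (fun z w => raddfB _ z w) Im_le.
exists (a%:C + 'i * b%:C) => e e0.
have e2 : 0 < e / 2 by rewrite divr_gt0.
have /cvgrPdist_lt/(_ _ e2)[N1 _ h1] := ha.
have /cvgrPdist_lt/(_ _ e2)[N2 _ h2] := hb.
exists (maxn N1 N2) => n; rewrite geq_max => /andP[n1 n2].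
rewrite cplx_sub_parts; apply: (le_lt_trans (cabsD _ _)); rewrite cabsM !cabs_real cabs_i.
by have := h1 n n1; have := h2 n n2; rewrite /= (distrC a) (distrC b); lra.
Qed.

End ComplexTopology.

(** * Borel functions and their uniform limits *)

Section BorelFunctions.
Variables (R : realType) (T : topologicalType) (Z : set T).
Implicit Types (f g : T -> Cplx R).
Local Notation Bs := (<<s Z, open_in Z>>).

Definition borel_fun f := forall V : set (Cplx R), open V -> Bs (Z `&` f @^-1` V).

Lemma borel0 : Bs set0.
Proof. by have [] := smallest_sigma_algebra Z (open_in Z). Qed.

Lemma borelC A : Bs A -> Bs (Z `\` A).
Proof. by have [_ h _] := smallest_sigma_algebra Z (open_in Z); exact: h. Qed.

Lemma borelU (F : nat -> set T) : (forall n, Bs (F n)) -> Bs (\bigcup_n F n).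
Proof. by have [_ _ h] := smallest_sigma_algebra Z (open_in Z); exact: h. Qed.

Lemma borelU2 A B : Bs A -> Bs B -> Bs (A `|` B).
Proof.
move=> hA hB; have -> : A `|` B = \bigcup_n (if n is 0%N then A else B).
  rewrite eqEsubset; split=> x; first by case=> ?; [exists 0%N|exists 1%N].
  by move=> [[|n] _]; [left|right].
by apply: borelU => -[].
Qed.

Lemma borel_subset A : Bs A -> A `<=` Z.
Proof.
move=> BA; suff : Bs `<=` [set A | A `<=` Z] by exact.
apply: smallest_sub.
  split; [by []|by move=> B sB x []|by move=> F sF x [n _ /sF]].
by move=> _ [W oW ->] x [].
Qed.

Lemma borelI2 A B : Bs A -> Bs B -> Bs (A `&` B).
Proof.
move=> hA hB.
have -> : A `&` B = Z `\` ((Z `\` A) `|` (Z `\` B)).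
  rewrite eqEsubset; split=> x.
    by move=> [Ax Bx]; split; [exact: borel_subset Ax|case=> -[]].
  move=> [Zx h]; split; apply: contrapT => nx; apply: h; [by left|by right].
by apply: borelC; apply: borelU2; exact: borelC.
Qed.

Lemma borel_open W : open W -> Bs (Z `&` W).
Proof. by move=> oW; apply: sub_sigma_algebra; exists W. Qed.

Lemma borelU_count (I : countType) (F : I -> set T) : (forall i, Bs (F i)) -> Bs (\bigcup_i F i).
Proof.
move=> hF; have -> : \bigcup_i F i =
    \bigcup_n (if @choice.unpickle I n is Some i then F i else set0).
  rewrite eqEsubset; split=> x [i _ Fx]; first by exists (choice.pickle i) => //; rewrite choice.pickleK.
  by move: Fx; case: (choice.unpickle i) => // j Fj; exists j.
by apply: borelU => n; case: (choice.unpickle n) => [i|]; [exact: hF|exact: borel0].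
Qed.

(** Pairs of discs with rational centres and radii [1/(n+1)] exhaust the preimage of [V] under
    [phi], so a countable union suffices. Linear combinations, products and conjugates are all
    instances. *)
Lemma borel_fun_comp2 (phi : Cplx R -> Cplx R -> Cplx R) f g :
  (forall z w (e : R), 0 < e -> exists2 d : R, 0 < d &
    forall z' w', cabs (z' - z) < d -> cabs (w' - w) < d -> cabs (phi z' w' - phi z w) < e) ->
  borel_fun f -> borel_fun g -> borel_fun (fun x => phi (f x) (g x)).
Proof.
move=> cphi bf bg V oV.
pose c (p q : rat) : Cplx R := (ratr p : R)%:C + 'i * (ratr q : R)%:C.
pose B (p q : rat) (n : nat) : set (Cplx R) := [set z | cabs (z - c p q) < n.+1%:R^-1].
pose ok (t : ((rat * rat) * (rat * rat)) * nat) :=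
  forall z w, B t.1.1.1 t.1.1.2 t.2 z -> B t.1.2.1 t.1.2.2 t.2 w -> V (phi z w).
have -> : Z `&` (fun x => phi (f x) (g x)) @^-1` V = \bigcup_t
    (if pselect (ok t) then (Z `&` f @^-1` B t.1.1.1 t.1.1.2 t.2) `&`
                            (Z `&` g @^-1` B t.1.2.1 t.1.2.2 t.2) else set0).
  rewrite eqEsubset; split=> [x [Zx Vx]|x [t _]]; last first.
    by case: pselect => // okt [[Zx Bf] [_ Bg]]; split=> //; exact: okt.
  have [e e0 he] := cplx_open_nbhd oV Vx.
  have [d d0 hd] := cphi (f x) (g x) e e0.
  (* Half of [d], because both the value at [x] and the nearby point are compared through the
     rational centre. *)
  have [n hn] : exists n : nat, n.+1%:R^-1 < d / 2 by apply: invn_lt; rewrite divr_gt0.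
  have n0 : 0 < (n.+1%:R^-1 : R) by rewrite invr_gt0.
  have [p1 [q1 h1]] := cplx_rat_approx (f x) n0.
  have [p2 [q2 h2]] := cplx_rat_approx (g x) n0.
  exists (((p1, q1), (p2, q2)), n) => //; case: pselect => [okt|[]]; first by split; split.
  move=> z w /= Bz Bw; apply: he; apply: hd.
    rewrite -(subrK (c p1 q1) z) -addrA; apply: (le_lt_trans (cabsD _ _)).
    rewrite [cabs (c p1 q1 - _)]cabsB.
    have b1 : cabs (z - c p1 q1) < d / 2 := lt_trans Bz hn.
    have b2 : cabs (f x - c p1 q1) < d / 2 := lt_trans h1 hn.
    lra.
  rewrite -(subrK (c p2 q2) w) -addrA; apply: (le_lt_trans (cabsD _ _)).
  rewrite [cabs (c p2 q2 - _)]cabsB.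
  have b1 : cabs (w - c p2 q2) < d / 2 := lt_trans Bw hn.
  have b2 : cabs (g x - c p2 q2) < d / 2 := lt_trans h2 hn.
  lra.
apply: borelU_count => t; case: (pselect (ok t)) => [okt|nok]; last exact: borel0.
by apply: borelI2; [apply: bf|apply: bg]; exact: cplx_open_ball.
Qed.

Lemma borel_fun_lim f : (forall e : R, 0 < e ->
    exists2 g, borel_fun g & forall x, cabs (f x - g x) <= e) -> borel_fun f.
Proof.
move=> hf V oV.
pose en (n : nat) : R := n.+1%:R^-1.
have en0 n : 0 < en n by rewrite invr_gt0.
have en2 n : 0 < en n / 2 by rewrite divr_gt0.
have [g hg] : exists g : nat -> T -> Cplx R, forall n,
    borel_fun (g n) /\ forall x, cabs (f x - g n x) <= en n / 2.
  have h n : exists g, borel_fun g /\ forall x, cabs (f x - g x) <= en n / 2.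
    by have [g] := hf _ (en2 n); exists g.
  by exists (fun n => projT1 (cid (h n))) => n; case: cid.
(* The radii leave room for the error [en n / 2] between [f] and [g n]: in one direction [f x]
   itself serves as [z], in the other [en n + en n / 2 < 2 * en n]. *)
pose W n := \bigcup_(z in [set z | forall w, cabs (w - z) < 2 * en n -> V w])
   [set w : Cplx R | cabs (w - z) < en n].
have oW n : open (W n) by apply: bigcup_open => z _; exact: cplx_open_ball.
have -> : Z `&` f @^-1` V = \bigcup_n (Z `&` g n @^-1` W n).
  rewrite eqEsubset; split=> [x [Zx Vx]|x [n _ [Zx [z hz /= gz]]]].
    have [e e0 he] := cplx_open_nbhd oV Vx.
    have [n hn] : exists n : nat, en n < e / 2 by apply: invn_lt; rewrite divr_gt0.
    exists n => //; split=> //; exists (f x).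
      by move=> w /= hw; apply: he; lra.
    by have := (hg n).2 x; rewrite /= cabsB; have := en0 n; lra.
  split=> //; apply: hz; rewrite -(subrK (g n x) (f x)) -addrA.
  apply: (le_lt_trans (cabsD _ _)).
  by have := (hg n).2 x; have := en0 n; lra.
by apply: borelU => n; apply: (hg n).1.
Qed.

End BorelFunctions.

Section BoundedBorel.
Variables (R : realType) (T : topologicalType) (Z : set T).
Implicit Types (f g : T -> Cplx R).

Lemma bounded_borelP f : bounded_borel Z f <->
  [/\ forall x, ~ Z x -> f x = 0, exists M : R, forall x, cabs (f x) <= M & borel_fun Z f].
Proof.
split=> -[h1 [M hM] h3]; split=> //; exists M => x.
  by rewrite cabs_le.
by rewrite -cabs_le.
Qed.

Lemma borel_fun_const c : borel_fun Z (fun=> c : Cplx R).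
Proof.
move=> V oV; have [Vc|nV] := pselect (V c).
  rewrite (_ : _ `&` _ = Z `&` setT); first by apply: borel_open; exact: openT.
  by rewrite eqEsubset; split=> x [Zx _].
rewrite (_ : _ `&` _ = set0); first exact: borel0.
by rewrite eqEsubset; split=> x // [].
Qed.

Lemma cplx_add_cont (c z w : Cplx R) (e : R) : 0 < e -> exists2 d : R, 0 < d &
  forall z' w', cabs (z' - z) < d -> cabs (w' - w) < d ->
    cabs ((c * z' + w') - (c * z + w)) < e.
Proof.
move=> e0; have c0 := cabs_ge0 c.
have m0 : 0 < cabs c + 1 by lra.
exists (e / (cabs c + 1)); first by rewrite divr_gt0.
move=> z' w' hz hw.
have -> : (c * z' + w') - (c * z + w) = c * (z' - z) + (w' - w) by ring.
apply: (le_lt_trans (cabsD _ _)); rewrite cabsM.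
have -> : e = cabs c * (e / (cabs c + 1)) + e / (cabs c + 1).
  by field; apply: lt0r_neq0.
by apply: ler_ltD => //; apply: ler_wpM2l => //; exact: ltW.
Qed.

Lemma cplx_mul_cont (z w : Cplx R) (e : R) : 0 < e -> exists2 d : R, 0 < d &
  forall z' w', cabs (z' - z) < d -> cabs (w' - w) < d -> cabs (z' * w' - z * w) < e.
Proof.
move=> e0; have z0 := cabs_ge0 z; have w0 := cabs_ge0 w.
pose M := cabs z + cabs w + 1; have M0 : 0 < M by rewrite /M; lra.
exists (Num.min 1 (e / M)); first by rewrite lt_min ltr01 divr_gt0.
move=> z' w'; rewrite !lt_min => /andP[hz1 hz] /andP[hw1 hw].
have -> : z' * w' - z * w = (z' - z) * (w' - w) + (z' - z) * w + z * (w' - w) by ring.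
apply: (le_lt_trans (cabsD _ _)).
have h := cabsD ((z' - z) * (w' - w)) ((z' - z) * w).
rewrite !cabsM in h *.
have a0 := cabs_ge0 (z' - z); have b0 := cabs_ge0 (w' - w).
set a := cabs (z' - z) in h hz hz1 a0 *; set b := cabs (w' - w) in h hw hw1 b0 *.
have eM : e = (e / M) * (cabs z + cabs w + 1).
  by rewrite -/M; field; apply: lt0r_neq0.
have d0 : 0 < e / M by rewrite divr_gt0.
set d := e / M in eM d0 hz hw *.
have h1 : a * b <= a by rewrite ler_piMr // ltW.
have h2 : a * cabs w <= d * cabs w by rewrite ler_wpM2r // ltW.
have h3 : cabs z * b <= cabs z * d by rewrite ler_wpM2l // ltW.
nra.
Qed.

Lemma cplx_conj_cont (z w : Cplx R) (e : R) : 0 < e -> exists2 d : R, 0 < d &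
  forall z' w' : Cplx R, cabs (z' - z) < d -> cabs (w' - w) < d -> cabs (z'^* - z^*) < e.
Proof. by move=> e0; exists e => // z' w' hz _; rewrite -conjB cabsJ. Qed.

Lemma bounded_borel_algebra : Cstar_subalgebra_fun (bounded_borel Z) (@bounded_borel R T Z).
Proof.
split=> //.
- apply/bounded_borelP; split=> //; last exact: borel_fun_const.
  by exists 0 => x; rewrite cabs0.
- move=> c f g /bounded_borelP[f0 [M hM] bf] /bounded_borelP[g0 [N hN] bg].
  apply/bounded_borelP; split=> [x nx||].
  + by rewrite f0 // g0 // mulr0 addr0.
  + exists (cabs c * M + N) => x; apply: (le_trans (cabsD _ _)); apply: lerD => //.
    by rewrite cabsM ler_wpM2l // cabs_ge0.
  + by apply: (borel_fun_comp2 (phi := fun z w => c * z + w)) => // z w e; exact: cplx_add_cont.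
- move=> f g /bounded_borelP[f0 [M hM] bf] /bounded_borelP[g0 [N hN] bg].
  split; apply/bounded_borelP; split.
  + by move=> x nx; rewrite f0 // mul0r.
  + exists (M * N) => x; rewrite cabsM; apply: ler_pM => //; exact: cabs_ge0.
  + by apply: (borel_fun_comp2 (phi := fun z w => z * w)) => // z w e; exact: cplx_mul_cont.
  + by move=> x nx; rewrite f0 //; exact: rmorph0.
  + by exists M => x; rewrite cabsJ.
  + by apply: (borel_fun_comp2 (phi := fun z w => z^*) (g := f)) => // z w e; exact: cplx_conj_cont.
- move=> f hf; have hf' (e : R) : 0 < e -> exists2 g, bounded_borel Z g & forall x, cabs (f x - g x) <= e.
    by move=> /hf[g bg hg]; exists g => // x; rewrite cabs_le.
  apply/bounded_borelP; split.
  + move=> x nx; apply: cabs_eq0; apply/eqP; rewrite eq_le cabs_ge0 andbT.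
    apply/ler_addgt0Pr => e /hf'[g /bounded_borelP[g0 _ _] /(_ x)].
    by rewrite g0 // subr0 add0r.
  + have [g /bounded_borelP[_ [M hM] _] hg] := hf' 1 ltr01.
    exists (M + 1) => x; rewrite -(subrK (g x) (f x)) addrC.
    by apply: (le_trans (cabsD _ _)); apply: lerD.
  + apply: borel_fun_lim => e /hf'[g /bounded_borelP[_ _ bg] hg]; by exists g.
Qed.

Lemma smallest_Cstar_subalgebra (S : set (T -> Cplx R)) : S `<=` bounded_borel Z ->
  Cstar_subalgebra_fun (bounded_borel Z) (smallest (Cstar_subalgebra_fun (bounded_borel Z)) S).
Proof.
move=> hS; split.
- by move=> f; apply; split=> //; exact: bounded_borel_algebra.
- by move=> B [[_ h _ _ _] _].
- by move=> c f g hf hg B hB; have [[_ _ h _ _] _] := hB; apply: h; [exact: hf|exact: hg].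
- move=> f g hf hg; split=> B hB; have [[_ _ _ h _] _] := hB.
    by case: (h f g (hf B hB) (hg B hB)).
  by case: (h f g (hf B hB) (hg B hB)).
- move=> f hf B hB; have [[_ _ _ _ h] _] := hB; apply: h => e /hf[g hg e'].
  by exists g => //; exact: hg.
Qed.

End BoundedBorel.

(** * C_0 functions on the unit space of HG and their restrictions in D *)

Section VanishingAtInfinity.
Variables (R : realType) (G : topologicalType) (o : groupoid_data G).
Hypothesis tG : topological_groupoid o.
Hypothesis etG : etale o.
Hypothesis hU : hausdorff_space (set_type (units o)).
Hypothesis hX : locally_compact_space G.
Local Notation r := (grng o).
Local Notation s := (gsrc o).
Local Notation inv := (ginv o).
Local Notation gG := (gpdG tG).
Local Notation H := (fellH G).
Local Notation Y := (fell_units o).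
Local Notation U0 := (units o).
Local Notation bis := (bisection o).
Local Notation single := (single hX).
Local Notation resS := (resS hX).
Local Notation D := (@algD R G o).
Implicit Types (A B C : H) (f g : G -> Cplx R) (h k : H -> Cplx R).

Lemma closed_cabs_ge h (e : R) : (forall A, cont_at h A) -> closed [set A | e <= cabs (h A)].
Proof.
move=> ch; rewrite -[X in closed X]setCK; apply: open_closedC; rewrite openE => A /= /negP.
rewrite -ltNge => hA.
have e0 : 0 < e - cabs (h A) by rewrite subr_gt0.
have /cont_atP/(_ _ e0) := ch A; apply: filterS => B hB /=; apply/negP; rewrite -ltNge.
rewrite -(subrK (h A) (h B)); apply: (le_lt_trans (cabsD _ _)); rewrite -ltrBrDr; exact: hB.
Qed.

Lemma C0_intro h : (forall A, ~ Y A -> h A = 0) -> (forall A, cont_at h A) ->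
  (forall e : R, 0 < e -> exists K, compact K /\ forall A, e <= cabs (h A) -> K A) -> C0 Y h.
Proof.
move=> h0 ch hK; split=> //.
  apply/(within_cont_at _ (fell_units_open tG etG hX)) => A _; exact: ch.
move=> e e0; have [K [cK sK]] := hK e e0.
have -> : Y `&` [set A | e%:C <= `|h A|] = [set A | e <= cabs (h A)].
  rewrite eqEsubset; split=> A; first by move=> [_ /=]; rewrite cabsE lecC.
  move=> /= hA; split; last by rewrite /= cabsE lecC.
  apply: contrapT => /h0 e1; move: hA; rewrite e1 cabs0; lra.
by apply: (subclosed_compact _ cK) => //; exact: closed_cabs_ge.
Qed.

Lemma C0_out h A : C0 Y h -> ~ Y A -> h A = 0.
Proof. by case=> + _ _; exact. Qed.

(** The unit space of HG is open and closed, so extension by zero is continuous on all of HG. *)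
Lemma C0_cont h A : C0 Y h -> cont_at h A.
Proof.
move=> [h0 /(within_cont_at _ (fell_units_open tG etG hX)) ch _].
have [/ch //|nA] := pselect (Y A).
apply: (@cont_near_eq _ _ _ (fun=> 0)); last exact: cont_const.
have nY : nbhs A (~` Y).
  by apply: open_nbhs_nbhs; split=> //; apply: closed_openC; exact: fell_units_closed.
by apply: filterS nY => B /h0.
Qed.

Lemma C0_compact h (e : R) : C0 Y h -> 0 < e -> compact [set A | e <= cabs (h A)].
Proof.
move=> [h0 _ hK] e0; have := hK e e0.
suff -> : Y `&` [set A | e%:C <= `|h A|] = [set A | e <= cabs (h A)] by [].
rewrite eqEsubset; split=> A; first by move=> [_ /=]; rewrite cabsE lecC.
move=> /= hA; split; last by rewrite /= cabsE lecC.
apply: contrapT => /h0 e1; move: hA; rewrite e1 cabs0; lra.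
Qed.

Lemma C0_bounded h : C0 Y h -> exists M : R, 0 <= M /\ forall A, cabs (h A) <= M.
Proof.
move=> Ch; have cK := C0_compact Ch ltr01.
have [M [M0 hM]] := compact_cabs_bounded cK (fun A _ => C0_cont A Ch).
exists (M + 1); split; first by lra.
move=> A; have [/hM|] := leP 1 (cabs (h A)); lra.
Qed.

Lemma CcY_C0 h : CcY o h -> C0 Y h.
Proof.
move=> [Ch h0]; apply: C0_intro => // [A|e e0]; first exact: CcH_cont.
have /(CcHP hX)[S [cS hS _]] := Ch; exists S; split=> // A hA.
apply: contrapT => /hS e1; move: hA; rewrite e1 cabs0; lra.
Qed.

Lemma C0_zero : C0 Y (fun=> 0 : Cplx R).
Proof. by apply: CcY_C0; split=> //; exact: CcH0. Qed.

Lemma C0_mul h k : C0 Y h -> (forall A, cont_at k A) ->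
  (exists M : R, forall A, cabs (k A) <= M) -> C0 Y (fun A => h A * k A).
Proof.
move=> Ch ck [M hM]; apply: C0_intro => [A nA|A|e e0].
- by rewrite (C0_out Ch nA) mul0r.
- by apply: cont_mul => //; exact: C0_cont.
- pose N := `|M| + 1; have N0 : 0 < N by rewrite /N; have := normr_ge0 M; lra.
  exists [set A | e / N <= cabs (h A)]; split; first by apply: C0_compact => //; rewrite divr_gt0.
  move=> A; rewrite cabsM /= => hA; rewrite ler_pdivrMr //; apply: (le_trans hA).
  apply: ler_wpM2l; first exact: cabs_ge0.
  by apply: (le_trans (hM A)); apply: (le_trans (ler_norm M)); rewrite /N; lra.
Qed.

Lemma C0_ZD (c : Cplx R) h k : C0 Y h -> C0 Y k -> C0 Y (fun A => c * h A + k A).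
Proof.
move=> Ch Ck; apply: C0_intro => [A nA|A|e e0].
- by rewrite (C0_out Ch nA) (C0_out Ck nA) mulr0 addr0.
- by apply: cont_add; [apply: cont_scale|]; exact: C0_cont.
- pose N := cabs c + 1; have N0 : 0 < N by rewrite /N; have := cabs_ge0 c; lra.
  exists ([set A | e / 2 / N <= cabs (h A)] `|` [set A | e / 2 <= cabs (k A)]); split.
    by apply: compactU; apply: C0_compact => //; rewrite ?divr_gt0.
  move=> A hA; have [hk|hk] := leP (e / 2) (cabs (k A)); first by right.
  left=> /=; rewrite ler_pdivrMr //.
  have := cabsD (c * h A) (k A); rewrite cabsM => h2.
  have h3 : cabs c * cabs (h A) <= cabs (h A) * N by rewrite mulrC ler_wpM2l ?cabs_ge0 // /N; lra.
  lra.
Qed.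

Lemma C0_conj h : C0 Y h -> C0 Y (fun A => ((h A)^* : Cplx R)).
Proof.
move=> Ch; apply: C0_intro => [A nA|A|e e0].
- by rewrite (C0_out Ch nA); exact: rmorph0.
- by apply: cont_conj; exact: C0_cont.
- exists [set A | e <= cabs (h A)]; split; first exact: C0_compact.
  by move=> A; rewrite cabsJ.
Qed.

Lemma C0_lim h : (forall e : R, 0 < e -> exists2 k, C0 Y k & forall A, cabs (h A - k A) <= e) -> C0 Y h.
Proof.
move=> hk; apply: C0_intro => [A nA|A|e e0].
- apply: cabs_eq0; apply/eqP; rewrite eq_le cabs_ge0 andbT.
  by apply/ler_addgt0Pr => e /hk[k Ck /(_ A)]; rewrite (C0_out Ck nA) subr0 add0r.
- apply/cont_atP => e e0; have e3 : 0 < e / 3 by rewrite divr_gt0.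
  have [k Ck kh] := hk _ e3; have /cont_atP/(_ _ e3) := C0_cont A Ck.
  apply: filterS => B hB.
  have -> : h B - h A = (h B - k B) + (k B - k A) + (k A - h A) by ring.
  apply: (le_lt_trans (cabsD _ _)); have := cabsD (h B - k B) (k B - k A).
  by have := kh A; have := kh B; rewrite [cabs (h A - _)]cabsB; lra.
- have e2 : 0 < e / 2 by rewrite divr_gt0.
  have [k Ck kh] := hk _ e2; exists [set A | e / 2 <= cabs (k A)].
  split; first exact: C0_compact.
  move=> A /= hA; have := kh A; have := cabsD (h A - k A) (k A); rewrite subrK; lra.
Qed.

Lemma single_unit x : Y (single x) <-> U0 x.
Proof.
split=> [/(fell_unitsP tG etG hX)[u uu]|ux].
  by rewrite singleE /= => <-.
by apply/(fell_unitsP tG etG hX); exists x => //; rewrite singleE.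
Qed.

(** Singletons of units are dense in [fell_units] by its definition as a closure; this lemma and
    [C0_le] reduce identities and bounds on HG to units of [G]. *)
Lemma C0_eq h k : C0 Y h -> C0 Y k -> (forall x, U0 x -> h (single x) = k (single x)) -> h = k.
Proof.
move=> Ch Ck hk; apply/funext => A; have [YA|nA] := pselect (Y A); last first.
  by rewrite (C0_out Ch nA) (C0_out Ck nA).
apply: (closure_eq YA (C0_cont A Ch) (C0_cont A Ck)) => B [x ux eB].
by rewrite (single_eq hX eB); exact: hk.
Qed.

Lemma C0_le h (M : R) : C0 Y h -> 0 <= M -> (forall x, U0 x -> cabs (h (single x)) <= M) ->
  forall A, cabs (h A) <= M.
Proof.
move=> Ch M0 hM A; have [YA|nA] := pselect (Y A); last by rewrite (C0_out Ch nA) cabs0.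
apply: (closure_le YA (C0_cont A Ch)) => B [x ux eB].
by rewrite (single_eq hX eB); exact: hM.
Qed.

Lemma restrE f x : restr U0 f x = if pselect (U0 x) then f x else 0.
Proof.
rewrite /restr /patch; case: pselect => [ux|nx]; first by rewrite mem_set.
by rewrite memNset.
Qed.

Lemma resS_out h x : C0 Y h -> ~ U0 x -> resS h x = 0.
Proof. by move=> Ch nx; apply: (C0_out Ch) => /single_unit. Qed.

(** A summand need not be continuous on the units, but it is continuous on the open set [V] and zero
    elsewhere. The preimage of an open set is thus relatively open, or, if the set contains 0, the
    union of a relatively open set with the complement of [V]. *)
Lemma Cc_restr_bounded_borel : restr U0 @` @Cc_span R G `<=` @bounded_borel R G U0.
Proof.
have [_ b0 bZD _ _] := @bounded_borel_algebra R G U0.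
move=> _ [f /(Cc_spanP tG etG hU hX) bf <-]; elim: bf => [|V f1 f2 bV Cf1 _ IH].
  rewrite (_ : restr _ _ = fun=> 0) //; apply/funext => x.
  by rewrite restrE; case: pselect.
rewrite (_ : restr _ _ = fun x => 1 * restr U0 f1 x + restr U0 f2 x); last first.
  apply/funext => x; rewrite !restrE.
  by case: pselect => [ux|nx] /=; rewrite ?mul1r ?mulr0 ?addr0.
apply: bZD => //; have oV := bisection_open bV.
have [M [_ hM]] := Cc_on_bounded oV (bisection_hausdorff tG etG hU bV) Cf1.
apply/bounded_borelP; split.
- by move=> x nx; rewrite restrE; case: pselect.
- exists M => x; rewrite restrE; case: pselect => [ux|nx] /=; first exact: hM.
  by rewrite cabs0; apply: le_trans (hM x); exact: cabs_ge0.
- move=> W oW.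
  have oVW : open (V `&` f1 @^-1` W).
    rewrite openE => x [Vx Wx]; have [cf] := Cc_on_continuous oV Cf1 Vx.
    by apply: filterI; [exact: open_nbhs_nbhs|apply: cf; exact: open_nbhs_nbhs].
  have f0 := Cc_on_out Cf1.
  have [W0|nW0] := pselect (W 0).
    rewrite (_ : _ `&` _ = (U0 `&` (V `&` f1 @^-1` W)) `|` (U0 `\` (U0 `&` V))).
      apply: borelU2; first exact: borel_open.
      by apply: borelC; exact: borel_open.
    rewrite eqEsubset; split=> x.
      move=> [ux]; rewrite /= restrE; case: pselect => // ux' Wx.
      have [Vx|nV] := pselect (V x); first by left.
      by right; split=> // -[].
    move=> [[ux [Vx Wx]]|[ux nx]]; split=> //=; rewrite restrE; case: pselect => //= _.
    by rewrite f0 // => Vx; apply: nx.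
  rewrite (_ : _ `&` _ = U0 `&` (V `&` f1 @^-1` W)); first exact: borel_open.
  rewrite eqEsubset; split=> x.
    move=> [ux]; rewrite /= restrE; case: pselect => // ux' Wx; split=> //; split=> //.
    by apply: contrapT => /f0 e; apply: nW0; rewrite -e.
  by move=> [ux [Vx Wx]]; split=> //=; rewrite restrE; case: pselect.
Qed.

Lemma algD_Cstar : Cstar_subalgebra_fun (bounded_borel U0) D.
Proof. exact: smallest_Cstar_subalgebra Cc_restr_bounded_borel. Qed.

Lemma algD_gen f : Cc_span f -> D (restr U0 f).
Proof. by move=> Cf B [_]; apply; exists f. Qed.

Lemma algD0 : D (fun=> 0). Proof. by have [] := algD_Cstar. Qed.

Lemma algD_ZD (c : Cplx R) f g : D f -> D g -> D (fun x => c * f x + g x).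
Proof. by have [_ _ h _ _] := algD_Cstar; exact: h. Qed.

Lemma algD_mul f g : D f -> D g -> D (fun x => f x * g x).
Proof. by have [_ _ _ h _] := algD_Cstar; move=> Df Dg; case: (h f g Df Dg). Qed.

Lemma algD_lim f : (forall e : R, 0 < e -> exists2 g, D g & forall x, cabs (f x - g x) <= e) -> D f.
Proof.
have [_ _ _ _ h] := algD_Cstar; move=> hf; apply: h => e /hf[g Dg hg]; exists g => // x.
by rewrite -cabs_le.
Qed.

Definition chiY : H -> Cplx R := restr Y (fun=> 1).

Lemma chiY_in A : Y A -> chiY A = 1.
Proof. by move=> YA; rewrite /chiY /restr /patch mem_set. Qed.

Lemma chiY_out A : ~ Y A -> chiY A = 0.
Proof. by move=> YA; rewrite /chiY /restr /patch memNset. Qed.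

Lemma chiY_cont A : cont_at chiY A.
Proof.
have [YA|nA] := pselect (Y A).
  apply: (@cont_near_eq _ _ _ (fun=> 1)); last exact: cont_const.
  have nY : nbhs A Y by apply: open_nbhs_nbhs; split=> //; exact: (fell_units_open tG etG hX).
  by apply: filterS nY => B; exact: chiY_in.
apply: (@cont_near_eq _ _ _ (fun=> 0)); last exact: cont_const.
have nY : nbhs A (~` Y).
  by apply: open_nbhs_nbhs; split=> //; apply: closed_openC; exact: fell_units_closed.
by apply: filterS nY => B; exact: chiY_out.
Qed.

Lemma CcY_chiY F : CcH F -> CcY o (fun A => F A * chiY A).
Proof.
move=> CF; split; first by apply: (CcHM hX) => // A; exact: chiY_cont.
by move=> A nA; rewrite chiY_out // mulr0.
Qed.

Lemma resS_extS f : resS (extS f) = f.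
Proof. by apply/funext => x; rewrite /resS (extS_single f (singleE hX x)). Qed.

Lemma resS_chiY F x : resS (fun A => F A * chiY A) x = restr U0 (resS F) x.
Proof.
rewrite restrE /resS; case: pselect => [/single_unit ux|nx] /=.
  by rewrite chiY_in // mulr1.
by rewrite chiY_out ?mulr0 // => /single_unit.
Qed.

(** Uniform estimates at units pass to all of HG by density, so a sequence that is uniformly Cauchy
    there has a uniform limit in C_0. *)
Lemma C0_limit_exists (u : nat -> H -> Cplx R) (f : G -> Cplx R) :
  (forall n, C0 Y (u n)) -> (forall n x, cabs (f x - resS (u n) x) <= n.+1%:R^-1) ->
  exists2 h, C0 Y h & resS h = f.
Proof.
move=> Cu hu.
have uu n m A : cabs (u n A - u m A) <= n.+1%:R^-1 + m.+1%:R^-1.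
  have -> : u n A - u m A = (-1) * u m A + u n A by ring.
  apply: (C0_le (h := fun A => (-1) * u m A + u n A)).
  - exact: C0_ZD.
  - by rewrite addr_ge0 // invr_ge0.
  - move=> x _.
    have -> : (-1) * u m (single x) + u n (single x) =
      (f x - resS (u m) x) - (f x - resS (u n) x) by rewrite /resS; ring.
    by apply: (le_trans (cabsD _ _)); rewrite cabsN addrC lerD.
have small (e : R) : 0 < e -> exists N : nat, forall n, (N <= n)%N -> n.+1%:R^-1 < e.
  move=> /invn_lt[N hN]; exists N => n Nn; apply: le_lt_trans hN.
  by rewrite lef_pV2 ?posrE // ler_nat ltnS.
have lim A : exists l, forall e : R, 0 < e -> exists N, forall n, (N <= n)%N -> cabs (u n A - l) < e.
  apply: cplx_complete => e e0; have e2 : 0 < e / 2 by rewrite divr_gt0.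
  have [N hN] := small _ e2; exists N => m n Nm Nn.
  apply: (le_lt_trans (uu m n A)); have := hN m Nm; have := hN n Nn.
  by set a := m.+1%:R^-1; set b := n.+1%:R^-1; lra.
pose h A := projT1 (cid (lim A)).
have hh A : forall e : R, 0 < e -> exists N, forall n, (N <= n)%N -> cabs (u n A - h A) < e.
  by rewrite /h; case: cid.
(* The factor 2 comes from an intermediate index [m >= n], whose error is at most that of [n]. *)
have hun n A : cabs (h A - u n A) <= 2 * n.+1%:R^-1.
  apply/ler_addgt0Pr => e e0; have [N hN] := hh A e e0.
  pose m := maxn N n; have := hN m (leq_maxl _ _); rewrite cabsB => h1.
  have h2 := uu m n A.
  have h3 : m.+1%:R^-1 <= n.+1%:R^-1 :> R.
    by rewrite lef_pV2 ?posrE // ler_nat ltnS leq_maxr.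
  have -> : h A - u n A = (h A - u m A) + (u m A - u n A) by ring.
  apply: (le_trans (cabsD _ _)); move: h2 h3; set a := m.+1%:R^-1; set b := n.+1%:R^-1.
  by move=> h2 h3; lra.
exists h.
  apply: C0_lim => e e0; have e2 : 0 < e / 2 by rewrite divr_gt0.
  have [n hn] := invn_lt e2; exists (u n) => // A; apply: (le_trans (hun n A)).
  by move: hn; set a := n.+1%:R^-1; lra.
apply/funext => x; apply/eqP; rewrite -subr_eq0; apply/eqP/cabs_eq0/eqP.
rewrite eq_le cabs_ge0 andbT; apply/ler_addgt0Pr => e e0; rewrite add0r.
have e3 : 0 < e / 3 by rewrite divr_gt0.
have [n hn] := invn_lt e3.
have -> : resS h x - f x = (h (single x) - u n (single x)) - (f x - resS (u n) x).
  by rewrite /resS; ring.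
apply: (le_trans (cabsD _ _)); rewrite cabsN.
have := hun n (single x); have := hu n x; move: hn.
by set a := n.+1%:R^-1; lra.
Qed.

(* The functions in D that extend to HG form a C*-subalgebra containing the generators. *)
Lemma algD_ext f : D f -> exists2 h, C0 Y h & resS h = f.
Proof.
have [D1 D2 D3 D4 D5] := algD_Cstar.
pose M := D `&` [set f | exists2 h, C0 Y h & resS h = f].
have GM : restr U0 @` @Cc_span R G `<=` M.
  move=> _ [g Cg <-]; split; first exact: algD_gen.
  exists (fun A => extS g A * chiY A).
    by apply: CcY_C0; apply: CcY_chiY; exact: (extS_Cc_span tG etG hU hX).
  by apply/funext => x; rewrite resS_chiY resS_extS.
have CM : Cstar_subalgebra_fun (bounded_borel U0) M.
  split.
  - by move=> g [/D1].
  - by split=> //; exists (fun=> 0); [exact: C0_zero|].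
  - move=> c g g' [Dg [h Ch eh]] [Dg' [k Ck ek]]; split; first exact: D3.
    by exists (fun A => c * h A + k A); [exact: C0_ZD|rewrite -eh -ek].
  - move=> g g' [Dg [h Ch eh]] [Dg' [k Ck ek]]; have [D4a D4b] := D4 g g' Dg Dg'.
    split; split=> //.
      exists (fun A => h A * k A); last by rewrite -eh -ek.
      have [N [_ hN]] := C0_bounded Ck.
      by apply: C0_mul => [//|A|]; [exact: C0_cont|exists N].
    by exists (fun A => (h A)^*); [exact: C0_conj|rewrite -eh].
  - move=> g hg; split; first by apply: D5 => e /hg[g' [Dg' _] h']; exists g'.
    have ex n : exists u, C0 Y u /\ forall x, cabs (g x - resS u x) <= n.+1%:R^-1.
      have [|g' [_ [u Cu eu]] h'] := hg n.+1%:R^-1; first by rewrite invr_gt0.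
      by exists u; split=> // x; rewrite cabs_le eu.
    apply: (@C0_limit_exists (fun n => projT1 (cid (ex n)))) => n; by case: cid => u [].
by move=> Df; have [_] := Df M (conj CM GM).
Qed.

(** The functions whose restriction to the units is known to lie in D before D is identified with
    C_0; they will approximate C_0 functions. *)
Definition algA k := CcH k /\ D (restr U0 (resS k)).

Lemma algA_ext f : Cc_span f -> algA (extS f).
Proof.
move=> Cf; split; first exact: (extS_Cc_span tG etG hU hX).
by rewrite resS_extS; exact: algD_gen.
Qed.

Lemma algA_ZD (c : Cplx R) h k : algA h -> algA k -> algA (fun A => c * h A + k A).
Proof.
move=> [Ch Dh] [Ck Dk]; split; first exact: (CcHZD hX).
rewrite (_ : restr _ _ = fun x => c * restr U0 (resS h) x + restr U0 (resS k) x).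
  exact: algD_ZD.
by apply/funext => x; rewrite !restrE; case: pselect => //= _; rewrite mulr0 addr0.
Qed.

Lemma algA_mul h k : algA h -> algA k -> algA (fun A => h A * k A).
Proof.
move=> [Ch Dh] [Ck Dk]; split; first by apply: (CcHM hX) => // A; exact: CcH_cont.
rewrite (_ : restr _ _ = fun x => restr U0 (resS h) x * restr U0 (resS k) x).
  exact: algD_mul.
by apply/funext => x; rewrite !restrE; case: pselect => //= _; rewrite mulr0.
Qed.

(** [N] and [S] are recorded because both [t] and [1 - t] will serve: [t] vanishes unless [S] is
    hit, while [1 - t] is 1 where [S] is missed and 0 where [N] is hit. *)
Lemma fell_bump x (U : set G) : open U -> U x -> exists t : H -> R,
  [/\ forall B, 0 <= t B <= 1, algA (fun B => (t B)%:C),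
    exists N, [/\ open N, N x & forall B, hit N B -> t B = 1] &
    exists S, [/\ compact S, S `<=` U & forall B, ~ hit S B -> t B = 0]].
Proof.
move=> oU Ux.
have [V [k [bV sVU Ck k01 [N [oN Nx sN kN]]]]] :=
  extS_bump R tG etG hU hX (single_in hX x) oU Ux.
have oV := bisection_open bV; have hV := bisection_hausdorff tG etG hU bV.
have /(Cc_onP _ oV hV)[S [cS sSV k0 _]] := Ck.
have ext_t B : exists2 t : R, 0 <= t <= 1 & extS k B = t%:C.
  have [[y [By Vy]]|nB] := pselect (hit V B).
    have -> : extS k B = k y.
      exact: (extS_in tG etG hU (fun x y => @bis_r_inj G o V x y bV) (Cc_on_out Ck) By Vy).
    exact: k01.
  exists 0; first by rewrite lexx ler01.
  by apply: (extS_out (Cc_on_out Ck)) => y By Vy; apply: nB; exists y.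
pose t B := projT1 (cid2 (ext_t B)).
have t01 B : 0 <= t B <= 1 by rewrite /t; case: cid2.
have tE B : extS k B = (t B)%:C by rewrite /t; case: cid2.
have eqt : (fun B => (t B)%:C) = extS k by apply/funext => B; rewrite tE.
have injC (a b : R) : a%:C = b%:C :> Cplx R -> a = b by move=> [].
exists t; split=> //.
- by rewrite eqt; apply: algA_ext; exact: (Cc_span_bis tG etG hU hX bV Ck).
- by exists N; split=> // B /kN; rewrite tE => /injC.
- exists S; split=> //; first exact: subset_trans sVU.
  move=> B nB; apply: injC; rewrite -tE.
  by apply: (extS_out k0) => y By Sy; apply: nB; exists y.
Qed.

(* No Stone-Weierstrass argument is needed: products of the functions [ext f] and
   [1 - ext f] are Urysohn functions for the subbasic sets of the Fell topology. *)
Lemma fell_urysohn A (M : set H) : nbhs A M -> exists t : H -> R,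
  [/\ forall B, 0 <= t B <= 1, algA (fun B => (t B)%:C),
    \forall B \near A, t B = 1 & forall B, t B <> 0 -> M B].
Proof.
(* The sets [M] that admit such a function form a filter, by taking products; so only the two tests
   of [fellH_cvg_lc] remain. *)
pose FF : set_system H := [set M | exists t : H -> R,
  [/\ forall B, 0 <= t B <= 1, algA (fun B => (t B)%:C),
    \forall B \near A, t B = 1 & forall B, t B <> 0 -> M B]].
have [x0 Ax0] := fset_of_neq0 A.
have FT : FF setT.
  have [t [t01 At [N [oN Nx tN]] _]] := fell_bump openT (I : setT x0).
  by exists t; split=> //; apply: filterS (fellH_nbhs_hit oN Nx Ax0) => B; exact: tN.
have fF : Filter FF.
  split=> //.
  - move=> P Q [t [t01 At t1 tP]] [t' [t01' At' t1' tQ]].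
    exists (fun B => t B * t' B); split.
    + move=> B; have /andP[a0 a1] := t01 B; have /andP[b0 b1] := t01' B.
      by rewrite mulr_ge0 // mulr_ile1.
    + rewrite (_ : (fun B => _) = fun B => (t B)%:C * (t' B)%:C); first exact: algA_mul.
      by apply/funext => B; exact: rmorphM.
    + by apply: filterS (filterI t1 t1') => B [-> ->]; rewrite mulr1.
    + move=> B h; split; [apply: tP|apply: tQ] => e; apply: h; by rewrite e ?mul0r ?mulr0.
  - by move=> P Q sPQ [t [h1 h2 h3 h4]]; exists t; split=> // B /h4/sPQ.
suff : FF --> A by move=> h; exact: h.
apply: fellH_cvg_lc => [x V oV Vx Ax|x nAx].
  have [t [t01 At [N [oN Nx tN]] [S [cS sSV tS]]]] := fell_bump oV Vx.
  exists t; split=> //; first by apply: filterS (fellH_nbhs_hit oN Nx Ax) => B; exact: tN.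
  move=> B tB; apply: contrapT => nB; apply: tB; apply: tS => -[y [By /sSV Vy]].
  by apply: nB; exists y.
have oC : open (~` fset_of A) by apply: closed_openC; exact: fset_of_closed.
have [t [t01 At [N [oN Nx tN]] [S [cS sSA tS]]]] := fell_bump oC nAx.
(* [1 - t] need not have compact support; the factor [p], equal to 1 near [A], cuts it off. *)
have [p [p01 Ap p1 _]] := FT.
exists N; split=> //; exists (fun B => p B * (1 - t B)); split.
- move=> B; have /andP[a0 a1] := t01 B; have /andP[b0 b1] := p01 B.
  by rewrite mulr_ge0 ?subr_ge0 // mulr_ile1 ?subr_ge0 // gerBl.
- rewrite (_ : (fun B => _) = fun B => (-1) * ((p B)%:C * (t B)%:C) + (p B)%:C).
    by apply: algA_ZD => //; exact: algA_mul.
  by apply/funext => B; rewrite rmorphM rmorphB /= rmorph1; ring.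
- have nS : nbhs A (miss S).
    apply: open_nbhs_nbhs; split; first exact: open_miss.
    by apply/missP => y Ay /sSA.
  apply: filterS (filterI p1 nS) => B [-> BS]; rewrite tS ?subr0 ?mulr1 // => -[y [By Sy]].
  exact: ((missP _ _).1 BS y By Sy).
- by move=> B h hN; apply: h; rewrite tN // subrr mulr0.
Qed.

(** The recursion [t c + (1 - t) k] averages the values [c] of [h] at finitely many centres with
    total weight [1 - q], where [q] is the product of the factors [1 - t]. No normalisation is
    required: [q] is 0 where [cabs (h A) >= e], and elsewhere the missing part [q h] is at most
    [e q]. *)
Lemma C0_approx h (e : R) : C0 Y h -> 0 < e ->
  exists2 k, algA k & forall A, Y A -> cabs (h A - k A) <= e.
Proof.
move=> Ch e0.
pose ok (tc : (H -> R) * Cplx R) := [/\ forall B, 0 <= tc.1 B <= 1,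
  algA (fun B => (tc.1 B)%:C) & forall B, tc.1 B <> 0 -> cabs (tc.2 - h B) <= e].
have [A SA|l [okl hl]] := @compact_list_cover H _ ok (fun tc B => tc.1 B = 1) _ (C0_compact Ch e0).
  have /cont_atP/(_ e e0) nM := C0_cont A Ch.
  have [t [t01 At t1 tM]] := fell_urysohn nM.
  exists (t, h A) => //; split=> // B /= /tM /=; rewrite cabsB; exact: ltW.
have [k [Ak [q [q01 qk q0]]]] : exists k, algA k /\ exists q : H -> R,
    [/\ forall B, 0 <= q B <= 1, forall B, cabs (k B - h B * (1 - q B)%:C) <= e * (1 - q B) &
     forall B, (exists2 tc, List.In tc l & tc.1 B = 1) -> q B = 0].
  have A0 : algA (fun=> 0).
    split; first exact: CcH0.
    rewrite (_ : restr _ _ = fun=> 0); first exact: algD0.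
    by apply/funext => x; rewrite restrE; case: pselect.
  elim: l okl {hl} => [|[t c] l IH] okl.
    exists (fun=> 0); split=> //; exists (fun=> 1); split.
    - by move=> B; rewrite ler01 lexx.
    - by move=> B; rewrite subrr mulr0 subrr cabs0 mulr0.
    - by move=> B [tc []].
  have [|k [Ak [q [q01 qk q0]]]] := IH; first by move=> tc tcl; apply: okl; right.
  have [/= t01 At tc] := okl (t, c) (or_introl erefl).
  exists (fun B => (-1) * ((t B)%:C * k B) + (c * (t B)%:C + k B)); split.
    by apply: algA_ZD; [exact: algA_mul|exact: algA_ZD].
  exists (fun B => (1 - t B) * q B); split.
  - move=> B; have /andP[a0 a1] := t01 B; have /andP[b0 b1] := q01 B.
    by rewrite mulr_ge0 ?subr_ge0 // mulr_ile1 ?subr_ge0 // gerBl.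
  - move=> B; have /andP[a0 a1] := t01 B; have /andP[b0 b1] := q01 B.
    have -> : (-1) * ((t B)%:C * k B) + (c * (t B)%:C + k B) - h B * (1 - (1 - t B) * q B)%:C =
        (t B)%:C * (c - h B) + (1 - t B)%:C * (k B - h B * (1 - q B)%:C).
      by rewrite !(rmorphB, rmorphM, rmorph1) /=; ring.
    apply: (le_trans (cabsD _ _)); rewrite !cabsM !cabs_real ger0_norm // ger0_norm ?subr_ge0 //.
    have -> : e * (1 - (1 - t B) * q B) = t B * e + (1 - t B) * (e * (1 - q B)) by ring.
    apply: lerD; last by apply: ler_wpM2l; rewrite ?subr_ge0.
    have [->|/eqP tB] := eqVneq (t B) 0; first by rewrite !mul0r.
    by apply: ler_wpM2l => //; exact: tc.
  - move=> B [tc' [<- /= ->|tcl tc1]]; first by rewrite subrr mul0r.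
    by rewrite q0 ?mulr0 //; exists tc'.
exists k => // A _.
have /andP[b0 b1] := q01 A.
have -> : h A - k A = h A * (q A)%:C - (k A - h A * (1 - q A)%:C).
  by rewrite rmorphB rmorph1 /=; ring.
apply: (le_trans (cabsD _ _)); rewrite cabsN cabsM cabs_real ger0_norm //.
have hq := qk A; have [/hl/q0 q0A|hA] := leP e (cabs (h A)).
  have h1 : e * (1 - q A) = e by rewrite q0A subr0 mulr1.
  have h2 : cabs (h A) * q A = 0 by rewrite q0A mulr0.
  by rewrite h1 in hq; rewrite h2 add0r.
have := ler_wpM2r b0 (ltW hA); lra.
Qed.

Lemma resS_algD h : C0 Y h -> D (resS h).
Proof.
move=> Ch; apply: algD_lim => e e0; have [k [_ Dk] hk] := C0_approx Ch e0.
exists (restr U0 (resS k)) => // x; rewrite restrE; case: pselect => /= [ux|nx].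
  by apply: hk; apply/single_unit.
by rewrite subr0 resS_out // cabs0 ltW.
Qed.

Lemma ext_DE h : C0 Y h -> ext_D o (resS h) = h.
Proof.
move=> Ch; rewrite /ext_D; case: xgetP => [k _ [Ck hk]|/(_ h)[]]; last first.
  by split=> // x A _ eA; rewrite (single_eq hX eA).
by apply: C0_eq => // x ux; rewrite (hk x (single x) ux (singleE hX x)).
Qed.

Lemma ext_D_C0 f : D f -> C0 Y (ext_D o f).
Proof. by move=> /algD_ext[h Ch <-]; rewrite ext_DE. Qed.

Lemma resS_ext_D f : D f -> resS (ext_D o f) = f.
Proof. by move=> /algD_ext[h Ch <-]; rewrite ext_DE. Qed.

End VanishingAtInfinity.

(** * Hilbert modules *)

(* [complex_scope] and [ring_scope] parse [_^*] differently; the constants are convertible. *)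
Lemma nconjM (R : realType) (z w : Cplx R) : ((z * w)^*)%R = z^* * w^*.
Proof. exact: rmorphM. Qed.

Lemma nconjD (R : realType) (z w : Cplx R) : ((z + w)^*)%R = z^* + w^*.
Proof. exact: rmorphD. Qed.

Lemma nconjB (R : realType) (z w : Cplx R) : ((z - w)^*)%R = z^* - w^*.
Proof. exact: rmorphB. Qed.

Lemma nconjK (R : realType) (z : Cplx R) : ((z^*)^*)%R = z.
Proof. exact: conjCK. Qed.

Section HilbertModules.
Variables (R : realType) (P : Type) (A : set (P -> Cplx R)).
Hypothesis bA : forall a, A a -> exists M : R, forall p, cabs (a p) <= M.
Variable E : hilbert_module A.
Local Notation ip := (@hm_ip R P A E).
Local Notation nrm := (@hm_norm R P A E).
Implicit Types (x y z : E) (T S : E -> E) (c : Cplx R) (p : P) (M e : R).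

Lemma ip_in x y : A (ip x y).
Proof. by have [h _ _ _ _] := hm_ip_axioms E. Qed.

Lemma ip_lin c x y z p : ip x (c *: y + z) p = c * ip x y p + ip x z p.
Proof. by have [_ h _ _ _] := hm_ip_axioms E. Qed.

Lemma ip_sym x y p : ip y x p = ((ip x y p)^*)%R.
Proof. by have [_ _ h _ _] := hm_ip_axioms E. Qed.

Lemma ip_def x : (forall p, ip x x p = 0) -> x = 0.
Proof. by have [_ _ _ _ h] := hm_ip_axioms E; exact: h. Qed.

Lemma ip0 x p : ip x 0 p = 0.
Proof.
have := ip_lin (-1) x 0 0 p; rewrite scaler0 addr0 => ->; ring.
Qed.

Lemma ipD x y z p : ip x (y + z) p = ip x y p + ip x z p.
Proof. by have := ip_lin 1 x y z p; rewrite scale1r mul1r. Qed.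

Lemma ipZ c x y p : ip x (c *: y) p = c * ip x y p.
Proof. by have := ip_lin c x y 0 p; rewrite addr0 ip0 addr0. Qed.

Lemma ipB x y z p : ip x (y - z) p = ip x y p - ip x z p.
Proof. by rewrite ipD -scaleN1r ipZ; ring. Qed.

Lemma ip_linl c x y z p : ip (c *: y + z) x p = c^* * ip y x p + ip z x p.
Proof. by rewrite ip_sym ip_lin nconjD nconjM -!ip_sym. Qed.

Lemma ip0l x p : ip 0 x p = 0.
Proof. by rewrite ip_sym ip0; exact: rmorph0. Qed.

Lemma ipDl x y z p : ip (y + z) x p = ip y x p + ip z x p.
Proof. by rewrite ip_sym ipD nconjD -!ip_sym. Qed.

Lemma ipBl x y z p : ip (y - z) x p = ip y x p - ip z x p.
Proof. by rewrite ip_sym ipB nconjB -!ip_sym. Qed.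

Lemma ip_inj x y : (forall z p, ip x z p = ip y z p) -> x = y.
Proof.
move=> h; apply/eqP; rewrite -subr_eq0; apply/eqP; apply: ip_def => p.
by rewrite ipBl h subrr.
Qed.

Lemma ip_self x p : ip x x p = (cabs (ip x x p))%:C.
Proof. by rewrite -cabsE ger0_norm //; have [_ _ _ h _] := hm_ip_axioms E. Qed.

(** For fixed [p] the inner product is a scalar semidefinite form, so the scalar argument applies
    pointwise. *)
Lemma Cauchy_Schwarz_sqr x y p :
  cabs (ip x y p) ^+ 2 <= cabs (ip x x p) * cabs (ip y y p).
Proof.
set a := cabs (ip x x p); set b := cabs (ip y y p); set n := cabs (ip x y p).
(* Positivity at [w *: y + x], with [w] a real multiple of the conjugate inner product, gives a real
   quadratic in [t]. *)
have main (t : R) : 0 <= t ^+ 2 * n ^+ 2 * b - 2 * t * n ^+ 2 + a.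
  pose w := - t%:C * (ip x y p)^*.
  suff <- : cabs (ip (w *: y + x) (w *: y + x) p) = t ^+ 2 * n ^+ 2 * b - 2 * t * n ^+ 2 + a.
    exact: cabs_ge0.
  apply: (fmorph_inj (real_complex R)); rewrite /= -ip_self ip_lin !ip_linl.
  have ew : (w^*)%R = - t%:C * ip x y p.
    rewrite /w nconjM nconjK; congr (_ * _).
    by rewrite -[- t%:C]rmorphN /=; exact: conjc_real.
  have hn : (ip x y p)^* * ip x y p = (n ^+ 2)%:C by rewrite mul_conj.
  rewrite ew [ip y x p]ip_sym (ip_self x) (ip_self y) -/a -/b /w.
  have -> : t ^+ 2 * n ^+ 2 * b - 2 * t * n ^+ 2 + a =
      t * (t * (n ^+ 2 * b)) + (- t * n ^+ 2 + (- t * n ^+ 2 + a)) by ring.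
  have cM (u v : R) : ((u * v)%:C : Cplx R) = u%:C * v%:C := rmorphM _ u v.
  have cD (u v : R) : ((u + v)%:C : Cplx R) = u%:C + v%:C := rmorphD _ u v.
  have cN (u : R) : ((- u)%:C : Cplx R) = - u%:C := rmorphN _ u.
  by move: hn; move: (n ^+ 2) => N hn; rewrite !(cD, cM, cN) -hn; ring.
have a0 : 0 <= a by exact: cabs_ge0.
have b0 : 0 <= b by exact: cabs_ge0.
have n0 : 0 <= n ^+ 2 by apply: sqr_ge0.
have [b00|bn] := eqVneq b 0.
  have [->|nn] := eqVneq (n ^+ 2) 0; first by rewrite mulr_ge0.
  (* For [b = 0] this [t] would give the quadratic the value -1; for [b > 0] its minimum is at
     [b^-1]. *)
  have := main ((a + 1) / (2 * n ^+ 2)); rewrite b00 mulr0.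
  have -> : 2 * ((a + 1) / (2 * n ^+ 2)) * n ^+ 2 = a + 1.
    by move: nn; move: (n ^+ 2) => N nn; field.
  lra.
have bp : 0 < b by rewrite lt_neqAle eq_sym bn.
have := main b^-1.
have -> : b^-1 ^+ 2 * n ^+ 2 * b - 2 * b^-1 * n ^+ 2 + a = (a * b - n ^+ 2) / b by field.
by rewrite pmulr_lge0 ?invr_gt0 // subr_ge0.
Qed.

Let qset x : set R := range (fun p => cabs (ip x x p)).

Lemma nrm_ge0 x : 0 <= nrm x.
Proof. exact: sqrtr_ge0. Qed.

(** Boundedness of the coefficients makes [sup] a genuine supremum. Norm estimates are reduced to
    pointwise ones through this lemma. *)
Lemma nrm_le x M : 0 <= M -> nrm x <= M <-> forall p, cabs (ip x x p) <= M ^+ 2.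
Proof.
move=> M0; have [M' hM'] := bA (ip_in x x); rewrite /hm_norm /ip_norm.
have up : has_ubound (qset x) by exists M' => _ [p _ <-].
split=> [h p|h].
  have hp : cabs (ip x x p) <= sup (qset x) by apply: ub_le_sup => //; exists p.
  apply: (le_trans hp); rewrite -[leLHS]sqr_sqrtr; first by rewrite ler_sqr ?nnegrE ?sqrtr_ge0.
  by apply: le_trans hp; exact: cabs_ge0.
rewrite -[leRHS](ger0_norm M0) -sqrtr_sqr ler_sqrt ?sqr_ge0 //.
(* The index type may be empty; the supremum of the empty range is 0. *)
have [q0|/eqP/set0P q0] := pselect (qset x = set0); last first.
  by apply: (@ge_sup _ (qset x)) => // _ [p _ <-].
by rewrite /qset in q0; rewrite q0 sup0 sqr_ge0.
Qed.

Lemma ip_self_le x p : cabs (ip x x p) <= nrm x ^+ 2.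
Proof. by apply: (nrm_le x (nrm_ge0 x)).1. Qed.

Lemma Cauchy_Schwarz x y p : cabs (ip x y p) <= nrm x * nrm y.
Proof.
rewrite -ler_sqr ?nnegrE ?mulr_ge0 ?nrm_ge0 ?cabs_ge0 // exprMn.
apply: (le_trans (Cauchy_Schwarz_sqr x y p)).
by apply: ler_pM; rewrite ?cabs_ge0 ?ip_self_le.
Qed.

Lemma nrm0 : nrm 0 = 0.
Proof.
apply/eqP; rewrite eq_le nrm_ge0 andbT; apply/nrm_le => // p.
by rewrite ip0 cabs0 expr0n.
Qed.

Lemma nrmD x y : nrm (x + y) <= nrm x + nrm y.
Proof.
apply/nrm_le => [|p]; first by rewrite addr_ge0 ?nrm_ge0.
rewrite ipD !ipDl.
have := ip_self_le x p; have := ip_self_le y p.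
have := Cauchy_Schwarz x y p; have := Cauchy_Schwarz y x p.
have := cabsD (ip x x p + ip y x p) (ip x y p + ip y y p).
have := cabsD (ip x x p) (ip y x p); have := cabsD (ip x y p) (ip y y p).
rewrite sqrrD; lra.
Qed.

Lemma nrmZ c x : nrm (c *: x) <= cabs c * nrm x.
Proof.
apply/nrm_le => [|p]; first by rewrite mulr_ge0 ?nrm_ge0 ?cabs_ge0.
rewrite ipZ ip_sym ipZ nconjM -ip_sym !cabsM cabsJ exprMn mulrA -expr2.
by apply: ler_wpM2l; rewrite ?sqr_ge0 ?ip_self_le.
Qed.

Lemma nrmN x : nrm (- x) = nrm x.
Proof.
have h y : nrm (- y) <= nrm y.
  by have := nrmZ (-1) y; rewrite scaleN1r cabsN cabs1 mul1r.
by apply/eqP; rewrite eq_le h -[leLHS]/(nrm x) -{1}[x]opprK h.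
Qed.

Lemma nrmB x y : nrm (x - y) = nrm (y - x).
Proof. by rewrite -nrmN opprB. Qed.

Lemma nrm_triangle x y z : nrm (x - z) <= nrm (x - y) + nrm (y - z).
Proof. by rewrite -(subrK y x) -addrA addrK; exact: nrmD. Qed.

Lemma nrm_eq0 x : nrm x <= 0 -> x = 0.
Proof.
move=> h; apply: ip_def => p; apply: cabs_eq0; apply/eqP.
rewrite eq_le cabs_ge0 andbT.
by have /(_ p) := (nrm_le x (lexx 0)).1 h; rewrite expr0n.
Qed.

Lemma small_eq0 (a K : R) : (forall e, 0 < e -> a <= K * e) -> a <= 0.
Proof.
move=> h; apply/ler_addgt0Pr => e e0; rewrite add0r.
have K1 : 0 < `|K| + 1 by rewrite ltr_pwDr.
apply: (le_trans (h (e / (`|K| + 1)) _)); first by rewrite divr_gt0.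
rewrite mulrA ler_pdivrMr // mulrC ler_wpM2l ?(ltW e0) //.
by apply: (le_trans (ler_norm K)); rewrite lerDl.
Qed.

Lemma adjoint_pair_sym T S : adjoint_pair T S -> adjoint_pair S T.
Proof. by move=> h x y; apply/funext => p; rewrite ip_sym -h -ip_sym. Qed.

(** [adjointable] does not include linearity; it follows by moving the operator to the other
    argument. *)
Lemma adjoint_pair_lin T S c x y : adjoint_pair T S -> T (c *: x + y) = c *: T x + T y.
Proof.
by move=> h; apply: ip_inj => z p; rewrite h !ip_linl !h.
Qed.

Lemma adjointable_lin T c x y : adjointable T -> T (c *: x + y) = c *: T x + T y.
Proof. by move=> [S h]; exact: adjoint_pair_lin h. Qed.

Lemma adjointable0 T : adjointable T -> T 0 = 0.
Proof.
move=> aT; have := adjointable_lin (-1) 0 0 aT.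
by rewrite scaler0 addr0 scaleN1r addNr.
Qed.

Lemma adjointableB T x y : adjointable T -> T (x - y) = T x - T y.
Proof. by move=> aT; rewrite addrC -scaleN1r adjointable_lin // scaleN1r addrC. Qed.

Lemma adjointable_sum T (I : Type) (s : seq I) (F : I -> E) : adjointable T ->
  T (\sum_(i <- s) F i) = \sum_(i <- s) T (F i).
Proof.
move=> aT; elim: s => [|i s IH]; first by rewrite !big_nil adjointable0.
by rewrite !big_cons -IH -{1}[F i]scale1r adjointable_lin // scale1r.
Qed.

(** Moving both operators to the other side by their adjoints leaves the error [x - y] alone in one
    argument, where Cauchy-Schwarz makes it small. *)
Lemma adjointable_eq (D : set E) T T' : (forall x e, 0 < e -> exists2 y, D y & nrm (x - y) < e) ->
  adjointable T -> adjointable T' -> (forall y, D y -> T y = T' y) -> T = T'.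
Proof.
move=> dD aT aT' h; apply/funext => x; apply/eqP; rewrite -subr_eq0; apply/eqP.
have [S hS] := aT; have [S' hS'] := aT'.
apply: ip_inj => z p; rewrite ip0l; apply: cabs_eq0; apply/eqP; rewrite eq_le cabs_ge0 andbT.
apply: (@small_eq0 _ (nrm (S z - S' z))) => e e0; have [y Dy xy] := dD x e e0.
have -> : T x - T' x = T (x - y) - T' (x - y).
  by rewrite adjointableB // adjointableB // (h y Dy) opprB addrA subrK.
rewrite ipBl hS hS' -ipB mulrC; apply: (le_trans (Cauchy_Schwarz _ _ _)).
by apply: ler_wpM2r; [exact: nrm_ge0|exact: ltW].
Qed.

Lemma the_operatorE (D : set E) (Q : set (E -> E)) T :
  (forall x e, 0 < e -> exists2 y, D y & nrm (x - y) < e) ->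
  (forall T1 T2, adjointable T1 -> adjointable T2 -> Q T1 -> Q T2 -> forall y, D y -> T1 y = T2 y) ->
  adjointable T -> Q T -> the_operator Q = T.
Proof.
move=> dD hQ aT QT; rewrite /the_operator; case: xgetP => [T' _ [aT' QT']|/(_ T)[]]; last by [].
by apply: (adjointable_eq dD) => //; exact: hQ.
Qed.

Definition op_bounded T := exists2 M, 0 <= M & forall x, nrm (T x) <= M * nrm x.

Lemma norm_closure_Cstar (B : set (E -> E)) :
  B (fun=> 0) ->
  (forall c T S, B T -> B S -> B (fun x => c *: T x + S x)) ->
  (forall T S, B T -> B S -> B (T \o S)) ->
  (forall T, B T -> exists2 S, B S & adjoint_pair T S) ->
  (forall T, B T -> op_bounded T) ->
  Cstar_subalgebra_op (norm_closure B).
Proof.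
move=> B0 BZD BM Bs Bb.
have Ba T : B T -> adjointable T by move=> /Bs[S _ h]; exists S.
have incl T : B T -> norm_closure B T.
  move=> BT; split; first exact: Ba.
  by move=> e e0; exists T => // x; rewrite subrr nrm0 mulr_ge0 ?nrm_ge0 // ltW.
have nb T : norm_closure B T -> op_bounded T.
  move=> [_ /(_ 1 ltr01)[S BS hS]]; have [M M0 hM] := Bb _ BS.
  exists (1 + M) => [|x]; first by rewrite addr_ge0.
  rewrite -(subrK (S x) (T x)) mulrDl; apply: (le_trans (nrmD _ _)).
  exact: lerD.
split.
- by move=> T [].
- exact: incl.
- move=> c T S [[T' aT] hT] [[S' aS] hS]; split.
    exists (fun x => c^* *: T' x + S' x) => x y; apply/funext => p.
    by rewrite ip_lin ip_linl aT aS.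
  move=> e e0; have c1 : 0 < cabs c + 1 by rewrite ltr_wpDl ?cabs_ge0.
  have [T1 BT1 h1] := hT _ (divr_gt0 e0 c1 : 0 < e / (cabs c + 1)).
  have e2 : 0 < e - cabs c * (e / (cabs c + 1)).
    have -> : e - cabs c * (e / (cabs c + 1)) = e / (cabs c + 1) by field; rewrite gt_eqF.
    exact: divr_gt0.
  have [S1 BS1 h2] := hS _ e2.
  exists (fun x => c *: T1 x + S1 x) => [|x]; first exact: BZD.
  have -> : c *: T x + S x - (c *: T1 x + S1 x) = c *: (T x - T1 x) + (S x - S1 x).
    by rewrite scalerBr opprD addrACA.
  apply: (le_trans (nrmD _ _)).
  have := h2 x; have := nrmZ c (T x - T1 x).
  have := ler_wpM2l (cabs_ge0 c) (h1 x); lra.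
- split.
    move=> T S nT nS; have [[T' aT] hT] := nT; have [[S' aS] hS] := nS; split.
      by exists (S' \o T') => x y; rewrite /= aT aS.
    move=> e e0; have [M M0 hM] := nb _ nT.
    have M1 : 0 < 2 * (M + 1) by rewrite mulr_gt0 // ltr_wpDl.
    have [S1 BS1 h1] := hS _ (divr_gt0 e0 M1 : 0 < e / (2 * (M + 1))).
    have [K K0 hK] := Bb _ BS1.
    have K1 : 0 < 2 * (K + 1) by rewrite mulr_gt0 // ltr_wpDl.
    (* [T1] is chosen after [S1], because its tolerance depends on the bound of [S1]. *)
    have [T1 BT1 h2] := hT _ (divr_gt0 e0 K1 : 0 < e / (2 * (K + 1))).
    exists (T1 \o S1) => [|x]; first exact: BM.
    rewrite /=; apply: (le_trans (nrm_triangle _ (T (S1 x)) _)).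
    rewrite -adjointableB; last by exists T'.
    have b1 : nrm (T (S x - S1 x)) <= M * (e / (2 * (M + 1))) * nrm x.
      by apply: (le_trans (hM _)); rewrite -mulrA ler_wpM2l.
    have b2 : nrm (T (S1 x) - T1 (S1 x)) <= e / (2 * (K + 1)) * K * nrm x.
      apply: (le_trans (h2 _)); rewrite -[leRHS]mulrA; apply: ler_wpM2l => //.
      by rewrite divr_ge0 // ltW.
    have c1 : M * (e / (2 * (M + 1))) <= e / 2.
      have -> : M * (e / (2 * (M + 1))) = e / 2 * (M / (M + 1)) by field; rewrite gt_eqF // ltr_wpDl.
      rewrite ler_piMr ?divr_ge0 ?(ltW e0) // ler_pdivrMr ?ltr_wpDl // mul1r lerDl //.
    have c2 : e / (2 * (K + 1)) * K <= e / 2.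
      have -> : e / (2 * (K + 1)) * K = e / 2 * (K / (K + 1)) by field; rewrite gt_eqF // ltr_wpDl.
      rewrite ler_piMr ?divr_ge0 ?(ltW e0) // ler_pdivrMr ?ltr_wpDl // mul1r lerDl //.
    have := ler_wpM2r (nrm_ge0 x) c1; have := ler_wpM2r (nrm_ge0 x) c2; lra.
  move=> T S [aT hT] TS; split; first by exists T; exact: adjoint_pair_sym.
  move=> e e0; have [T1 BT1 h1] := hT e e0; have [S1 BS1 TS1] := Bs _ BT1.
  exists S1 => // x; set y := S x - S1 x.
  (* The estimate for [T - T1] passes to the adjoint, since [y] paired with itself is [(T - T1) y]
     paired with [x]. *)
  have hy : nrm y ^+ 2 <= e * nrm x * nrm y.
    rewrite -[leRHS]sqr_sqrtr ?mulr_ge0 ?nrm_ge0 ?(ltW e0) // ler_sqr ?nnegrE ?nrm_ge0 ?sqrtr_ge0 //.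
    apply/nrm_le => [|p]; first exact: sqrtr_ge0.
    rewrite sqr_sqrtr ?mulr_ge0 ?nrm_ge0 ?(ltW e0) //.
    rewrite {2}/y ipB -TS -TS1 -ipBl; apply: (le_trans (Cauchy_Schwarz _ _ _)).
    by rewrite [leRHS]mulrAC ler_wpM2r ?nrm_ge0.
  have [->|ny] := eqVneq (nrm y) 0; first by rewrite mulr_ge0 ?nrm_ge0 ?(ltW e0).
  by move: hy; rewrite expr2 ler_pM2r // lt_neqAle eq_sym ny nrm_ge0.
- move=> T [aT hT]; split=> // e e0; have e2 : 0 < e / 2 by rewrite divr_gt0.
  have [S [_ hS] h1] := hT _ e2; have [S1 BS1 h2] := hS _ e2.
  exists S1 => // x; apply: (le_trans (nrm_triangle _ (S x) _)).
  have := h1 x; have := h2 x; lra.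
Qed.

End HilbertModules.

(** * Extension of maps from dense families *)

Section LipschitzExtension.
Variables (R : realType) (P Q : Type) (A : set (P -> Cplx R)) (B : set (Q -> Cplx R)).
Hypothesis bA : forall a, A a -> exists M : R, forall p, cabs (a p) <= M.
Hypothesis bB : forall a, B a -> exists M : R, forall p, cabs (a p) <= M.
Variables (E : hilbert_module A) (F : hilbert_module B).
Variables (X : Type) (e1 : X -> E) (e2 : X -> F) (M : R).
Hypothesis de : forall x (e : R), 0 < e -> exists u, hm_norm (x - e1 u) < e.

(** The dense family is indexed by [X], and [e1] may repeat values: the estimate shows that [e2]
    depends only on [e1], so no quotient has to be formed. *)
Lemma lipschitz_extension : 0 <= M ->
  (forall u v, hm_norm (e2 u - e2 v) <= M * hm_norm (e1 u - e1 v)) ->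
  exists T : E -> F, (forall u, T (e1 u) = e2 u) /\
    forall x y, hm_norm (T x - T y) <= M * hm_norm (x - y).
Proof.
move=> M0 hM.
have small (e : R) : 0 < e -> exists N : nat, forall n, (N <= n)%N -> n.+1%:R^-1 < e.
  move=> e0; have [N hN] : exists N : nat, N.+1%:R^-1 < e.
    exists (Num.truncn e^-1); rewrite invf_plt ?posrE //.
    exact: truncnS_gt.
  exists N => n Nn; apply: le_lt_trans hN.
  by rewrite lef_pV2 ?posrE // ler_nat ltnS.
(* The limit is characterised by an inequality against every [v], so later steps need not return to
   the sequence that produced it. *)
have key x : exists l, forall v, hm_norm (l - e2 v) <= M * hm_norm (x - e1 v).
  have [u hu] : exists u : nat -> X, forall n, hm_norm (x - e1 (u n)) < n.+1%:R^-1.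
    have h n : exists v, hm_norm (x - e1 v) < n.+1%:R^-1 by apply: de; rewrite invr_gt0.
    by exists (fun n => projT1 (cid (h n))) => n; case: cid.
  have sm (e : R) : 0 < e -> exists N : nat, forall n, (N <= n)%N ->
      M * hm_norm (x - e1 (u n)) < e.
    move=> e0; have M1 : 0 < M + 1 by rewrite ltr_wpDl.
    have [N hN] := small _ (divr_gt0 e0 M1 : 0 < e / (M + 1)).
    exists N => n Nn; have h1 := lt_trans (hu n) (hN n Nn).
    move: h1; rewrite ltr_pdivlMr // mulrC mulrDl mul1r; apply: le_lt_trans.
    by rewrite lerDl nrm_ge0.
  have cauchy (e : R) : 0 < e -> exists N : nat, forall m n : nat, (N <= m)%N -> (N <= n)%N ->
      ip_norm (@hm_ip _ _ _ F) (e2 (u m) - e2 (u n)) < e.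
    move=> e0; have e2' : 0 < e / 2 by rewrite divr_gt0.
    have [N hN] := sm _ e2'; exists N => m n Nm Nn.
    apply: (le_lt_trans (hM _ _)).
    have := ler_wpM2l M0 (nrm_triangle bA (e1 (u m)) x (e1 (u n))).
    rewrite (nrmB bA (e1 (u m)) x); have := hN m Nm; have := hN n Nn; lra.
  have [l hl] := hm_complete cauchy; exists l => v.
  apply/ler_addgt0Pr => e e0; have e2' : 0 < e / 2 by rewrite divr_gt0.
  have [N1 h1] := hl _ e2'; have [N2 h2] := sm _ e2'.
  pose n := maxn N1 N2; have := h1 n (leq_maxl _ _); have := h2 n (leq_maxr _ _).
  rewrite -/(hm_norm _) => k1 k2.
  apply: (le_trans (nrm_triangle bB l (e2 (u n)) (e2 v))).
  have := hM (u n) v; have := ler_wpM2l M0 (nrm_triangle bA (e1 (u n)) x (e1 v)).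
  rewrite (nrmB bA (e1 (u n)) x); move: k2; rewrite (nrmB bB _ l); lra.
pose T x := projT1 (cid (key x)).
have hT x v : hm_norm (T x - e2 v) <= M * hm_norm (x - e1 v) by rewrite /T; case: cid.
exists T; split=> [v|x y].
  apply/eqP; rewrite -subr_eq0; apply/eqP; apply: (nrm_eq0 bB).
  by apply: (le_trans (hT _ _)); rewrite subrr (nrm0 bA) mulr0.
rewrite -subr_le0; apply: (@small_eq0 _ _ (2 * M)) => e e0; have [v hv] := de x e0.
have h1 := hT x v; have h2 := hT y v; rewrite (nrmB bB) in h2.
have h3 := nrm_triangle bB (T x) (e2 v) (T y).
have h4 := ler_wpM2l M0 (nrm_triangle bA y x (e1 v)); rewrite (nrmB bA y x) in h4.
have h5 := ler_wpM2l M0 (ltW hv); lra.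
Qed.

End LipschitzExtension.

Section AdjointableExtension.
Variables (R : realType) (P : Type) (A : set (P -> Cplx R)).
Hypothesis bA : forall a, A a -> exists M : R, forall p, cabs (a p) <= M.
Variables (E : hilbert_module A) (X : Type) (em f g : X -> E) (M : R).
Hypothesis de : forall x (e : R), 0 < e -> exists u, hm_norm (x - em u) < e.

(** Both extensions exist by the Lipschitz bounds, and the adjoint relation is passed to the limit
    one argument at a time. *)
Lemma adjointable_extension : 0 <= M ->
  (forall u v, hm_norm (f u - f v) <= M * hm_norm (em u - em v)) ->
  (forall u v, hm_norm (g u - g v) <= M * hm_norm (em u - em v)) ->
  (forall u v, hm_ip (f u) (em v) = hm_ip (em u) (g v)) ->
  exists T S : E -> E, [/\ adjoint_pair T S, forall u, T (em u) = f u,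
    forall u, S (em u) = g u & forall x, hm_norm (T x) <= M * hm_norm x].
Proof.
move=> M0 hf hg fg.
have [T [Tf Tl]] := lipschitz_extension bA bA de M0 hf.
have [S [Sg Sl]] := lipschitz_extension bA bA de M0 hg.
have step1 x v p : hm_ip (T x) (em v) p = hm_ip x (g v) p.
  apply/eqP; rewrite -subr_eq0; apply/eqP; apply: cabs_eq0; apply/eqP; rewrite eq_le cabs_ge0 andbT.
  apply: (@small_eq0 _ _ (M * hm_norm (em v) + hm_norm (g v))) => e e0; have [u hu] := de x e0.
  have -> : hm_ip (T x) (em v) p - hm_ip x (g v) p =
      hm_ip (T x - T (em u)) (em v) p - hm_ip (x - em u) (g v) p.
    by rewrite ipBl ipBl Tf fg; ring.
  apply: (le_trans (cabsD _ _)); rewrite cabsN.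
  have h1 := Cauchy_Schwarz bA (T x - T (em u)) (em v) p.
  have h2 := Cauchy_Schwarz bA (x - em u) (g v) p.
  have h3 := ler_wpM2r (nrm_ge0 (em v)) (Tl x (em u)).
  have h4 := ler_wpM2l (mulr_ge0 M0 (nrm_ge0 (em v))) (ltW hu).
  have h5 := ler_wpM2r (nrm_ge0 (g v)) (ltW hu).
  move: h1 h2 h3 h4 h5; rewrite -[_ * _ * hm_norm (em v)]mulrA.
  rewrite [hm_norm (x - em u) * hm_norm (em v)]mulrC mulrA; lra.
have ad : adjoint_pair T S.
  move=> x y; apply/funext => p.
  apply/eqP; rewrite -subr_eq0; apply/eqP; apply: cabs_eq0; apply/eqP; rewrite eq_le cabs_ge0 andbT.
  apply: (@small_eq0 _ _ (hm_norm (T x) + M * hm_norm x)) => e e0; have [u hu] := de y e0.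
  have -> : hm_ip (T x) y p - hm_ip x (S y) p =
      hm_ip (T x) (y - em u) p - hm_ip x (S y - S (em u)) p.
    by rewrite ipB ipB Sg step1; ring.
  apply: (le_trans (cabsD _ _)); rewrite cabsN.
  have h1 := Cauchy_Schwarz bA (T x) (y - em u) p.
  have h2 := Cauchy_Schwarz bA x (S y - S (em u)) p.
  have h3 := ler_wpM2l (nrm_ge0 x) (Sl y (em u)).
  have h4 := ler_wpM2l (mulr_ge0 M0 (nrm_ge0 x)) (ltW hu).
  have h5 := ler_wpM2l (nrm_ge0 (T x)) (ltW hu).
  move: h1 h2 h3 h4 h5; rewrite [hm_norm x * (M * _)]mulrCA mulrA; lra.
exists T, S; split=> // x.
have T0 : T 0 = 0 by apply: adjointable0; exists S.
by have := Tl x 0; rewrite T0 !subr0.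
Qed.

End AdjointableExtension.

(** * Operators on the module of HG *)

Section ConvolutionEstimates.
Variables (R : realType) (G : topologicalType) (o : groupoid_data G).
Hypothesis gG : is_groupoid o.
Local Notation r := (grng o).
Local Notation s := (gsrc o).
Local Notation inv := (ginv o).
Local Notation "x ** y" := (gmul o x y) (at level 40, left associativity).
Implicit Types (x y z u : G) (V : set G) (f g phi : G -> Cplx R) (M : R).

Lemma conv_units_l phi g x : (forall z, ~ units o z -> phi z = 0) ->
  gconv o phi g x = phi (r x) * g x.
Proof.
move=> phi0; rewrite /gconv (@fsum_single _ _ _ _ (r x)) ?/mkset ?(g_rr gG) //.
  by rewrite (g_unit_i gG) ?(g_rx gG) //; exact: g_unit_r.
move=> z /= ez nz; rewrite phi0 ?mul0r // => /(g_unitP gG) uz; apply: nz.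
by rewrite -uz ez.
Qed.

Lemma conv_scale_r (c : Cplx R) f g g' x : fibre_finite o f ->
  gconv o f (fun y => c * g y + g' y) x = c * gconv o f g x + gconv o f g' x.
Proof.
move=> ff; rewrite (convDr _ _ _ ff); congr (_ + _).
by rewrite /gconv mulr_fsumr; apply: eq_fsbigr => z _; rewrite mulrCA.
Qed.

Lemma conv_scale_l (c : Cplx R) f f' g x : fibre_finite o f -> fibre_finite o f' ->
  gconv o (fun y => c * f y + f' y) g x = c * gconv o f g x + gconv o f' g x.
Proof.
move=> ff ff'; rewrite convDl //; last first.
  apply: (@eq_ind _ (fun y => f y * c) (fibre_finite o)).
    exact: fibre_finiteM.
  by apply/funext => y; rewrite mulrC.
by congr (_ + _); rewrite /gconv mulr_fsumr; apply: eq_fsbigr => z _; rewrite mulrA.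
Qed.

(** At a unit the convolution is the sum over a source fibre of the squared moduli of [f] weighted
    by [phi], so bounding the weight bounds the sum. *)
Lemma conv_star_weighted f phi u M : fibre_finite o f -> units o u ->
  (forall x, cabs (phi x) <= M) ->
  cabs (gconv o (star o f) (fun x => phi x * f x) u) <= M * cabs (gconv o (star o f) f u).
Proof.
move=> ff uu hphi.
have ru : r u = u by apply/(g_unitP gG).
pose S := [set z | r z = r u /\ f (inv z) <> 0].
have fS : finite_set S.
  apply: (@sub_finite_set _ _ (inv @` [set z | s z = u /\ f z <> 0])).
    move=> z [ez fz]; exists (inv z); last exact: (g_invK gG).
    by split=> //; rewrite (g_si gG) ez.
  by apply: finite_image; exact: (ff u).2.
have red k : gconv o (star o f) (fun x => k x * f x) u =
    \sum_(z <- fset_set S) ((f (inv z))^* * (k (inv z) * f (inv z))).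
  rewrite /gconv (@fsum_supp _ _ _ S).
  - rewrite fsbig_finite //; apply: eq_big_seq => z; rewrite in_fset_set // => /set_mem[ez _].
    rewrite /star; have -> // : inv z ** u = inv z.
    by rewrite -[X in _ ** X]ru -ez -(g_si gG) (g_xs gG).
  - by move=> z [].
  - move=> z /= ez nS; rewrite /star (_ : f (inv z) = 0); last first.
      by apply: contrapT => fz; apply: nS.
    by rewrite rmorph0 mul0r.
have -> : gconv o (star o f) f u = gconv o (star o f) (fun x => 1 * f x) u.
  by congr (gconv o _ _ u); apply/funext => x; rewrite mul1r.
rewrite !red.
have -> : \sum_(z <- fset_set S) ((f (inv z))^* * (1 * f (inv z))) =
    (\sum_(z <- fset_set S) cabs (f (inv z)) ^+ 2)%:C :> Cplx R.
  by rewrite rmorph_sum; apply: eq_bigr => z _; rewrite mul1r mul_conj.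
rewrite cabs_real ger0_norm; last by apply: sumr_ge0 => z _; exact: sqr_ge0.
apply: (le_trans (cabs_sum _ _ _)); rewrite mulr_sumr; apply: ler_sum => z _.
rewrite cabsM cabsM cabsJ mulrCA -expr2.
by apply: ler_wpM2r; [exact: sqr_ge0|exact: hphi].
Qed.

(** A nonzero term [star f w * f (inv w ** z)] has [inv w] and [inv w ** z] in [V] with equal
    ranges, hence equal, so [z] is a unit; injectivity of [s] leaves one such term. *)
Lemma star_conv_units V f M : (forall y z, V y -> V z -> s y = s z -> y = z) ->
  (forall y z, V y -> V z -> r y = r z -> y = z) ->
  (forall x, ~ V x -> f x = 0) -> (forall x, cabs (f x) <= M) ->
  (forall z, ~ units o z -> gconv o (star o f) f z = 0) /\
  (forall z, cabs (gconv o (star o f) f z) <= M ^+ 2).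
Proof.
move=> sV rV f0 fM.
have inV x : f x <> 0 -> V x by move=> fx; apply: contrapT => /f0.
have h z w : r w = r z -> star o f w * f (inv w ** z) <> 0 -> z = r z /\ V (inv w).
  move=> e nz; have fw : f (inv w) <> 0.
    by move=> fw; apply: nz; rewrite /star fw rmorph0 mul0r.
  have fz : f (inv w ** z) <> 0 by move=> fz; apply: nz; rewrite fz mulr0.
  have ez : inv w ** z = inv w.
    by apply: rV; [exact: inV|exact: inV|rewrite (g_rM gG) // (g_si gG)].
  split; last exact: inV.
  by rewrite -[LHS](g_iK gG e) ez (g_xi gG) e.
split=> [z nz|z].
  apply: fsbig1 => w /= e; apply: contrapT => /(h z w e)[ez _]; apply: nz.
  by rewrite ez; exact: g_unit_r.
have M0 : 0 <= M by apply: le_trans (fM z); exact: cabs_ge0.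
have [[w [e nw]]|no] := pselect (exists w, r w = r z /\ star o f w * f (inv w ** z) <> 0).
  rewrite /gconv (@fsum_single _ _ _ _ w) //; last first.
    move=> w' /= e'; apply: contra_notP => /(h z w' e')[_ Vw'].
    have [_ Vw] := h z w e nw.
    rewrite -[w'](g_invK gG) -[w](g_invK gG); congr (inv _); apply: sV => //.
    by rewrite !(g_si gG) e' e.
  rewrite cabsM /star cabsJ expr2; apply: ler_pM; rewrite ?cabs_ge0 //; exact: fM.
rewrite /gconv fsbig1 ?cabs0 ?sqr_ge0 // => w /= e.
by apply: contrapT => nw; apply: no; exists w.
Qed.

(** By associativity [f^* * f] acts on [g] first. It is supported on the units, so it multiplies [g]
    by a function of the range that is at most [M ^+ 2]. *)
Lemma conv_bisection_bound V f g u M :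
  (forall y z, V y -> V z -> s y = s z -> y = z) ->
  (forall y z, V y -> V z -> r y = r z -> y = z) ->
  (forall x, ~ V x -> f x = 0) -> (forall x, cabs (f x) <= M) ->
  fibre_finite o f -> fibre_finite o g -> units o u ->
  cabs (gconv o (star o (gconv o f g)) (gconv o f g) u) <=
    M ^+ 2 * cabs (gconv o (star o g) g u).
Proof.
move=> sV rV f0 fM ff fg uu.
have [h0 hM] := star_conv_units sV rV f0 fM.
have fsf := fibre_finite_star gG ff; have fsg := fibre_finite_star gG fg.
have -> : star o (gconv o f g) = gconv o (star o g) (star o f).
  by apply/funext => x; exact: star_conv.
rewrite (conv_assoc gG) //; last exact: fibre_finite_conv.
have -> : gconv o (star o f) (gconv o f g) = fun x => gconv o (star o f) f (r x) * g x.
  by apply/funext => x; rewrite -(conv_assoc gG) // conv_units_l.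
by apply: conv_star_weighted.
Qed.

End ConvolutionEstimates.

Section Density.
Variables (R : realType) (P : Type) (A : set (P -> Cplx R)).
Hypothesis bA : forall a, A a -> exists M : R, forall p, cabs (a p) <= M.
Variables (E : hilbert_module A) (D : set E).
Hypothesis dD : forall x (e : R), 0 < e -> exists2 y, D y & hm_norm (x - y) < e.

Lemma ip_dense_inj (x x' : E) :
  (forall y p, D y -> hm_ip x y p = hm_ip x' y p) -> x = x'.
Proof.
move=> h; apply/eqP; rewrite -subr_eq0; apply/eqP; set w := x - x'.
apply: ip_def => p; apply: cabs_eq0; apply/eqP; rewrite eq_le cabs_ge0 andbT.
apply: (@small_eq0 _ _ (hm_norm w)) => e e0; have [y Dy wy] := dD w e0.
have wy0 : hm_ip w y p = 0 by rewrite /w ipBl h // subrr.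
have -> : hm_ip w w p = hm_ip w (w - y) p by rewrite ipB wy0 subr0.
apply: (le_trans (Cauchy_Schwarz bA _ _ _)).
by apply: ler_wpM2l; [exact: nrm_ge0|exact: ltW].
Qed.

End Density.

(** * Convolution operators and the range representation on L^2(HG) *)

Section HausdorffModule.
Variables (R : realType) (G : topologicalType) (o : groupoid_data G).
Hypothesis tG : topological_groupoid o.
Hypothesis etG : etale o.
Hypothesis hU : hausdorff_space (set_type (units o)).
Hypothesis hX : locally_compact_space G.
Local Notation r := (grng o).
Local Notation s := (gsrc o).
Local Notation inv := (ginv o).
Local Notation "x ** y" := (gmul o x y) (at level 40, left associativity).
Local Notation gG := (gpdG tG).
Local Notation H := (fellH G).
Local Notation oH := (fell_groupoid o).
Local Notation RR := (grng oH).
Local Notation SS := (gsrc oH).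
Local Notation Y := (fell_units o).
Local Notation U0 := (units o).
Local Notation bis := (bisection o).
Local Notation single := (single hX).
Local Notation resS := (resS hX).
Variable E : hilbert_module (@C0 R H Y).
Variable emb : (H -> Cplx R) -> E.
Hypothesis Espec : is_L2_hausdorff oH emb.
Local Notation nrm := (@hm_norm _ _ _ E).
Local Notation LL := (L_op_hausdorff oH emb).
Local Notation RP := (range_rep oH emb).
Implicit Types (A B C : H) (f g : G -> Cplx R) (h k F K : H -> Cplx R) (T S : E -> E).

Lemma C0_bdd a : @C0 R H Y a -> exists M : R, forall p, cabs (a p) <= M.
Proof. by move=> Ca; have [M [_ hM]] := C0_bounded tG etG hX Ca; exists M. Qed.
Local Notation bE := (@C0_bdd).

Lemma embZD (c : Cplx R) F K : CcH F -> CcH K ->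
  emb (fun A => c * F A + K A) = c *: emb F + emb K.
Proof. by have [h _ _ _] := Espec; exact: h. Qed.

Lemma embB F K : CcH F -> CcH K -> emb F - emb K = emb (fun A => (-1) * K A + F A).
Proof. by move=> CF CK; rewrite embZD // scaleN1r addrC. Qed.

Lemma embD F K : CcH F -> CcH K -> emb (fun A => F A + K A) = emb F + emb K.
Proof.
move=> CF CK; rewrite -[emb F]scale1r -embZD //; congr emb.
by apply/funext => A; rewrite mul1r.
Qed.

Lemma emb0 : emb (fun=> 0) = 0.
Proof.
have := embB (@CcH0 R G) (@CcH0 R G); rewrite subrr => ->.
by congr emb; apply/funext => A; rewrite mulr0 addr0.
Qed.

Lemma emb_dense x (e : R) : 0 < e -> exists2 y, (emb @` @CcH R G) y & nrm (x - y) < e.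
Proof.
move=> e0; have [_ _ _ h] := Espec; have [F CF xF] := h x e e0.
by exists (emb F) => //; exists F.
Qed.

Lemma resS_convE F K : resS (gconv oH F K) = gconv o (resS F) (resS K).
Proof. by apply/funext => x; exact: resS_conv. Qed.

Lemma resS_starE F : resS (star oH F) = star o (resS F).
Proof. by apply/funext => x; exact: resS_star. Qed.

Lemma ip_emb F K u : CcH F -> CcH K -> U0 u ->
  hm_ip (emb F) (emb K) (single u) = gconv o (star o (resS F)) (resS K) u.
Proof.
move=> CF CK uu; have [_ -> // _ _] := Espec.
rewrite /restr /patch mem_set; last by apply/(single_unit tG etG).
by rewrite (resS_conv tG etG hU) resS_starE.
Qed.

Lemma ipH_eq (x y x' y' : E) :
  (forall u, U0 u -> hm_ip x y (single u) = hm_ip x' y' (single u)) -> hm_ip x y = hm_ip x' y'.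
Proof. by move=> h; apply: (C0_eq tG etG (hX := hX)) => //; exact: ip_in. Qed.

Lemma ipH_inj (x y : E) :
  (forall z u, U0 u -> hm_ip x z (single u) = hm_ip y z (single u)) -> x = y.
Proof.
move=> h; apply: ip_inj => z p; suff -> : hm_ip x z = hm_ip y z by [].
by apply: ipH_eq; exact: h.
Qed.

Lemma nrmH_le (x : E) (M : R) : 0 <= M ->
  (forall u, U0 u -> cabs (hm_ip x x (single u)) <= M ^+ 2) -> nrm x <= M.
Proof.
move=> M0 h; apply/(nrm_le bE) => // p.
by apply: (C0_le tG etG (hX := hX)); rewrite ?sqr_ge0 //; exact: ip_in.
Qed.

(** Common source of the range representation and of the convolution operators. The adjoint relation
    is asked only at units of [G], and [M] must bound both [m] and [m'] because both are
    extended. *)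
Lemma multiplier_op (m m' : (H -> Cplx R) -> H -> Cplx R) (M : R) : 0 <= M ->
  (forall F, CcH F -> CcH (m F) /\ CcH (m' F)) ->
  (forall (c : Cplx R) F K, CcH F -> CcH K ->
    m (fun A => c * F A + K A) = (fun A => c * m F A + m K A) /\
    m' (fun A => c * F A + K A) = (fun A => c * m' F A + m' K A)) ->
  (forall F K u, CcH F -> CcH K -> U0 u ->
    gconv o (star o (resS (m F))) (resS K) u = gconv o (star o (resS F)) (resS (m' K)) u) ->
  (forall F, CcH F -> nrm (emb (m F)) <= M * nrm (emb F) /\
                      nrm (emb (m' F)) <= M * nrm (emb F)) ->
  exists T S, [/\ adjoint_pair T S, forall F, CcH F -> T (emb F) = emb (m F),
    forall F, CcH F -> S (emb F) = emb (m' F) & forall x, nrm (T x) <= M * nrm x].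
Proof.
move=> M0 Cm lm adj bd.
have de x (e : R) : 0 < e -> exists u : {F | CcH F}, nrm (x - emb (sval u)) < e.
  by move=> /(emb_dense x)[_ [F CF <-] xF]; exists (exist _ F CF).
have lip (n : (H -> Cplx R) -> H -> Cplx R) : (forall F, CcH F -> CcH (n F)) ->
    (forall (c : Cplx R) F K, CcH F -> CcH K ->
       n (fun A => c * F A + K A) = (fun A => c * n F A + n K A)) ->
    (forall F, CcH F -> nrm (emb (n F)) <= M * nrm (emb F)) ->
    forall u v : {F | CcH F}, nrm (emb (n (sval u)) - emb (n (sval v))) <=
      M * nrm (emb (sval u) - emb (sval v)).
  move=> Cn ln bn [F CF] [K CK] /=.
  rewrite (embB (Cn _ CF) (Cn _ CK)) (embB CF CK) -ln //; apply: bn.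
  exact: (CcHZD hX).
have [||u v|T [S [TS Tm Sm bT]]] := @adjointable_extension _ _ _ bE E {F | CcH F}
    (fun u => emb (sval u)) (fun u => emb (m (sval u))) (fun u => emb (m' (sval u))) M de M0.
- apply: lip => [F /Cm[] //|c F K CF CK|F CF]; first by case: (lm c F K CF CK).
  by case: (bd F CF).
- apply: lip => [F /Cm[] //|c F K CF CK|F CF]; first by case: (lm c F K CF CK).
  by case: (bd F CF).
- case: u v => [F CF] [K CK] /=; apply: ipH_eq => u uu.
  have [CmF _] := Cm F CF; have [_ CmK] := Cm K CK.
  by rewrite !ip_emb //; exact: adj.
- exists T, S; split=> // F CF; [exact: (Tm (exist _ F CF))|exact: (Sm (exist _ F CF))].
Qed.

Lemma L_opHE F T : adjointable T -> (forall K, CcH K -> T (emb K) = emb (gconv oH F K)) -> LL F = T.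
Proof.
move=> aT hT; apply: (the_operatorE bE (D := emb @` @CcH R G)) => //; first exact: emb_dense.
by move=> T1 T2 _ _ h1 h2 _ [K CK <-]; rewrite h1 // h2.
Qed.

Lemma range_repE h T : adjointable T ->
  (forall F, CcH F -> T (emb F) = emb (fun A => h (RR A) * F A)) -> RP h = T.
Proof.
move=> aT hT; apply: (the_operatorE bE (D := emb @` @CcH R G)) => //; first exact: emb_dense.
by move=> T1 T2 _ _ h1 h2 _ [K CK <-]; rewrite h1 // h2.
Qed.

Lemma range_mul_CcH h F : C0 Y h -> CcH F -> CcH (fun A => h (RR A) * F A).
Proof.
move=> Ch CF; have -> : (fun A => h (RR A) * F A) = fun A => F A * h (RR A).
  by apply/funext => A; rewrite mulrC.
apply: (CcHM hX) => // A; apply: (cont_rng tG etG hU hX) => B.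
exact: (C0_cont tG etG hX).
Qed.

Lemma range_mul_adj h F K u : U0 u ->
  gconv o (star o (resS (fun A => h (RR A) * F A))) (resS K) u =
  gconv o (star o (resS F)) (resS (fun A => (h (RR A))^* * K A)) u.
Proof.
move=> uu; apply: eq_fsbigr => z /set_mem ez; have ez' : r z = r u := ez.
rewrite /star !resSE !(single_rng tG etG hU) (g_rM gG) ?(g_si gG) //.
by rewrite conjM mulrAC mulrC mulrA.
Qed.

Lemma range_mul_bound h F (M : R) : C0 Y h -> 0 <= M -> (forall A, cabs (h A) <= M) -> CcH F ->
  nrm (emb (fun A => h (RR A) * F A)) <= M * nrm (emb F).
Proof.
move=> Ch M0 hM CF; have CF' := range_mul_CcH Ch CF.
apply: nrmH_le => [|u uu]; first by rewrite mulr_ge0 ?nrm_ge0.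
rewrite ip_emb // range_mul_adj //.
pose phi x : Cplx R := (cabs (h (RR (single x))) ^+ 2)%:C.
rewrite [X in gconv _ _ X u](_ : _ = fun x => phi x * resS F x); last first.
  by apply/funext => x; rewrite !resSE /phi -mul_conj mulrA.
apply: (@le_trans _ _ (M ^+ 2 * cabs (gconv o (star o (resS F)) (resS F) u))).
  apply: (conv_star_weighted gG) => // [|x]; first exact: (resS_fibre_finite tG etG hU).
  rewrite /phi cabs_real ger0_norm ?sqr_ge0 // ler_sqr ?nnegrE ?cabs_ge0 //.
rewrite -ip_emb // exprMn; apply: ler_wpM2l; first exact: sqr_ge0.
exact: (ip_self_le bE).
Qed.

Lemma range_rep_spec h (M : R) : C0 Y h -> 0 <= M -> (forall A, cabs (h A) <= M) ->
  [/\ adjoint_pair (RP h) (RP (fun A => (h A)^*)),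
      forall F, CcH F -> RP h (emb F) = emb (fun A => h (RR A) * F A) &
      forall x, nrm (RP h x) <= M * nrm x].
Proof.
move=> Ch M0 hM; have Ch' := C0_conj tG etG hX Ch.
have hM' A : cabs ((h A)^* : Cplx R) <= M by rewrite cabsJ.
have [F CF|c F K CF CK|F K u CF CK uu|F CF|T [S [TS Tm Sm bT]]] :=
  @multiplier_op (fun F A => h (RR A) * F A) (fun F A => (h (RR A))^* * F A) M M0.
- by split; [exact: range_mul_CcH|exact: (range_mul_CcH Ch')].
- by split; apply/funext => A; rewrite mulrDr mulrCA.
- exact: range_mul_adj.
- by split; [exact: range_mul_bound|exact: (range_mul_bound Ch')].
have aT : adjointable T by exists S.
have aS : adjointable S by exists T; exact: adjoint_pair_sym.
by rewrite (range_repE aT Tm) (range_repE aS Sm).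
Qed.

Lemma conv_adj f g (k' : G -> Cplx R) u : fibre_finite o f -> fibre_finite o g -> fibre_finite o k' ->
  gconv o (star o (gconv o f g)) k' u = gconv o (star o g) (gconv o (star o f) k') u.
Proof.
move=> ff fg fk; have -> : star o (gconv o f g) = gconv o (star o g) (star o f).
  by apply/funext => x; exact: (star_conv gG).
by apply: (conv_assoc gG) => //; exact: (fibre_finite_star gG).
Qed.

Let ff F : CcH F -> fibre_finite o (resS F) := fun CF => resS_fibre_finite tG etG hU hX CF.

Lemma convH_scale_r (c : Cplx R) F K K' : CcH F ->
  gconv oH F (fun A => c * K A + K' A) = fun A => c * gconv oH F K A + gconv oH F K' A.
Proof.
move=> CF; apply/funext => A; apply: conv_scale_r.
exact: (CcH_fibre_finite tG etG hU hX).
Qed.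

(** [F] is any function restricting to [f], so that the bound applies to [star oH (extS f)] as well
    as to [extS f]. *)
Lemma conv_bis_bound V f F : bis V -> Cc_on V f -> resS F = f -> CcH F ->
  exists2 M : R, 0 <= M & forall K, CcH K -> nrm (emb (gconv oH F K)) <= M * nrm (emb K).
Proof.
move=> bV Cf eF CF; have [M [M0 hM]] := Cc_on_bounded (bisection_open bV)
  (bisection_hausdorff tG etG hU bV) Cf.
exists M => // K' CK; apply: nrmH_le => [|u uu]; first by rewrite mulr_ge0 ?nrm_ge0.
have CFK := CcH_conv tG etG hU hX CF CK.
rewrite ip_emb // resS_convE eF.
apply: (@le_trans _ _ (M ^+ 2 * cabs (gconv o (star o (resS K')) (resS K') u))).
  apply: (@conv_bisection_bound _ _ _ gG V) => //.
  - by move=> y z; exact: bis_s_inj.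
  - by move=> y z; exact: bis_r_inj.
  - exact: Cc_on_out.
  - by rewrite -eF; exact: ff.
  - exact: ff.
rewrite -ip_emb // exprMn; apply: ler_wpM2l; first exact: sqr_ge0.
exact: (ip_self_le bE).
Qed.

(** Convolution operators are first exhibited through this specification; [L_op_convolver] then
    shows that the choice made in [L_op_hausdorff] agrees. *)
Definition convolver F T := [/\ adjointable T, op_bounded T &
  forall K, CcH K -> T (emb K) = emb (gconv oH F K)].

Lemma convolver_bis V f : bis V -> Cc_on V f -> exists T, convolver (extS f) T.
Proof.
move=> bV Cf; have CF := extS_CcH tG etG hU hX bV Cf.
have CsF := CcH_star tG hX CF; have [bV' Cf'] := Cc_on_star tG etG hU bV Cf.
have [M1 M10 h1] := conv_bis_bound bV Cf (resS_extS hX f) CF.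
have eS : resS (star oH (extS f)) = star o f by rewrite resS_starE resS_extS.
have [M2 M20 h2] := conv_bis_bound bV' Cf' eS CsF.
(* [M1 + M2] bounds convolution by [extS f] and by its adjoint at once. *)
have [|F CF'|c F K CF' CK|F K u CF' CK uu|F CF'|T [S [TS Tm Sm bT]]] :=
  @multiplier_op (gconv oH (extS f)) (gconv oH (star oH (extS f))) (M1 + M2).
- exact: addr_ge0.
- by split; exact: (CcH_conv tG etG hU hX).
- by split; exact: convH_scale_r.
- rewrite !resS_convE resS_starE; apply: conv_adj; exact: ff.
- split.
    by apply: (le_trans (h1 _ CF')); apply: ler_wpM2r; rewrite ?nrm_ge0 ?lerDl.
  by apply: (le_trans (h2 _ CF')); apply: ler_wpM2r; rewrite ?nrm_ge0 ?lerDr.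
exists T; split=> //; first by exists S.
by exists (M1 + M2) => //; exact: addr_ge0.
Qed.

Lemma op_bounded_lin (c : Cplx R) T S : op_bounded T -> op_bounded S ->
  op_bounded (fun x => c *: T x + S x).
Proof.
move=> [M M0 hM] [M' M'0 hM']; exists (cabs c * M + M') => [|x].
  by rewrite addr_ge0 ?mulr_ge0 ?cabs_ge0.
apply: (le_trans (nrmD bE _ _)); have := nrmZ bE c (T x); have := hM' x.
by have := ler_wpM2l (cabs_ge0 c) (hM x); rewrite mulrDl -mulrA; lra.
Qed.

Lemma adjointable_linop (c : Cplx R) T S : adjointable T -> adjointable S ->
  adjointable (fun x => c *: T x + S x).
Proof.
move=> [T' aT] [S' aS]; exists (fun x => (c^*)%R *: T' x + S' x) => x y; apply/funext => p.
by rewrite ip_lin ip_linl aT aS.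
Qed.

Lemma convolver_lin (c : Cplx R) F K T S : CcH F -> CcH K -> convolver F T -> convolver K S ->
  convolver (fun A => c * F A + K A) (fun x => c *: T x + S x).
Proof.
move=> CF CK [aT bT hT] [aS bS hS]; split; first exact: adjointable_linop.
  exact: op_bounded_lin.
move=> K' CK'; rewrite hT // hS // -embZD; try exact: (CcH_conv tG etG hU hX).
by congr emb; apply/funext => A; rewrite conv_scale_l //; exact: (CcH_fibre_finite tG etG hU hX).
Qed.

Lemma convolver_elem V f a T : bis V -> Cc_on V f -> C0 Y a -> convolver (extS f) T ->
  convolver (elem o f a) (T \o RP a).
Proof.
move=> bV Cf Ca [aT [M M0 bT] hT]; have [N [N0 hN]] := C0_bounded tG etG hX Ca.
have [ad em bd] := range_rep_spec Ca N0 hN; split.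
- by have [S aS] := aT; exists (RP (fun A => (a A)^*) \o S) => x y; rewrite /= aS ad.
- exists (M * N) => [|x]; first exact: mulr_ge0.
  by apply: (le_trans (bT _)); rewrite -mulrA; exact: ler_wpM2l.
- move=> K CK; rewrite /= em // hT; last exact: range_mul_CcH.
  congr emb; apply/funext => A; rewrite (conv_elem_l tG etG hU).
  by congr (gconv oH _ _ A); apply/funext => B; rewrite mulrC.
Qed.

Lemma adjointable_zero : @adjointable _ _ _ E (fun=> 0).
Proof. by exists (fun=> 0) => x y; apply/funext => p; rewrite ip0l ip0. Qed.

Lemma convolver0 : convolver (fun=> 0) (fun=> 0).
Proof.
split; first exact: adjointable_zero.
  by exists 0 => // x; rewrite (nrm0 bE) mul0r.
move=> K CK; rewrite -emb0; congr emb; apply/funext => A; rewrite /gconv fsbig1 // => z _.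
by rewrite mul0r.
Qed.

Lemma convolver_ex F : CcH F -> exists T, convolver F T.
Proof.
move=> /(CcH_tspan tG etG hU hX); elim=> [|V f a K bV Cf Ya tK [S hS]].
  by exists (fun=> 0); exact: convolver0.
have [T hT] := convolver_bis bV Cf; have Ca := CcY_C0 tG etG hX Ya.
have CK : CcH K by exact: (tspan_CcH tG etG hU hX).
have Ce : CcH (elem o f a).
  by apply: (elem_CcH tG etG hU hX bV Cf) => A; exact: (C0_cont tG etG hX).
exists (fun x => 1 *: (T \o RP a) x + S x).
have -> : (fun A => elem o f a A + K A) = fun A => 1 * elem o f a A + K A.
  by apply/funext => A; rewrite mul1r.
apply: convolver_lin => //; exact: convolver_elem bV Cf Ca hT.
Qed.

Lemma L_op_convolver F T : convolver F T -> LL F = T.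
Proof. by move=> [aT _ hT]; exact: L_opHE. Qed.

Lemma L_opH_spec F : CcH F -> convolver F (LL F).
Proof. by move=> /convolver_ex[T hT]; rewrite (L_op_convolver hT). Qed.

(** Adjointability provides some [S]; tested against the dense image of [emb], it satisfies the
    specification of [LL (star oH F)]. *)
Lemma L_opH_adj F : CcH F -> adjoint_pair (LL F) (LL (star oH F)).
Proof.
move=> CF; have [[S TS] _ hT] := L_opH_spec CF; suff -> : LL (star oH F) = S by [].
apply: L_opHE => [|K CK]; first by exists (LL F); exact: adjoint_pair_sym.
apply: (ip_dense_inj bE emb_dense) => _ p [K' CK' <-].
rewrite (adjoint_pair_sym TS) hT //; move: p; apply/funeqP; apply: ipH_eq => u uu.
have CsF := CcH_star tG hX CF.
rewrite !ip_emb ?resS_convE ?resS_starE //; try exact: (CcH_conv tG etG hU hX).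
by rewrite conv_adj ?(starK gG) -?resS_starE; try exact: ff.
Qed.

Lemma L_opH_lin (c : Cplx R) F K : CcH F -> CcH K ->
  LL (fun A => c * F A + K A) = fun x => c *: LL F x + LL K x.
Proof. by move=> CF CK; apply: L_op_convolver; apply: convolver_lin => //; exact: L_opH_spec. Qed.

Lemma L_opH_comp F K : CcH F -> CcH K -> LL (gconv oH F K) = LL F \o LL K.
Proof.
move=> CF CK; have [aF _ hF] := L_opH_spec CF; have [aK _ hK] := L_opH_spec CK.
apply: L_opHE => [|K' CK'].
  by have [S aS] := aF; have [S' aS'] := aK; exists (S' \o S) => x y; rewrite /= aS aS'.
have CC := CcH_conv tG etG hU hX.
rewrite /= hK // hF; last exact: (CC).
congr emb; apply: (eq_on_singles hX) => [A|A|x A eA].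
- by apply: CcH_cont; apply: (CC) => //; exact: (CC).
- by apply: CcH_cont; apply: (CC) => //; exact: (CC).
rewrite (single_eq hX eA) !(resS_conv tG etG hU) !resS_convE; symmetry.
by apply: (conv_assoc gG); exact: ff.
Qed.

(* With [CcH_tspan], this expresses every [L(F)] by the generators of part 2. *)
Lemma L_opH_elem V f a : bis V -> Cc_on V f -> C0 Y a -> LL (elem o f a) = LL (extS f) \o RP a.
Proof.
move=> bV Cf Ca; apply: L_op_convolver; apply: (convolver_elem bV Cf Ca).
exact/L_opH_spec/(extS_CcH tG etG hU hX bV Cf).
Qed.

Lemma Cstar_red_hausdorff_Cstar : Cstar_subalgebra_op (Cstar_red_hausdorff oH emb).
Proof.
apply: (norm_closure_Cstar bE).
- by exists (fun=> 0); [exact: CcH0|exact: L_op_convolver convolver0].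
- move=> c _ _ [F CF <-] [K CK <-]; exists (fun A => c * F A + K A); first exact: (CcHZD hX).
  exact: L_opH_lin.
- move=> _ _ [F CF <-] [K CK <-]; exists (gconv oH F K); last exact: L_opH_comp.
  exact: (CcH_conv tG etG hU hX).
- move=> _ [F CF <-]; exists (LL (star oH F)); last exact: L_opH_adj.
  by exists (star oH F) => //; exact: (CcH_star tG hX).
- by move=> _ [F CF <-]; have [] := L_opH_spec CF.
Qed.

Lemma range_rep_Cc k : CcY o k -> RP k = LL k.
Proof.
move=> Yk; have Ck := CcY_C0 tG etG hX Yk; have [Ck' k0] := Yk.
have [aT _ hT] := L_opH_spec Ck'; apply: range_repE => // F CF; rewrite hT //.
congr emb; apply: (eq_on_singles hX) => [A|A|x A eA].
- by apply: CcH_cont; exact: (CcH_conv tG etG hU hX).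
- by apply: CcH_cont; exact: range_mul_CcH.
rewrite (single_eq hX eA) (single_rng tG etG hU) (resS_conv tG etG hU) (conv_units_l gG) //.
by move=> z nz; rewrite resSE k0 // => /(single_unit tG etG).
Qed.

(** [h] is approximated uniformly by compactly supported functions, and [range_rep_spec] bounds the
    operator of a difference by its supremum. *)
Lemma range_rep_in h : C0 Y h -> Cstar_red_hausdorff oH emb (RP h).
Proof.
move=> Ch; have [M [M0 hM]] := C0_bounded tG etG hX Ch.
have [ad em _] := range_rep_spec Ch M0 hM.
split=> [|e e0]; first by exists (RP (fun A => (h A)^*)).
have [k [Ck _] hk] := C0_approx tG etG hU hX Ch e0.
(* [C0_approx] controls [k] on the units only, so it is cut off there by [chiY]. *)
have Yk' := CcY_chiY tG etG hX Ck; set k' := fun A => _ in Yk'.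
have Ck' := CcY_C0 tG etG hX Yk'.
have hk' A : cabs ((-1) * k' A + h A) <= e.
  have [YA|nA] := pselect (Y A); last first.
    by rewrite /k' chiY_out // (C0_out Ch nA) !mulr0 addr0 cabs0 ltW.
  have -> : (-1) * k' A + h A = h A - k A by rewrite /k' chiY_in //; ring.
  exact: hk.
exists (RP k'); first by rewrite range_rep_Cc //; exists k' => //; case: Yk'.
have [N [N0 hN]] := C0_bounded tG etG hX Ck'.
have [ad' em' _] := range_rep_spec Ck' N0 hN.
have Cd := C0_ZD tG etG hX (-1) Ck' Ch.
have [ad2 em2 bd2] := range_rep_spec Cd (ltW e0) hk'.
suff eq : RP (fun A => (-1) * k' A + h A) = fun x => (-1) *: RP k' x + RP h x.
  by move=> x; have := bd2 x; rewrite eq scaleN1r addrC.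
apply: range_repE => [|F CF].
  by apply: adjointable_linop; [exists (RP (fun A => (k' A)^*))|exists (RP (fun A => (h A)^*))].
rewrite em' // em // -embZD; try exact: range_mul_CcH.
by congr emb; apply/funext => A; ring.
Qed.

End HausdorffModule.

(** * The isomorphism *)

Section Transfer.
Variables (R : realType) (P Q : Type) (A : set (P -> Cplx R)) (B : set (Q -> Cplx R)).
Hypothesis bA : forall a, A a -> exists M : R, forall p, cabs (a p) <= M.
Hypothesis bB : forall a, B a -> exists M : R, forall p, cabs (a p) <= M.
Variables (E : hilbert_module A) (F : hilbert_module B) (X : Type) (e1 : X -> E).
Hypothesis de : forall x (e : R), 0 < e -> exists u, hm_norm (x - e1 u) < e.

Lemma ip_suml (I : Type) (s : seq I) (f : I -> E) y p :
  hm_ip (\sum_(i <- s) f i) y p = \sum_(i <- s) hm_ip (f i) y p.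
Proof.
elim: s => [|i s IH]; first by rewrite !big_nil ip0l.
by rewrite !big_cons ipDl IH.
Qed.

Lemma ip_sumr (I : Type) (s : seq I) (f : I -> E) x p :
  hm_ip x (\sum_(i <- s) f i) p = \sum_(i <- s) hm_ip x (f i) p.
Proof.
elim: s => [|i s IH]; first by rewrite !big_nil ip0.
by rewrite !big_cons ipD IH.
Qed.

Lemma lipschitz_eq (T T' : E -> F) (M : R) : 0 <= M ->
  (forall x y, hm_norm (T x - T y) <= M * hm_norm (x - y)) ->
  (forall x y, hm_norm (T' x - T' y) <= M * hm_norm (x - y)) ->
  (forall u, T (e1 u) = T' (e1 u)) -> T = T'.
Proof.
move=> M0 hT hT' h; apply/funext => x; apply/eqP; rewrite -subr_eq0; apply/eqP.
apply: (nrm_eq0 bB); apply: (@small_eq0 _ _ (2 * M)) => e e0; have [u hu] := de x e0.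
have h1 := hT x (e1 u); have h2 := hT' (e1 u) x; rewrite -h (nrmB bA) in h2.
have h3 := nrm_triangle bB (T x) (T (e1 u)) (T' x).
have h4 := ler_wpM2l M0 (ltW hu); lra.
Qed.

(** Values are compared at a point [p] on one side and [q] on the other, before the coefficient
    algebras are identified. *)
Lemma ip_transfer (T : E -> F) (p : P) (q : Q) :
  (forall x y, hm_norm (T x - T y) <= 1 * hm_norm (x - y)) ->
  (forall u v, hm_ip (T (e1 u)) (T (e1 v)) q = hm_ip (e1 u) (e1 v) p) ->
  forall x y, hm_ip (T x) (T y) q = hm_ip x y p.
Proof.
move=> hT h; have step x v : hm_ip (T x) (T (e1 v)) q = hm_ip x (e1 v) p.
  apply/eqP; rewrite -subr_eq0; apply/eqP; apply: cabs_eq0; apply/eqP; rewrite eq_le cabs_ge0 andbT.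
  apply: (@small_eq0 _ _ (hm_norm (T (e1 v)) + hm_norm (e1 v))) => e e0.
  have [u hu] := de x e0.
  have -> : hm_ip (T x) (T (e1 v)) q - hm_ip x (e1 v) p =
      hm_ip (T x - T (e1 u)) (T (e1 v)) q - hm_ip (x - e1 u) (e1 v) p.
    by rewrite ipBl ipBl h; ring.
  apply: (le_trans (cabsD _ _)); rewrite cabsN mulrDl.
  have h0 := hT x (e1 u); rewrite mul1r in h0.
  apply: lerD.
    apply: (le_trans (Cauchy_Schwarz bB _ _ _)); rewrite mulrC.
    by apply: ler_wpM2l; [exact: nrm_ge0|exact: le_trans h0 (ltW hu)].
  apply: (le_trans (Cauchy_Schwarz bA _ _ _)); rewrite mulrC.
  by apply: ler_wpM2l; [exact: nrm_ge0|exact: ltW].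
move=> x y.
apply/eqP; rewrite -subr_eq0; apply/eqP; apply: cabs_eq0; apply/eqP; rewrite eq_le cabs_ge0 andbT.
apply: (@small_eq0 _ _ (hm_norm (T x) + hm_norm x)) => e e0.
have [u hu] := de y e0.
have -> : hm_ip (T x) (T y) q - hm_ip x y p =
    hm_ip (T x) (T y - T (e1 u)) q - hm_ip x (y - e1 u) p.
  by rewrite ipB ipB step; ring.
apply: (le_trans (cabsD _ _)); rewrite cabsN mulrDl.
have h0 := hT y (e1 u); rewrite mul1r in h0.
apply: lerD; apply: (le_trans (Cauchy_Schwarz _ _ _ _)) => //.
  by apply: ler_wpM2l; [exact: nrm_ge0|exact: le_trans h0 (ltW hu)].
by apply: ler_wpM2l; [exact: nrm_ge0|exact: ltW].
Qed.

End Transfer.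

(** * Comparison of L^2(G) with L^2(HG) *)

Section Comparison.
Variables (R : realType) (G : topologicalType) (o : groupoid_data G).
Hypothesis tG : topological_groupoid o.
Hypothesis etG : etale o.
Hypothesis hU : hausdorff_space (set_type (units o)).
Hypothesis hX : locally_compact_space G.
Local Notation gG := (gpdG tG).
Local Notation H := (fellH G).
Local Notation oH := (fell_groupoid o).
Local Notation RR := (grng oH).
Local Notation SS := (gsrc oH).
Local Notation Y := (fell_units o).
Local Notation U0 := (units o).
Local Notation bis := (bisection o).
Local Notation single := (single hX).
Local Notation resS := (resS hX).
Local Notation Cc := (@Cc_span R G).
Local Notation D := (@algD R G o).
Variables (EG : hilbert_module D) (tensor : (G -> Cplx R) -> (G -> Cplx R) -> EG).
Hypothesis EGspec : is_L2 tensor.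
Variables (EH : hilbert_module (@C0 R H Y)) (emb : (H -> Cplx R) -> EH).
Hypothesis EHspec : is_L2_hausdorff oH emb.
Local Notation LL := (L_op_hausdorff oH emb).
Local Notation RP := (range_rep oH emb).
Implicit Types (f g a b : G -> Cplx R) (u : G) (x y : EG) (z w : EH).

Lemma algD_borel a : D a -> bounded_borel U0 a.
Proof. by have [h _ _ _ _] := algD_Cstar R tG etG hU hX; exact: h. Qed.

Lemma algD_bdd a : D a -> exists M : R, forall p, cabs (a p) <= M.
Proof. by move=> /algD_borel/bounded_borelP[_ h _]. Qed.

Lemma algD_out a p : D a -> ~ U0 p -> a p = 0.
Proof. by move=> /algD_borel/bounded_borelP[h _ _]; exact: h. Qed.
Local Notation bG := algD_bdd.
Local Notation bH := (C0_bdd tG etG hX).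

Lemma ext_D_single a u : D a -> ext_D o a (single u) = a u.
Proof. by move=> Da; rewrite -[RHS](congr1 (fun k => k u) (resS_ext_D tG etG hU hX Da)). Qed.

Lemma ext_D_inC0 a : D a -> C0 Y (ext_D o a).
Proof. exact: (ext_D_C0 tG etG hU hX). Qed.

Lemma elem_span_CcH f a : Cc f -> D a -> CcH (elem o f (ext_D o a)).
Proof.
move=> Cf Da; apply: (CcHM hX); first exact: (extS_Cc_span tG etG hU hX).
move=> A; apply: (cont_src tG etG hU hX) => B; exact: (C0_cont tG etG hX _ (ext_D_inC0 Da)).
Qed.

(** Lists of these pairs stand for finite sums of elementary tensors. Different lists may have the
    same sum, which [lipschitz_extension] tolerates. *)
Let pairs : Type := {fa : (G -> Cplx R) * (G -> Cplx R) | Cc fa.1 /\ D fa.2}.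
Let tsum (l : seq pairs) : EG := \sum_(t <- l) tensor (sval t).1 (sval t).2.
Let esum (l : seq pairs) : EH := \sum_(t <- l) emb (elem o (sval t).1 (ext_D o (sval t).2)).

Lemma tensor_dense x (e : R) : 0 < e -> exists l, hm_norm (x - tsum l) < e.
Proof.
move=> e0; have [_ _ _ _ h] := EGspec; have [n [f [a [fa hx]]]] := h x e e0.
pose t (i : 'I_n) : pairs := exist _ (f i, a i) (fa i).
exists [seq t i | i <- index_enum 'I_n].
by rewrite /tsum big_map.
Qed.

(** For [v] in the range fibre of the unit [u], the sources of [inv v] and [inv v ** u] are both
    [u], so the coefficients leave the sum as values at [u]. *)
Lemma ip_elem f a g b u : Cc f -> D a -> Cc g -> D b -> U0 u ->
  hm_ip (emb (elem o f (ext_D o a))) (emb (elem o g (ext_D o b))) (single u) =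
  hm_ip (tensor f a) (tensor g b) u.
Proof.
move=> Cf Da Cg Db uu; have [_ _ -> // _ _] := EGspec.
rewrite (ip_emb tG etG hU hX EHspec) //; try exact: elem_span_CcH.
have eS k c : Cc k -> D c -> resS (elem o k (ext_D o c)) = fun v => k v * c (gsrc o v).
  move=> Ck Dc; apply/funext => v; rewrite resSE /elem (single_src tG etG hU) ext_D_single //.
  by rewrite (extS_single k (singleE hX v)).
rewrite !eS // restrE; case: pselect => // uu'.
have ru : grng o u = u by apply/(g_unitP gG).
rewrite /gconv mulr_fsumr mulr_fsuml; apply: eq_fsbigr => v /set_mem ev.
have ev' : grng o v = grng o u := ev.
rewrite /star (g_si gG) ev' ru (g_sM gG) ?(g_si gG) // (g_unit_s gG uu) conjM.
by rewrite mulrA; congr (_ * _); rewrite -mulrA mulrCA mulrA.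
Qed.

Lemma ip_sums l l' u : U0 u -> hm_ip (esum l) (esum l') (single u) = hm_ip (tsum l) (tsum l') u.
Proof.
move=> uu; rewrite /esum /tsum !ip_suml; apply: eq_bigr => -[[f a] [/= Cf Da]] _.
rewrite !ip_sumr; apply: eq_bigr => -[[g b] [/= Cg Db]] _; exact: ip_elem.
Qed.

(** Both norms are suprema over units of [G]: functions in D vanish elsewhere, and C_0 functions are
    bounded by their values there. *)
Lemma nrm_GH x z : (forall u, U0 u -> hm_ip z z (single u) = hm_ip x x u) -> hm_norm z = hm_norm x.
Proof.
move=> h; apply/eqP; rewrite eq_le; apply/andP; split.
  apply: (nrmH_le tG etG (hX := hX)) => [|u uu]; first exact: nrm_ge0.
  by rewrite h //; exact: (ip_self_le bG).
apply/(nrm_le bG) => [|p]; first exact: nrm_ge0.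
have [up|np] := pselect (U0 p); first by rewrite -h //; exact: (ip_self_le bH).
by rewrite (algD_out (ip_in x x) np) cabs0 sqr_ge0.
Qed.

Lemma nrm_sums l l' : hm_norm (esum l - esum l') = hm_norm (tsum l - tsum l').
Proof. by apply: nrm_GH => u uu; rewrite !ipB !ipBl !ip_sums. Qed.

(** The coefficient [a] of an elementary summand is the extension of [resS a], which lies in D by
    [resS_algD]; so every [emb F] is itself some [esum l]. *)
Lemma esum_dense z (e : R) : 0 < e -> exists l, hm_norm (z - esum l) < e.
Proof.
move=> e0; have [_ [F CF <-] zF] := emb_dense EHspec z e0.
suff [l el] : exists l, emb F = esum l by exists l; rewrite -el.
elim: (CcH_tspan tG etG hU hX CF) => {F CF zF} [|V f a F bV Cf Ya tF [l el]].
  by exists [::]; rewrite (emb0 EHspec) /esum big_nil.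
have Ca := CcY_C0 tG etG hX Ya; have Da := resS_algD tG etG hU hX Ca.
have Cf' := Cc_span_bis tG etG hU hX bV Cf.
exists ((exist _ (f, resS a) (conj Cf' Da) : pairs) :: l).
rewrite /esum big_cons -/(esum l) -el /= (ext_DE tG etG hX Ca) (embD EHspec) //.
  by apply: (elem_CcH tG etG hU hX bV Cf) => A; exact: (C0_cont tG etG hX).
exact: (tspan_CcH tG etG hU hX).
Qed.

(* [esum] and [tsum] have equal norms, and [esum] is dense because it reaches every [emb F]. *)
Lemma comparison_maps : exists (Phi : EG -> EH) (Psi : EH -> EG),
  [/\ cancel Phi Psi, cancel Psi Phi,
    forall f a, Cc f -> D a -> Phi (tensor f a) = emb (elem o f (ext_D o a)) &
    forall x y u, U0 u -> hm_ip (Phi x) (Phi y) (single u) = hm_ip x y u].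
Proof.
have iso l l' : hm_norm (esum l - esum l') <= 1 * hm_norm (tsum l - tsum l').
  by rewrite mul1r nrm_sums.
have osi l l' : hm_norm (tsum l - tsum l') <= 1 * hm_norm (esum l - esum l').
  by rewrite mul1r nrm_sums.
have [Phi [Pe Pl]] := lipschitz_extension bG bH tensor_dense ler01 iso.
have [Psi [Qe Ql]] := lipschitz_extension bH bG esum_dense ler01 osi.
exists Phi, Psi; split.
- suff : Psi \o Phi = id by move=> h x; exact: (congr1 (@^~ x) h).
  apply: (lipschitz_eq bG bG tensor_dense ler01) => [x y|x y|l] /=.
  + by apply: (le_trans (Ql _ _)); rewrite mul1r.
  + by rewrite mul1r.
  + by rewrite Pe Qe.
- suff : Phi \o Psi = id by move=> h x; exact: (congr1 (@^~ x) h).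
  apply: (lipschitz_eq bH bH esum_dense ler01) => [x y|x y|l] /=.
  + by apply: (le_trans (Pl _ _)); rewrite mul1r.
  + by rewrite mul1r.
  + by rewrite Qe Pe.
- move=> f a Cf Da; have := Pe [:: exist _ (f, a) (conj Cf Da)].
  by rewrite /tsum /esum !big_seq1.
- move=> x y u uu; apply: (ip_transfer bG bH tensor_dense Pl) => l l'.
  by rewrite !Pe ip_sums.
Qed.

Section WithPhi.
Variables (Phi : EG -> EH) (Psi : EH -> EG).
Hypothesis PhiK : cancel Phi Psi.
Hypothesis PsiK : cancel Psi Phi.
Hypothesis Phi_tensor : forall f a, Cc f -> D a -> Phi (tensor f a) = emb (elem o f (ext_D o a)).
Hypothesis Phi_ip : forall x y u, U0 u -> hm_ip (Phi x) (Phi y) (single u) = hm_ip x y u.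

Lemma ipG_eq x y x' y' : (forall u, U0 u -> hm_ip x y u = hm_ip x' y' u) -> hm_ip x y = hm_ip x' y'.
Proof.
move=> h; apply/funext => p; have [/h//|np] := pselect (U0 p).
by rewrite (algD_out (ip_in x y) np) (algD_out (ip_in x' y') np).
Qed.

(** [Phi] comes from a Lipschitz extension without linear structure. It is linear because it
    preserves inner products and is surjective, [Psi] being its inverse. *)
Lemma Phi_lin (c : Cplx R) x y : Phi (c *: x + y) = c *: Phi x + Phi y.
Proof.
apply: (ipH_inj tG etG (hX := hX)) => z u uu.
by rewrite -(PsiK z) ip_linl !Phi_ip // ip_linl.
Qed.

Lemma PhiB x y : Phi (x - y) = Phi x - Phi y.
Proof. by rewrite addrC -scaleN1r Phi_lin scaleN1r addrC. Qed.

Lemma Phi_nrm x : hm_norm (Phi x) = hm_norm x.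
Proof. by apply: nrm_GH => u uu; rewrite Phi_ip. Qed.

Lemma Psi_nrm z : hm_norm (Psi z) = hm_norm z.
Proof. by rewrite -Phi_nrm PsiK. Qed.

Lemma Phi_ext_D x y : hm_ip (Phi x) (Phi y) = ext_D o (hm_ip x y).
Proof.
apply: (C0_eq tG etG (hX := hX)) => [||u uu]; first exact: ip_in.
  by apply: ext_D_inC0; exact: ip_in.
by rewrite Phi_ip // ext_D_single //; exact: ip_in.
Qed.

Lemma Phi_act x a : D a -> Phi (hm_act x a) = hm_act (Phi x) (ext_D o a).
Proof.
move=> Da; apply: (ipH_inj tG etG (hX := hX)) => z u uu; rewrite -(PsiK z) Phi_ip //.
have [_ _ _ hG] := hm_act_axioms EG; have [_ _ _ hH] := hm_act_axioms EH.
rewrite ip_sym hG // [RHS]ip_sym hH; last exact: ext_D_inC0.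
by rewrite Phi_ip // ext_D_single.
Qed.

Lemma adjoint_Phi T S : adjoint_pair T S -> adjoint_pair (Phi \o T \o Psi) (Phi \o S \o Psi).
Proof.
move=> TS z w; apply: (ipH_eq tG etG (hX := hX)) => u uu.
have e1 := Phi_ip (T (Psi z)) (Psi w) uu; have e2 := Phi_ip (Psi z) (S (Psi w)) uu.
by rewrite PsiK in e1; rewrite PsiK in e2; rewrite /= e1 e2 TS.
Qed.

Lemma adjoint_Psi T S : adjoint_pair T S -> adjoint_pair (Psi \o T \o Phi) (Psi \o S \o Phi).
Proof.
move=> TS x y; apply: ipG_eq => u uu.
by rewrite -!Phi_ip //= !PsiK TS.
Qed.

(** The transported operator satisfies the specification of [L_op], because coefficients on the
    right pass through convolution by [conv_elem_r]. *)
Lemma L_op_ext f : Cc f -> L_op tensor f = Psi \o LL (extS f) \o Phi.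
Proof.
move=> Cf; have CF := extS_Cc_span tG etG hU hX Cf.
have [aL _ hL] := L_opH_spec tG etG hU hX EHspec CF.
apply: (the_operatorE bG (D := range tsum)).
- by move=> x e /(tensor_dense x)[l hl]; exists (tsum l) => //; exists l.
- move=> T1 T2 a1 a2 h1 h2 _ [l _ <-]; rewrite /tsum !adjointable_sum //.
  by apply: eq_bigr => -[[g a] [/= Cg Da]] _; rewrite h1 // h2.
- by have [S TS] := aL; exists (Psi \o S \o Phi); exact: adjoint_Psi.
- move=> g a Cg Da; rewrite /= Phi_tensor // hL; last exact: elem_span_CcH.
  apply: (can_inj PhiK); rewrite PsiK Phi_tensor //; last exact: (Cc_span_conv tG etG hU hX).
  have Cfg := Cc_span_conv tG etG hU hX Cf Cg.
  congr emb; apply: (eq_on_singles hX) => [A|A|x A eA].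
  + by apply: CcH_cont; apply: (CcH_conv tG etG hU hX) => //; exact: elem_span_CcH.
  + by apply: CcH_cont; exact: elem_span_CcH.
  rewrite (conv_elem_r tG etG hU) /elem; congr (_ * _).
  rewrite (single_eq hX eA) (resS_conv tG etG hU) !resS_extS.
  by rewrite (extS_single _ (singleE hX x)).
Qed.

Lemma Phi_L_op f : Cc f -> Phi \o L_op tensor f \o Psi = LL (extS f).
Proof. by move=> Cf; rewrite L_op_ext //; apply/funext => z /=; rewrite !PsiK. Qed.

Lemma L_op_in_Cstar_red f : Cc f -> Cstar_red tensor (L_op tensor f).
Proof.
move=> Cf; split; last first.
  by move=> e e0; exists (L_op tensor f) => [|x]; [exists f|rewrite subrr (nrm0 bG) mulr_ge0 ?nrm_ge0 ?ltW].
rewrite L_op_ext //.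
have [[S TS] _ _] := L_opH_spec tG etG hU hX EHspec (extS_Cc_span tG etG hU hX Cf).
by exists (Psi \o S \o Phi); exact: adjoint_Psi.
Qed.

Lemma Phi_Cstar_red T : Cstar_red tensor T -> Cstar_red_hausdorff oH emb (Phi \o T \o Psi).
Proof.
move=> [[S TS] hT]; split; first by exists (Phi \o S \o Psi); exact: adjoint_Phi.
move=> e e0; have [_ [f Cf <-] hf] := hT e e0; exists (LL (extS f)).
  by exists (extS f) => //; exact: (extS_Cc_span tG etG hU hX).
by move=> z; rewrite -Phi_L_op //= -PhiB Phi_nrm -[hm_norm z]Psi_nrm.
Qed.

Lemma Cstar_generated_Phi :
  Cstar_generated ([set Phi \o T \o Psi | T in Cstar_red tensor] `|` (RP @` C0 Y)) =
  Cstar_red_hausdorff oH emb.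
Proof.
rewrite eqEsubset; split.
  apply: smallest_sub; first exact: (Cstar_red_hausdorff_Cstar tG etG hU hX EHspec).
  move=> _ [[T cT <-]|[h Ch <-]]; first exact: Phi_Cstar_red.
  exact: (range_rep_in tG etG hU hX EHspec).
(* [B] is any C*-subalgebra containing the generators; being norm closed, it contains [T] once it
   contains every [LL F]. *)
move=> T [aT hT] B [[_ B0 BZD [BM _] Bcl] gB]; apply: Bcl; split=> // e /hT[_ [F CF <-] hF].
exists (LL F) => //; elim: (CcH_tspan tG etG hU hX CF) => {F CF hF} [|V f a F bV Cf Ya tF BF].
  by rewrite (L_op_convolver tG etG hX EHspec (convolver0 tG etG hX EHspec)).
have Ca := CcY_C0 tG etG hX Ya; have CF : CcH F by exact: (tspan_CcH tG etG hU hX).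
have Ce : CcH (elem o f a).
  by apply: (elem_CcH tG etG hU hX bV Cf) => A; exact: (C0_cont tG etG hX).
have -> : (fun A => elem o f a A + F A) = fun A => 1 * elem o f a A + F A.
  by apply/funext => A; rewrite mul1r.
rewrite (L_opH_lin tG etG hU hX EHspec) //; apply: BZD => //.
rewrite (L_opH_elem tG etG hU hX EHspec bV Cf Ca); apply: BM; apply: gB; last by right; exists a.
have Cf' := Cc_span_bis tG etG hU hX bV Cf.
left; exists (L_op tensor f); first exact: L_op_in_Cstar_red.
exact: Phi_L_op.
Qed.

End WithPhi.
End Comparison.

Theorem proposition3p5 (R : realType) (G : topologicalType)
    (o : groupoid_data G)
    (G_groupoid : topological_groupoid o)
    (G_locally_compact : locally_compact_space G)
    (G_etale : etale o)
    (G_open_range : open_range_map o)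
    (G_hausdorff_units : hausdorff_space (set_type (units o)))
    (L2G : hilbert_module (@algD R G o))
    (tensor : (G -> Cplx R) -> (G -> Cplx R) -> L2G)
    (L2G_spec : is_L2 tensor)
    (L2HG : hilbert_module (@C0 R (fellH G) (fell_units o)))
    (emb : (fellH G -> Cplx R) -> L2HG)
    (L2HG_spec : is_L2_hausdorff (fell_groupoid o) emb) :
  exists (Phi : L2G -> L2HG) (Psi : L2HG -> L2G),
    [/\ hilbert_iso (ext_D o) Phi Psi,
        forall f a, Cc_span f -> algD o a ->
          Phi (tensor f a) =
          emb (fun A => ext_Cc f A * ext_D o a (gsrc (fell_groupoid o) A)) &
        Cstar_generated
          ([set Phi \o T \o Psi | T in Cstar_red tensor] `|`
           (range_rep (fell_groupoid o) emb @` C0 (fell_units o))) =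
        Cstar_red_hausdorff (fell_groupoid o) emb].
Proof.
have tG := G_groupoid; have etG := G_etale; have hU := G_hausdorff_units; have hX := G_locally_compact.
have [Phi [Psi [PhiK PsiK Pt Pip]]] := comparison_maps tG etG hU hX L2G_spec L2HG_spec.
exists Phi, Psi; split.
- split=> //.
  + exact: Phi_lin Pip.
  + exact: Phi_ext_D Pip.
  + exact: Phi_act Pip.
- by move=> f a Cf Da; rewrite Pt // (ext_CcE G_groupoid) //.
- exact: Cstar_generated_Phi Pip.
Qed.
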